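(* Let $G=(V,E,\mu,w)$ be a connected, locally finite and stochastically complete graph. Let $s\in(0,1)$, $p\in[2,+\infty)$ and assume $\inf_{x\in V}\mu(x)>0$. Suppose $h:V\to\mathbb R$ satisfies $h_0=\inf_{x\in V}h(x)>0$ and, for any fixed $x_0\in V$, $h(x)\to+\infty$ as $\mathrm d(x,x_0)\to+\infty$. Suppose $f:V\times\mathbb R\to\mathbb R$, with $F(x,y)=\int_0^yf(x,t)\,dt$, satisfies: (A1) $f(x,y)$ is continuous with respect to $y\ge0$, and $f(x,0)=0$ for any $x\in V$; (A2) for any constant $M>0$ there exists a constant $C_M$ such that $f(x,y)\le C_M$ for any $(x,y)\in V\times[0,M]$; (A3) there exists a constant $\alpha>p$ such that $0<\alpha F(x,y)\le yf(x,y)$ for any $x\in V$ and $y>0$; (A4) $\displaystyle\limsup_{y\to0^+}\frac{f(x,y)}{y^{p-1}}<\lambda_p=\inf_{u\in\mathcal H_{s,p}(V),\,u\not\equiv0}\frac{\int_V(|\nabla^su|^p+h|u|^p)\,d\mu}{\int_V|u|^p\,d\mu}$ uniformly in $x\in V$; (A5) for any $x\in V$, $f(x,y)/y^{p-1}$ is strictly increasing with respect to $y>0$. Then the fractional $p$-Laplace equation $$(-\Delta)_p^su+h|u|^{p-2}u=f(x,u)\quad\text{in }V$$ has a strictly positive ground state solution in $\mathcal H_{s,p}(V)$.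
   Context: $G=(V,E,\mu,w)$ is a weighted graph with countable vertex set $V$, edge set $E$, positive vertex measure $\mu:V\to(0,+\infty)$ and positive symmetric edge weight $w_{xy}=w_{yx}>0$ ($xy\in E$); locally finite means every vertex has finitely many neighbours. $\mathrm d(x,x_0)$ is the minimal number of edges of a path between $x$ and $x_0$. Write $\int_V g\,d\mu=\sum_{x\in V}g(x)\mu(x)$. Let $p(t,x,y)$ be the (minimal) heat kernel of $G$, i.e. of the Laplacian $\Delta u(x)=\frac1{\mu(x)}\sum_{y\sim x}w_{xy}(u(y)-u(x))$. $G$ is stochastically complete if $\sum_{y\in V}p(t,x,y)\mu(y)=1$ for all $t>0$, $x\in V$. (The exponent $p$ is unrelated to the heat kernel.) For $x\ne y\in V$, set $$W_s(x,y)=\frac{s}{\Gamma(1-s)}\mu(x)\mu(y)\int_0^{+\infty}p(t,x,y)\,t^{-1-s}\,dt,$$ where $\Gamma(\cdot)$ is the Gamma function. For bounded $u,v:V\to\mathbb R$, $$\nabla^su\nabla^sv(x)=\frac1{2\mu(x)}\sum_{y\in V,\,y\ne x}W_s(x,y)(u(x)-u(y))(v(x)-v(y)),\qquad |\nabla^su|(x)=\sqrt{\nabla^su\nabla^su(x)},$$ and the fractional $p$-Laplace operator is $$(-\Delta)_p^su(x)=\frac1{2\mu(x)}\sum_{y\in V,\,y\ne x}W_s(x,y)\big(|\nabla^su|^{p-2}(x)+|\nabla^su|^{p-2}(y)\big)(u(x)-u(y)).$$ $C_c(V)$ is the set of functions $V\to\mathbb R$ with finite support. $\mathcal H_{s,p}(V)$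 is the completion of $C_c(V)$ under the norm $\|u\|_{\mathcal H_{s,p}(V)}=(\int_V(|\nabla^su|^p+h|u|^p)\,d\mu)^{1/p}$, regarded as a space of bounded functions on $V$ (this norm dominates a multiple of the sup norm). $u\in\mathcal H_{s,p}(V)$ is a (weak) solution of the equation if $$\int_V\big(|\nabla^su|^{p-2}\nabla^su\nabla^s\varphi+h|u|^{p-2}u\varphi\big)d\mu=\int_Vf(x,u)\varphi\,d\mu\quad\forall\varphi\in\mathcal H_{s,p}(V);$$ such a $u$ is also a point-wise solution. Strictly positive means $u(x)>0$ for all $x\in V$. With $u^+=\max\{u,0\}$, let $$E_{s,p}(u)=\frac1p\int_V(|\nabla^su|^p+h|u|^p)\,d\mu-\int_VF(x,u^+)\,d\mu,$$ $$\mathcal N_{s,p}=\Big\{u\in\mathcal H_{s,p}(V)\setminus\{0\}:\int_V(|\nabla^su|^p+h|u|^p)\,d\mu=\int_Vf(x,u^+)u^+\,d\mu\Big\},\qquad e_{s,p}=\inf_{u\in\mathcal N_{s,p}}E_{s,p}(u).$$ A ground state solution is a solution $u\in\mathcal N_{s,p}$ with $E_{s,p}(u)=e_{s,p}$. *)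

(* Defs.v *)
From mathcomp Require Import all_boot all_order all_algebra.
From mathcomp Require Import all_classical all_reals all_analysis.
Import Order.TTheory GRing.Theory Num.Theory.
Import numFieldNormedType.Exports.

Set Implicit Arguments.
Unset Strict Implicit.
Unset Printing Implicit Defensive.

Local Open Scope classical_set_scope.
Local Open Scope ring_scope.

(* Loops are not excluded: they contribute nothing to the Laplacian, to
   distances or to connectedness.  Off the edges the values of [weight] are
   irrelevant. *)
Record weighted_graph (R : realType) (V : countType) := WeightedGraph {
  edge : rel V;
  mu : V -> R;
  weight : V -> V -> R;
  edge_sym : forall x y, edge x y = edge y x;
  mu_gt0 : forall x, 0 < mu x;
  weight_sym : forall x y, edge x y -> weight x y = weight y x;
  weight_gt0 : forall x y, edge x y -> 0 < weight x y
}.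

Definition locally_finite (R : realType) (V : countType)
    (G : weighted_graph R V) : Prop :=
  forall x, finite_set [set y | edge G x y].

Definition walk (R : realType) (V : countType) (G : weighted_graph R V)
    (x y : V) (n : nat) : Prop :=
  exists q : seq V, [/\ path (edge G) x q, last x q = y & size q = n].

Definition connected_graph (R : realType) (V : countType)
    (G : weighted_graph R V) : Prop :=
  [set: V] !=set0 /\ forall x y, exists n, walk G x y n.

(* The default value 0 is only taken when no walk joins x and y. *)
Definition graph_dist (R : realType) (V : countType) (G : weighted_graph R V)
    (x y : V) : nat :=
  xget 0%N [set n | walk G x y n /\ forall m, walk G x y m -> (n <= m)%N].

(* Absolutely convergent sum of a real family, as the difference of the sums
   of its positive and negative parts (meaningless unless summable). *)
Definition vsum (R : realType) (V : countType) (A : set V) (g : V -> R) : R :=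
  fine ((\esum_(x in A) (EFin \o g)^\+ x) - (\esum_(x in A) (EFin \o g)^\- x))%E.

(* Integral against mu of a nonnegative function, possibly +oo. *)
Definition vint_ge0 (R : realType) (V : countType) (G : weighted_graph R V)
    (g : V -> R) : \bar R :=
  (\esum_(x in [set: V]) (g x * mu G x)%:E)%E.

Definition vintegrable (R : realType) (V : countType) (G : weighted_graph R V)
    (g : V -> R) : Prop :=
  summable [set: V] (fun x => (g x * mu G x)%:E).

Definition vint (R : realType) (V : countType) (G : weighted_graph R V)
    (g : V -> R) : R :=
  vsum [set: V] (fun x => g x * mu G x).

(* A finitely supported sum, by local finiteness. *)
Definition laplacian (R : realType) (V : countType) (G : weighted_graph R V)
    (u : V -> R) (x : V) : R :=
  (mu G x)^-1 *
    \sum_(y \in [set y | edge G x y]) (weight G x y * (u y - u x)).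

Definition dirichlet_laplacian (R : realType) (V : countType)
    (G : weighted_graph R V) (Om : set V) (u : V -> R) (x : V) : R :=
  \1_Om x * laplacian G (fun y => \1_Om y * u y) x.

(* For Om finite, the kernel with respect to mu of the semigroup
   exp(t Delta_Om) on functions supported in Om, extended by 0; that is,
   the power series of the exponential applied to the initial datum
   1_{y} / mu(y), restricted to Om. *)
Definition dirichlet_heat_kernel (R : realType) (V : countType)
    (G : weighted_graph R V) (Om : set V) (t : R) (x y : V) : R :=
  limn (series (fun k : nat =>
    t ^+ k / k`!%:R *
    iter k (dirichlet_laplacian G Om)
      (fun z => \1_Om z * \1_[set y] z / mu G y) x)).

(* The minimal heat kernel: the limit of the Dirichlet heat kernels along an
   exhaustion of V by finite sets.  They increase with Om, so the limit is
   the supremum over all finite sets; it is finite because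
   p_Om(t,x,y) mu(y) <= 1. *)
Definition heat_kernel (R : realType) (V : countType) (G : weighted_graph R V)
    (t : R) (x y : V) : R :=
  sup [set dirichlet_heat_kernel G Om t x y | Om in [set Om | finite_set Om]].

Definition stochastically_complete (R : realType) (V : countType)
    (G : weighted_graph R V) : Prop :=
  forall (t : R) (x : V), 0 < t ->
    (\esum_(y in [set: V]) (heat_kernel G t x y * mu G y)%:E = 1)%E.

Definition Gamma (R : realType) (z : R) : R :=
  \int[lebesgue_measure]_(t in `]0, +oo[) (t `^ (z - 1) * expR (- t)).

(* Only used for x <> y, where the integral converges. *)
Definition Ws (R : realType) (V : countType) (G : weighted_graph R V)
    (s : R) (x y : V) : R :=
  s / Gamma (1 - s) * mu G x * mu G y *
    \int[lebesgue_measure]_(t in `]0, +oo[)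
      (heat_kernel G t x y * t `^ (-1 - s)).

Definition frac_grad_prod (R : realType) (V : countType)
    (G : weighted_graph R V) (s : R) (u v : V -> R) (x : V) : R :=
  (2 * mu G x)^-1 *
    vsum [set~ x] (fun y => Ws G s x y * (u x - u y) * (v x - v y)).

Definition frac_grad_norm (R : realType) (V : countType)
    (G : weighted_graph R V) (s : R) (u : V -> R) (x : V) : R :=
  Num.sqrt (frac_grad_prod G s u u x).

(* Since 0 `^ 0 = 1, the factor |grad u|^(p-2) is 1 when p = 2. *)
Definition frac_p_laplacian (R : realType) (V : countType)
    (G : weighted_graph R V) (s p : R) (u : V -> R) (x : V) : R :=
  (2 * mu G x)^-1 *
    vsum [set~ x] (fun y => Ws G s x y *
      (frac_grad_norm G s u x `^ (p - 2) + frac_grad_norm G s u y `^ (p - 2)) *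
      (u x - u y)).

Definition p_energy (R : realType) (V : countType) (G : weighted_graph R V)
    (s p : R) (h : V -> R) (u : V -> R) : \bar R :=
  vint_ge0 G (fun x => frac_grad_norm G s u x `^ p + h x * `|u x| `^ p).

Definition Hsp_norm (R : realType) (V : countType) (G : weighted_graph R V)
    (s p : R) (h : V -> R) (u : V -> R) : \bar R :=
  (p_energy G s p h u `^ p^-1)%E.

Definition Cc (R : realType) (V : countType) : set (V -> R) :=
  [set u | finite_set [set x | u x != 0]].

(* The completion of Cc realised as a space of bounded functions: the norm
   dominates a multiple of the sup norm, so a Cauchy sequence converges
   uniformly and its class is identified with its uniform limit. *)
Definition Hsp (R : realType) (V : countType) (G : weighted_graph R V)
    (s p : R) (h : V -> R) : set (V -> R) :=
  [set u | exists u_ : nat -> V -> R,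
    [/\ forall n, Cc (u_ n),
        forall eps : R, 0 < eps -> exists N : nat, forall m n : nat,
          (N <= m)%N -> (N <= n)%N ->
          (Hsp_norm G s p h (fun x => (u_ m x - u_ n x)%R) < eps%:E)%E
      & forall eps : R, 0 < eps ->
          \forall n \near \oo, forall x, `|u_ n x - u x| < eps]].

(* F(x, y); only used for y >= 0. *)
Definition primitive (R : realType) (V : countType) (f : V -> R -> R)
    (x : V) (y : R) : R :=
  \int[lebesgue_measure]_(t in `[0, y]) f x t.

Definition pos_part (R : realType) (V : countType) (u : V -> R) (x : V) : R :=
  Num.max (u x) 0.

Definition lambda_p (R : realType) (V : countType) (G : weighted_graph R V)
    (s p : R) (h : V -> R) : \bar R :=
  ereal_inf [set (p_energy G s p h u / vint_ge0 G (fun x => `|u x| `^ p)%R)%E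
            | u in [set u | Hsp G s p h u /\ u <> (fun=> 0)]].

(* Convergence of the sums is part of the notion of weak solution. *)
Definition weak_solution (R : realType) (V : countType)
    (G : weighted_graph R V) (s p : R) (h : V -> R) (f : V -> R -> R)
    (u : V -> R) : Prop :=
  Hsp G s p h u /\
  forall phi : V -> R, Hsp G s p h phi ->
    let lhs x := frac_grad_norm G s u x `^ (p - 2) * frac_grad_prod G s u phi x
                 + h x * `|u x| `^ (p - 2) * u x * phi x in
    let rhs x := f x (u x) * phi x in
    [/\ vintegrable G lhs, vintegrable G rhs & vint G lhs = vint G rhs].

Definition pointwise_solution (R : realType) (V : countType)
    (G : weighted_graph R V) (s p : R) (h : V -> R) (f : V -> R -> R)
    (u : V -> R) : Prop :=
  forall x, frac_p_laplacian G s p u x + h x * `|u x| `^ (p - 2) * u x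
            = f x (u x).

Definition functional (R : realType) (V : countType) (G : weighted_graph R V)
    (s p : R) (h : V -> R) (f : V -> R -> R) (u : V -> R) : \bar R :=
  ((p^-1)%:E * p_energy G s p h u
   - vint_ge0 G (fun x => primitive f x (pos_part u x)))%E.

Definition nehari (R : realType) (V : countType) (G : weighted_graph R V)
    (s p : R) (h : V -> R) (f : V -> R -> R) : set (V -> R) :=
  [set u | [/\ Hsp G s p h u, u <> (fun=> 0)
    & p_energy G s p h u
      = vint_ge0 G (fun x => f x (pos_part u x) * pos_part u x)]].

Definition ground_level (R : realType) (V : countType) (G : weighted_graph R V)
    (s p : R) (h : V -> R) (f : V -> R -> R) : \bar R :=
  ereal_inf [set functional G s p h f u | u in nehari G s p h f].

Definition ground_state_solution (R : realType) (V : countType)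
    (G : weighted_graph R V) (s p : R) (h : V -> R) (f : V -> R -> R)
    (u : V -> R) : Prop :=
  [/\ weak_solution G s p h f u, nehari G s p h f u
    & functional G s p h f u = ground_level G s p h f].

(* Main.v *)
Require Import Defs.
From mathcomp Require Import all_boot all_order all_algebra finmap.
From mathcomp Require Import all_classical all_reals all_analysis.
From mathcomp Require Import measurable_realfun ring lra.
From mathcomp Require summability.
Import Order.TTheory GRing.Theory Num.Theory.
Import numFieldNormedType.Exports.

Set Implicit Arguments.
Unset Strict Implicit.
Unset Printing Implicit Defensive.

Local Open Scope classical_set_scope.
Local Open Scope ring_scope.

(** The solution is a minimiser of the functional on the Nehari set.  Four things
    carry the argument.

    _The weights._  The heat kernel enters through four facts about [Ws]: it is
    nonnegative, symmetric, summable in one variable ([Ws_summ]) and positive on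
    edges ([Ws_gt0]).  All come from Dirichlet heat kernels of finite sets.  Euler's
    scheme contracts the sup norm, so these kernels are bounded by [1 / mu y]; the
    one-point set gives [1 - p(t,x,x) mu(x) <= deg(x) t], so stochastic completeness
    leaves a mass of at most [min(1, deg(x) t)] off the diagonal, which is integrable
    against [t^(-1-s)]; and the two-point set gives [p(t,x,y) >= c t] for small [t]
    when [x] and [y] are adjacent.

    _The energy._  For [p >= 2] the energy [|grad u|^p + h |u|^p] satisfies Clarkson's
    inequality pointwise.  Uniform convexity replaces weak compactness: a pointwise
    limit of elements of the space with bounded energy is again in the space
    ([Hsp_closed]), by minimising the energy over shrinking convex neighbourhoods of
    the limit.

    _The minimisation._  Write [B(u)] and [C(u)] for the integrals of [f(x,u+) u+] and
    [F(x,u+)].  On the Nehari set the functional equals [J(u) = B(u) / p - C(u)], the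
    integral of a nonnegative function which by [A5] increases with [u+].  One
    minimises [J] over the larger set of the nonzero [u] with [energy u <= B(u)].  By
    [A3], [J] bounds the energy there.  Along an ultrafilter a minimising sequence
    converges pointwise; as [h] tends to infinity, [B] and [C] converge too, and as
    every [u] in the set has a value of at least [delta0] by [A4], the limit is not
    zero ([relaxed_minimizer]).  A minimiser satisfies [energy u = B(u)], as otherwise
    [t u] with [t < 1] would be better ([minimizer_nehari]).

    _The equation._  If the derivative at the minimiser [u] were not zero in a
    direction [w], then for small [e > 0] and all [t] near 1 the functional at
    [t u + e w] would be below its value at [t u], which is at most the value at [u]
    since [A5] makes the functional largest at [t = 1] on the ray through [u].  The
    intermediate value theorem gives a [t] for which [t u + e w] is on the Nehari set:
    a contradiction ([euler_lagrange]).  Point masses as directions give the pointwise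
    equation with [f(x,u+)].  The value of [u] at a negative minimum would contradict
    it, a zero of [u] would spread along edges to all of the graph, and density of the
    finitely supported functions gives the weak form. *)

(** * Absolutely summable families over a countable type *)

Notation totally := summability.totally.
#[local] Existing Instance summability.totally_filter.

Section Tsum.
Context {R : realType} {V : countType}.
Implicit Types (g k : V -> R) (A B : {fset V}).

Definition psum g A : R := \sum_(i <- A) g i.

(** Estimates on finite partial sums are thereby estimates on sums. *)
Definition summ g : Prop := exists M, forall A, psum (fun x => `|g x|) A <= M.

Definition tsum g : R := vsum [set: V] g.

Lemma psumD g k A : psum (fun x => g x + k x) A = psum g A + psum k A.
Proof. by rewrite /psum big_split. Qed.

Lemma psumZ c g A : psum (fun x => c * g x) A = c * psum g A.
Proof. by rewrite /psum mulr_sumr. Qed.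

Lemma le_psum g k A : (forall x, g x <= k x) -> psum g A <= psum k A.
Proof. by move=> gk; apply: ler_sum => i _. Qed.

Lemma psum_ge0 g A : (forall x, 0 <= g x) -> 0 <= psum g A.
Proof. by move=> g0; apply: sumr_ge0. Qed.

Lemma psum_subset g A B : (forall x, 0 <= g x) -> (A `<=` B)%fset ->
  psum g A <= psum g B.
Proof.
move=> g0 AB; rewrite /psum [leRHS](big_fsetID _ (mem A)) /=.
rewrite [X in X + _](_ : _ = \sum_(i <- A) g i); last first.
  apply: eq_fbigl => i; rewrite !inE.
  by apply/andP/idP => [[]//|iA]; split => //; exact: (fsubsetP AB).
by rewrite lerDl; apply: sumr_ge0.
Qed.

Lemma esum_psum g : (\esum_(x in [set: V]) (g x)%:E =
  ereal_sup [set (psum g A)%:E | A in [set: {fset V}]])%E.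
Proof.
rewrite /esum; congr ereal_sup; apply/seteqP; split => [_ [A [Af _] <-]|_ [A _ <-]].
  exists (fset_set A) => //.
  by rewrite fsbig_finite//= /psum sumEFin.
exists [set` A]; first by split => //; exact: finite_fset.
by rewrite fsbig_finite ?finite_fset//= set_fsetK sumEFin.
Qed.

Lemma summ_bound g M : (forall x, 0 <= g x) -> (forall A, psum g A <= M) -> summ g.
Proof.
move=> g0 gM; exists M => A; rewrite (_ : (fun x => _) = g)//.
by apply/funext => x; rewrite ger0_norm.
Qed.

Lemma esum_le_psum g M : (forall A, psum g A <= M) <->
  (\esum_(x in [set: V]) (g x)%:E <= M%:E)%E.
Proof.
rewrite esum_psum; split => [gM|gM A].
  by apply: ge_ereal_sup => _ [A _ <-]; rewrite lee_fin.
by rewrite -lee_fin; apply: le_trans gM; apply: ereal_sup_ubound; exists A.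
Qed.

Lemma tsum_ge0E g : (forall x, 0 <= g x) ->
  tsum g = fine (\esum_(x in [set: V]) (g x)%:E)%E.
Proof.
move=> g0; rewrite /tsum /vsum; congr fine.
rewrite [X in (_ - X)%E]esum1 ?sube0; last first.
  by move=> x _; rewrite funenegE /= max_r// lee_fin oppr_le0.
by apply: eq_esum => x _; rewrite funeposE /= max_l// lee_fin.
Qed.

Lemma esum_fin g M : (forall x, 0 <= g x) -> (forall A, psum g A <= M) ->
  (\esum_(x in [set: V]) (g x)%:E = (tsum g)%:E)%E.
Proof.
move=> g0 gM; rewrite tsum_ge0E// fineK// ge0_fin_numE//; last by apply: esum_ge0 => x _;
  rewrite lee_fin.
by move/esum_le_psum : gM => /le_lt_trans; apply; rewrite ltry.
Qed.

Lemma summ_le g k : summ k -> (forall x, `|g x| <= k x) -> summ g.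
Proof.
move=> [M kM] gk; exists M => A; apply: le_trans (kM A); apply: le_psum => x.
exact: le_trans (gk x) (ler_norm _).
Qed.

Lemma summ_norm g : summ (fun x => `|g x|) <-> summ g.
Proof.
split=> [h|[M h]]; first exact: (summ_le h).
by apply: (@summ_bound _ M).
Qed.

Lemma summD g k : summ g -> summ k -> summ (fun x => g x + k x).
Proof.
move=> [M gM] [N kN]; exists (M + N) => A.
apply: (@le_trans _ _ (psum (fun x => `|g x| + `|k x|) A)).
  by apply: le_psum => x; exact: ler_normD.
by rewrite psumD lerD.
Qed.

Lemma summZ c g : summ g -> summ (fun x => c * g x).
Proof.
move=> [M gM]; exists (`|c| * M) => A.
rewrite (_ : psum _ A = `|c| * psum (fun x => `|g x|) A) ?ler_wpM2l//.
by rewrite -psumZ; apply: eq_bigr => x _; rewrite normrM.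
Qed.

Lemma summN g : summ g -> summ (fun x => - g x).
Proof. by move=> [M gM]; exists M => A; rewrite /psum; under eq_bigr do rewrite normrN;
  exact: gM. Qed.

Lemma summB g k : summ g -> summ k -> summ (fun x => g x - k x).
Proof. by move=> gs ks; apply: summD => //; exact: summN. Qed.

Lemma summable_summ g : summable [set: V] (fun x => (g x)%:E) <-> summ g.
Proof.
rewrite /summable; split => [|[M gM]]; last first.
  by apply: le_lt_trans (ltry M); apply/esum_le_psum.
move=> h; exists (fine (\esum_(x in [set: V]) `|(g x)%:E|)%E) => A.
move: A; apply/esum_le_psum; rewrite fineK//.
by rewrite ge0_fin_numE//; exact: esum_ge0.
Qed.

Lemma ge0_tsum_cvg g : (forall x, 0 <= g x) -> summ g -> psum g @ totally --> tsum g.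
Proof.
move=> g0 [M gM].
have gM' A : psum g A <= M.
  by apply: le_trans (gM A); apply: le_psum => x; exact: ler_norm.
have E := esum_fin g0 gM'.
apply/cvgrPdist_le => e e0.
have : ((tsum g - e)%:E < \esum_(x in [set: V]) (g x)%:E)%E.
  by rewrite E lte_fin; lra.
rewrite esum_psum => /ereal_sup_gt[_ [A _ <-]]; rewrite lte_fin => gA.
exists A => // B /= AB.
have gAB := psum_subset g0 AB.
have gB : psum g B <= tsum g.
  by rewrite -lee_fin -E esum_psum; apply: ereal_sup_ubound; exists B.
by rewrite ger0_norm; lra.
Qed.

Lemma tsum_posneg g : summ g ->
  tsum g = tsum (fun x => Num.max (g x) 0) - tsum (fun x => Num.max (- g x) 0).
Proof.
move=> [M gM].
have h1 : forall A, psum (fun x => Num.max (g x) 0) A <= M.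
  by move=> A; apply: le_trans (gM A); apply: le_psum => x; rewrite ge_max normr_ge0 ler_norm.
have h2 : forall A, psum (fun x => Num.max (- g x) 0) A <= M.
  by move=> A; apply: le_trans (gM A); apply: le_psum => x;
    rewrite ge_max normr_ge0 -normrN ler_norm.
have p1 x : 0 <= Num.max (g x) 0 by rewrite le_max lexx orbT.
have p2 x : 0 <= Num.max (- g x) 0 by rewrite le_max lexx orbT.
rewrite {1}/tsum /vsum.
rewrite (_ : esum _ _ = \esum_(x in [set: V]) (Num.max (g x) 0)%:E)%E; last first.
  by apply: eq_esum => x _; rewrite funeposE /= EFin_max.
rewrite (_ : esum _ (_^\-)%E = \esum_(x in [set: V]) (Num.max (- g x) 0)%:E)%E; last first.
  by apply: eq_esum => x _; rewrite funenegE /= EFin_max.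
by rewrite (esum_fin p1 h1) (esum_fin p2 h2).
Qed.

(** The sum is defined through positive and negative parts; as a limit of finite partial
    sums it inherits their algebra. *)
Lemma tsum_cvg g : summ g -> psum g @ totally --> tsum g.
Proof.
move=> gs; rewrite tsum_posneg//.
rewrite (_ : psum g = fun A => psum (fun x => Num.max (g x) 0) A - psum (fun x =>
  Num.max (- g x) 0) A); last first.
  apply/funext => A; rewrite /psum -sumrB; apply: eq_bigr => x _.
  have [h|h] := leP 0 (g x); have [h'|h'] := leP 0 (- g x); lra.
have p1 x : 0 <= Num.max (g x) 0 by rewrite le_max lexx orbT.
have p2 x : 0 <= Num.max (- g x) 0 by rewrite le_max lexx orbT.
apply: cvgB; apply: ge0_tsum_cvg => //; (apply: (summ_le (proj2 (summ_norm g) gs)) => x).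
  by rewrite ger0_norm// ge_max normr_ge0 ler_norm.
by rewrite ger0_norm// ge_max normr_ge0 -normrN ler_norm.
Qed.

Lemma tsum_uniq g l : summ g -> psum g @ totally --> l -> tsum g = l.
Proof. by move=> /tsum_cvg h1 h2; apply: cvg_unique h1 h2. Qed.

Lemma tsumD g k : summ g -> summ k -> tsum (fun x => g x + k x) = tsum g + tsum k.
Proof.
move=> gs ks; apply: tsum_uniq; first exact: summD.
rewrite (_ : psum _ = fun A => psum g A + psum k A); first by apply: cvgD; exact: tsum_cvg.
by apply/funext => A; exact: psumD.
Qed.

Lemma tsumZ c g : summ g -> tsum (fun x => c * g x) = c * tsum g.
Proof.
move=> gs; apply: tsum_uniq; first exact: summZ.
rewrite (_ : psum _ = fun A => c * psum g A); first by apply: cvgMr; exact: tsum_cvg.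
by apply/funext => A; exact: psumZ.
Qed.

Lemma tsumN g : summ g -> tsum (fun x => - g x) = - tsum g.
Proof. by move=> gs; rewrite -mulN1r -tsumZ//; congr tsum; apply/funext => x; rewrite mulN1r. Qed.

Lemma tsumB g k : summ g -> summ k -> tsum (fun x => g x - k x) = tsum g - tsum k.
Proof. by move=> gs ks; rewrite tsumD ?tsumN//; exact: summN. Qed.

Lemma tsum_le_bound g M : summ g -> (forall A, psum g A <= M) -> tsum g <= M.
Proof.
move=> /tsum_cvg gs gM; apply: (cvgr_to_le gs).
exact: nearW.
Qed.

Lemma le_tsum g k : summ g -> summ k -> (forall x, g x <= k x) -> tsum g <= tsum k.
Proof.
move=> gs ks gk; rewrite -subr_ge0 -tsumB//.
apply: (cvgr_to_ge (tsum_cvg (summB ks gs))); apply: nearW => A.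
by apply: psum_ge0 => x; rewrite subr_ge0.
Qed.

Lemma tsum_ge0 g : (forall x, 0 <= g x) -> 0 <= tsum g.
Proof. by move=> g0; rewrite tsum_ge0E// fine_ge0//; apply: esum_ge0 => x _; rewrite lee_fin. Qed.

Lemma psum_le_tsum g A : (forall x, 0 <= g x) -> summ g -> psum g A <= tsum g.
Proof.
move=> g0 gs; apply: (cvgr_to_ge (tsum_cvg gs)).
by exists A => // B /= AB; exact: psum_subset.
Qed.

Lemma le_tsum1 g x : (forall x, 0 <= g x) -> summ g -> g x <= tsum g.
Proof.
by move=> g0 gs; have := psum_le_tsum [fset x]%fset g0 gs; rewrite /psum big_seq_fset1.
Qed.

Lemma normr_tsum g : summ g -> `|tsum g| <= tsum (fun x => `|g x|).
Proof.
move=> gs; have gn := proj2 (summ_norm g) gs.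
rewrite ler_norml -tsumN//; apply/andP; split; apply: le_tsum => //.
- exact: summN.
- by move=> x; rewrite lerNl -normrN ler_norm.
- by move=> x; exact: ler_norm.
Qed.

Lemma tsum_eq0 g : (forall x, 0 <= g x) -> summ g -> tsum g <= 0 -> forall x, g x = 0.
Proof.
by move=> g0 gs g_le x; apply: le_anti; rewrite g0 andbT (le_trans (le_tsum1 x g0 gs)).
Qed.

Lemma summ_finsupp g A : (forall x, x \notin A -> g x = 0) -> summ g /\ tsum g = psum g A.
Proof.
move=> gA.
have H (k : V -> R) B : (forall x, x \notin A -> k x = 0) -> (A `<=` B)%fset -> psum k B = psum k A.
  move=> kA AB; rewrite /psum [LHS](big_fsetID _ (mem A)) /=.
  rewrite [X in _ + X]big_seq_cond [X in _ + X]big1 ?addr0; last first.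
    by move=> i; rewrite !inE /= andbT => /andP[_ /kA].
  by apply: eq_fbigl => i; rewrite !inE; apply/andP/idP => [[]//|iA]; split => //;
    exact: (fsubsetP AB).
have gs : summ g.
  exists (psum (fun x => `|g x|) A) => B.
  rewrite -(H _ (A `|` B)%fset) ?fsubsetUl//; last by move=> x /gA ->; rewrite normr0.
  by apply: psum_subset => //; exact: fsubsetUr.
split => //; apply: tsum_uniq => //.
apply: cvg_near_cst; exists A => // B /= AB; exact: H.
Qed.

Lemma tsum1 g z : (forall x, x != z -> g x = 0) -> summ g /\ tsum g = g z.
Proof.
move=> gz; have [|gs ->] := @summ_finsupp g [fset z]%fset.
  by move=> x; rewrite inE => /gz.
by rewrite /psum big_seq_fset1.
Qed.

Lemma summ_tail g e : summ g -> 0 < e -> exists A : {fset V}, forall B,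
  [disjoint A & B]%fset -> psum (fun x => `|g x|) B <= e.
Proof.
move=> /summ_norm gs e0; have /cvgrPdist_le /(_ e e0)[A _ h] := tsum_cvg gs.
exists A => B AB.
have := h A (fsubset_refl A).
have := psum_le_tsum (A `|` B)%fset (fun x => normr_ge0 (g x)) gs.
have -> : psum (fun x => `|g x|) (A `|` B)%fset = psum (fun x => `|g x|) A + psum (fun x =>
  `|g x|) B.
  rewrite /psum (big_fsetID _ (mem A)) /=; congr (_ + _); apply: eq_fbigl => i; rewrite !inE.
    by apply/andP/idP => [[]//|iA]; rewrite iA.
  apply/andP/idP => [[/orP[->//|//]]|iB]; rewrite iB orbT; split => //.
  by rewrite fdisjoint_sym in AB; exact: (fdisjointP AB).
by rewrite ler_norml => h1 /andP[h2 h3]; lra.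
Qed.

Lemma tsum_tail g k A M : summ g -> (forall x, x \in A -> g x <= k x) ->
  (forall B, [disjoint A & B]%fset -> psum g B <= M) -> tsum g <= psum k A + M.
Proof.
move=> gs gk gM; apply: (cvgr_to_le (tsum_cvg gs)).
exists A => // B /= AB.
rewrite /psum (big_fsetID _ (mem A)) /= lerD//.
  rewrite (_ : \sum_(i <- [fset x | x in B & x \in A]%fset) g i = \sum_(i <- A) g i); last first.
    by apply: eq_fbigl => i; rewrite !inE; apply/andP/idP => [[]//|iA]; split => //;
      exact: (fsubsetP AB).
  by rewrite big_seq [leRHS]big_seq; apply: ler_sum => i; exact: gk.
apply: gM; apply/fdisjointP => x xA; rewrite !inE /= xA andbF//.
Qed.

Lemma cvg_psum {T : Type} (F : set_system T) {FF : Filter F} (g_ : T -> V -> R) g A :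
  (forall x, (fun i => g_ i x) @ F --> g x) -> (fun i => psum (g_ i) A) @ F --> psum g A.
Proof.
move=> gF; rewrite /psum; elim: (enum_fset A) => [|x r IH].
  by under eq_fun do rewrite big_nil; rewrite big_nil; exact: cvg_cst.
by under eq_fun do rewrite big_cons; rewrite big_cons; apply: cvgD.
Qed.

(** Uniformly small tails reduce the convergence to that of one finite partial sum. The
    filter is arbitrary because sequences, one-sided neighbourhoods and an ultrafilter
    are all used. *)
Lemma tight_tsum {T : Type} (F : set_system T) {FF : ProperFilter F}
    (g_ : T -> V -> R) g :
  (\forall i \near F, summ (g_ i)) ->
  (forall e, 0 < e -> exists A : {fset V}, \forall i \near F, forall B,
    [disjoint A & B]%fset -> psum (fun x => `|g_ i x|) B <= e) ->
  (forall x, (fun i => g_ i x) @ F --> g x) ->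
  summ g /\ (fun i => tsum (g_ i)) @ F --> tsum g.
Proof.
move=> gs tail gF.
have cabs A : (fun i => psum (fun x => `|g_ i x|) A) @ F --> psum (fun x => `|g x|) A.
  by apply: cvg_psum => x; exact: cvg_norm.
have tailg A e : (\forall i \near F, forall B,
    [disjoint A & B]%fset -> psum (fun x => `|g_ i x|) B <= e) ->
    forall B, [disjoint A & B]%fset -> psum (fun x => `|g x|) B <= e.
  by move=> h B AB; apply: (cvgr_to_le (cabs B)); apply: filterS h => i; apply.
have summg : summ g.
  have [A /tailg hA] := tail 1 ltr01.
  exists (psum (fun x => `|g x|) A + 1) => B.
  rewrite {1}/psum (big_fsetID _ (mem A)) /= lerD//.
    apply: (@psum_subset (fun x => `|g x|)) => //.
    by apply/fsubsetP => x; rewrite !inE => /andP[].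
  by apply: hA; apply/fdisjointP => x xA; rewrite !inE /= xA andbF.
split=> //; apply/cvgrPdist_le => e e0.
have e4 : 0 < e / 4 by lra.
have [A hA] := tail _ e4; have hg := tailg _ _ hA.
have cA : (fun i => psum (fun x => `|g x - g_ i x|) A) @ F --> (0 : R).
  rewrite (_ : 0 = psum (fun x : V => (0:R)) A); last by rewrite /psum big1.
  apply: cvg_psum => x; rewrite -(normr0 R) -(subrr (g x)).
  by apply: cvg_norm; apply: cvgB => //; exact: cvg_cst.
move/cvgrPdist_le : cA => /(_ _ e4) cA.
near=> i.
have gis : summ (g_ i) by near: i.
have hi : forall B, [disjoint A & B]%fset -> psum (fun x => `|g_ i x|) B <= e / 4 by near: i.
rewrite -tsumB//; apply: le_trans (normr_tsum (summB summg gis)) _.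
have ds : summ (fun x => `|g x - g_ i x|) by apply/summ_norm/summB.
apply: (le_trans (@tsum_tail _ (fun x => `|g x - g_ i x|) A (e/2) ds _ _)) => //.
  move=> B AB; apply: (@le_trans _ _ (psum (fun x => `|g x|) B + psum (fun x => `|g_ i x|) B)).
    by rewrite -psumD; apply: le_psum => x; exact: ler_normB.
  by have := hg B AB; have := hi B AB; lra.
have : `|0 - psum (fun x : V => `|g x - g_ i x|) A| <= e / 4 by near: i.
by rewrite sub0r normrN => /(le_trans (ler_norm _)); lra.
Unshelve. all: by end_near. Qed.

(** A summable majorant makes the tails uniformly small. *)
Lemma dominated_tsum {T : Type} (F : set_system T) {FF : ProperFilter F}
    (g_ : T -> V -> R) g k :
  summ k -> (\forall i \near F, forall x, `|g_ i x| <= k x) ->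
  (forall x, (fun i => g_ i x) @ F --> g x) ->
  summ g /\ (fun i => tsum (g_ i)) @ F --> tsum g.
Proof.
move=> ks gk; apply: tight_tsum.
  by apply: filterS gk => i; exact: summ_le.
move=> e e0; have [A hA] := summ_tail ks e0; exists A.
apply: filterS gk => i gik B AB; apply: le_trans (hA B AB).
by apply: le_psum => x; apply: le_trans (gik x) (ler_norm _).
Qed.

Lemma lt_tsum g k z : summ g -> summ k -> (forall x, g x <= k x) -> g z < k z ->
  tsum g < tsum k.
Proof.
move=> gs ks gk gz; rewrite -subr_gt0 -tsumB//.
have d0 x : 0 <= k x - g x by rewrite subr_ge0.
by apply: lt_le_trans (le_tsum1 z d0 (summB ks gs)); rewrite subr_gt0.
Qed.

(** The bound passes to finite partial sums, then to the limit, and the sum is their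
    supremum. *)
Lemma fatou_tsum {T : Type} (F : set_system T) {FF : ProperFilter F}
    (g_ : T -> V -> R) g M :
  (\forall i \near F, (forall x, 0 <= g_ i x) /\ summ (g_ i) /\ tsum (g_ i) <= M) ->
  (forall x, (fun i => g_ i x) @ F --> g x) ->
  [/\ forall x, 0 <= g x, summ g & tsum g <= M].
Proof.
move=> gM gF.
have g0 x : 0 <= g x.
  by apply: (cvgr_to_ge (gF x)); apply: filterS gM => i [].
have gA A : psum g A <= M.
  apply: (cvgr_to_le (@cvg_psum _ F _ _ _ A gF)); apply: filterS gM => i [g0' [gs]].
  by apply: le_trans; exact: psum_le_tsum.
have gs : summ g := summ_bound g0 gA.
by split => //; exact: tsum_le_bound.
Qed.

End Tsum.

(** * Inequalities between real powers *)

Section PowR.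
Context {R : realType}.
Implicit Types (p q x y A B S D : R).

Lemma le_powR (r x y : R) : 0 <= r -> 0 <= x -> x <= y -> x `^ r <= y `^ r.
Proof. by move=> r0 x0 xy; rewrite ge0_ler_powR// nnegrE// (le_trans x0). Qed.

Lemma powR_midpoint q x y : 1 <= q -> 0 <= x -> 0 <= y ->
  ((x + y) / 2) `^ q <= (x `^ q + y `^ q) / 2.
Proof.
move=> q1 x0 y0.
have h0 : (0 : R) <= 2^-1 by lra.
have h1 : (2^-1 : R) <= 1 by lra.
pose t : {i01 R} := Itv01 h0 h1.
have /= := @convex_powR R q q1 t x y.
rewrite !inE /= !in_itv /= !andbT => /(_ x0 y0).
rewrite [X in _ <= X -> _]convRE /=.
rewrite [X in X `^ _](_ : _ = (x + y) / 2); last first.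
  rewrite -[LHS]/(conv t (x : R^o) (y : R^o)) convRE /= /unstable.onem.
  lra.
move/le_trans; apply; rewrite /unstable.onem; lra.
Qed.

Lemma powR_superadd q x y : 1 <= q -> 0 <= x -> 0 <= y ->
  x `^ q + y `^ q <= (x + y) `^ q.
Proof.
move=> q1 x0 y0.
have q0 : 0 < q by lra.
have E z : 0 <= z -> z `^ q = z * z `^ (q - 1) by move=> z0; rewrite mulr_powRB1.
rewrite !E ?addr_ge0// mulrDl lerD// ler_wpM2l//.
  by apply: le_powR => //; lra.
by apply: le_powR => //; lra.
Qed.

Lemma powR_sqr p x : 0 <= x -> x `^ p = (x ^+ 2) `^ (p / 2).
Proof.
move=> x0; rewrite -powR_mulrn// -powRrM; congr powR.
by field.
Qed.

(** With [q = p / 2 >= 1], superadditivity of [t^q] and then its convexity bound the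
    left-hand side by the mean of [A^p] and [B^p]. The hypothesis is the parallelogram
    identity for the norms of the half sum and half difference of two vectors. *)
Lemma clarkson_powR p A B S D : 2 <= p -> 0 <= A -> 0 <= B -> 0 <= S -> 0 <= D ->
  S ^+ 2 + D ^+ 2 = (A ^+ 2 + B ^+ 2) / 2 ->
  S `^ p + D `^ p <= (A `^ p + B `^ p) / 2.
Proof.
move=> p2 A0 B0 S0 D0 SD; rewrite !(powR_sqr p)//.
have q1 : 1 <= p / 2 by lra.
apply: le_trans (powR_superadd q1 (sqr_ge0 S) (sqr_ge0 D)) _.
by rewrite SD; apply: powR_midpoint; rewrite ?sqr_ge0.
Qed.

Lemma powRS1 p x : 0 <= x -> 1 < p -> x `^ (p - 1) * x = x `^ p.
Proof. by move=> x0 p1; rewrite mulrC mulr_powRB1//; lra. Qed.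

Lemma powR_m2 p x : 0 <= x -> 2 <= p -> x `^ (p - 2) * x = x `^ (p - 1).
Proof.
move=> x0; rewrite le_eqVlt => /orP[/eqP <-|p2].
  by rewrite subrr powRr0 mul1r (_ : 2 - 1 = 1 :> R) ?powRr1//; lra.
have -> : p - 2 = (p - 1) - 1 by lra.
by rewrite powRS1//; lra.
Qed.

Lemma powR_m2_sqr p x : 0 <= x -> 2 <= p -> x `^ (p - 2) * x ^+ 2 = x `^ p.
Proof. by move=> x0 p2; rewrite expr2 mulrA powR_m2// powRS1//; lra. Qed.

Lemma young_powR p A B : 1 < p -> 0 <= A -> 0 <= B ->
  p * (A `^ (p - 1) * B) <= (p - 1) * A `^ p + B `^ p.
Proof.
move=> p1 A0 B0.
have q0 : 0 < p / (p - 1) by rewrite divr_gt0; lra.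
have p0 : 0 < p by lra.
have := @conjugate_powR R (A `^ (p - 1)) B (p / (p - 1)) p (powR_ge0 _ _) B0 q0 p0.
have -> : (p / (p - 1))^-1 + p^-1 = 1 by field; apply/andP; split; lra.
move=> /(_ erefl).
rewrite -powRrM (_ : (p - 1) * (p / (p - 1)) = p); last by field; lra.
rewrite -(ler_pM2l p0) => /le_trans; apply.
rewrite le_eqVlt; apply/orP; left; apply/eqP; field; apply/andP; split; lra.
Qed.

(** Convexity of the [p]-th power of a norm: for vectors [u] and [v] of norms [A] and
    [B] and inner product [c], the left-hand side is the value at [v] of the tangent at
    [u]. *)
Lemma powR_tangent p A B c : 2 <= p -> 0 <= A -> 0 <= B -> c <= A * B ->
  A `^ p + p * (A `^ (p - 2) * (c - A ^+ 2)) <= B `^ p.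
Proof.
move=> p2 A0 B0 cAB.
rewrite mulrBr powR_m2_sqr//.
have p1 : 1 < p by lra.
have := young_powR p1 A0 B0.
have : A `^ (p - 2) * c <= A `^ (p - 1) * B.
  by rewrite -powR_m2// -mulrA ler_wpM2l ?powR_ge0.
move=> h1 h2.
have : p * (A `^ (p - 2) * c) <= p * (A `^ (p - 1) * B) by rewrite ler_wpM2l//; lra.
lra.
Qed.

(** One of the two terms on the right is enough, according to whether [B <= L A].
    Young's inequality in this form lets the coefficient [L] of [A^p] be as small as
    desired. *)
Lemma powR_split_young p L A B : 1 < p -> 0 < L -> 0 <= A -> 0 <= B ->
  A `^ (p - 1) * B <= L * A `^ p + L `^ (1 - p) * B `^ p.
Proof.
move=> p1 L0 A0 B0.
have h1 : 0 <= L * A `^ p by rewrite mulr_ge0 ?powR_ge0 ?ltW.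
have h2 : 0 <= L `^ (1 - p) * B `^ p by rewrite mulr_ge0 ?powR_ge0.
have [BL|LB] := leP B (L * A).
  apply: (@le_trans _ _ (L * A `^ p)); last by rewrite lerDl.
  by rewrite -(powRS1 A0 p1) mulrCA ler_wpM2l ?powR_ge0.
apply: (@le_trans _ _ (L `^ (1 - p) * B `^ p)); last by rewrite lerDr.
rewrite -(powRS1 B0 p1) mulrA ler_wpM2r//.
rewrite (_ : 1 - p = - (p - 1)); last by lra.
rewrite powRN ler_pdivlMl ?powR_gt0// -powRM//; last exact: ltW.
by apply: le_powR; [lra|rewrite mulr_ge0// ltW|exact: ltW].
Qed.

(** At a positive limit the power is differentiable; at the limit 0 the claim follows
    from monotonicity. *)
Lemma cvg_powR {T : Type} (F : set_system T) {FF : Filter F} (g : T -> R) (l r : R) :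
  0 <= r -> (\forall i \near F, 0 <= g i) -> 0 <= l -> g @ F --> l ->
  (fun i => g i `^ r) @ F --> l `^ r.
Proof.
rewrite le_eqVlt => /orP[/eqP <-|r0].
  by move=> _ _ _; rewrite powRr0; under eq_fun do rewrite powRr0; exact: cvg_cst.
move=> g0; rewrite le_eqVlt => /orP[/eqP <-|l0] gl; last first.
  apply: (continuous_cvg FF (f := g) (h := fun x : R => x `^ r) (a := l)) => //.
  apply: differentiable_continuous; apply/derivable1_diffP.
  by apply: derivable_powR; rewrite in_itv /= l0.
rewrite powR0 ?gt_eqF//; apply/cvgrPdist_lt => e e0.
have e1 : 0 < e `^ (r^-1) by rewrite powR_gt0.
move/cvgrPdist_lt : gl => /(_ _ e1) gl; near=> i.
have gi : 0 <= g i by near: i.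
rewrite sub0r normrN ger0_norm ?powR_ge0//.
have : `|0 - g i| < e `^ r^-1 by near: i.
rewrite sub0r normrN ger0_norm// => h.
rewrite [ltRHS](_ : e = (e `^ r^-1) `^ r); last first.
  by rewrite -powRrM mulVf ?gt_eqF// powRr1// ltW.
by rewrite gt0_ltr_powR// ?nnegrE ?powR_ge0.
Unshelve. all: by end_near. Qed.

End PowR.

(** * Integrals of nonnegative functions as lower integrals *)

Section LowerIntegral.
Import HBNNSimple.
Local Open Scope ereal_scope.
Context d (T : measurableType d) (R : realType) (nu : {measure set T -> \bar R}).
Implicit Types (D : set T) (f g : T -> R).

Notation I D f := (\int[nu]_(t in D) (f t)%:E).

(** The integral of a nonnegative function is the supremum of the integrals of the
    simple functions below it, so that it is monotone and superadditive on all
    nonnegative functions. The heat kernel is compared in this way with explicit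
    functions of the time variable. *)
Lemma le_integral_ge0 D (f g : T -> \bar R) : (forall t, D t -> 0 <= f t) ->
  (forall t, D t -> f t <= g t) -> \int[nu]_(t in D) f t <= \int[nu]_(t in D) g t.
Proof.
move=> f0 fg; rewrite !ge0_integralE//; last by move=> t Dt; exact: le_trans (f0 t Dt) (fg t Dt).
apply: le_ereal_sup => _ [k kf <-]; exists k => // t.
apply: le_trans (kf t) _; rewrite /patch; case: ifPn => // /set_mem; exact: fg.
Qed.

Lemma integral_superadd D (f g : T -> R) : (forall t, D t -> 0 <= f t)%R ->
  (forall t, D t -> 0 <= g t)%R ->
  I D f + I D g <= I D (fun t => f t + g t)%R.
Proof.
move=> f0 g0; rewrite !ge0_integralE//; last first.
  by move=> t Dt; rewrite lee_fin addr_ge0 ?f0 ?g0.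
set Sf := (X in ereal_sup X + _ <= _); set Sg := (X in _ + ereal_sup X <= _).
set S := (X in _ <= X).
have key (a b : {nnsfun T >-> R}) : (forall t, (a t)%:E <= ((fun t => (f t)%:E) \_ D) t) ->
    (forall t, (b t)%:E <= ((fun t => (g t)%:E) \_ D) t) -> sintegral nu a + sintegral nu b <= S.
  move=> af bg; rewrite -sintegralD; apply: ereal_sup_ubound.
  exists (add_nnsfun a b) => // t /=.
  have := af t; have := bg t; rewrite /patch; case: ifPn => _ /= h1 h2; rewrite lee_fin in h1;
    rewrite lee_fin in h2; rewrite lee_fin.
    exact: lerD.
  by rewrite -(addr0 0%R) lerD.
have [->|Soo] := eqVneq S +oo; first exact: leey.
have z0 (k : T -> R) : (forall t, D t -> 0 <= k t)%R -> forall t,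
  ((nnsfun0 : {nnsfun T >-> R}) t)%:E <= ((fun t => (k t)%:E) \_ D) t.
  by move=> k0 t; rewrite /patch /=; case: ifPn => // /set_mem /k0.
have Sb (b : {nnsfun T >-> R}) : (forall t, (b t)%:E <= ((fun t =>
  (g t)%:E) \_ D) t) -> sintegral nu b \is a fin_num.
  move=> bg; rewrite ge0_fin_numE ?sintegral_ge0//.
  apply: le_lt_trans (_ : S < +oo); last by rewrite lt_neqAle Soo leey.
  have := key nnsfun0 b (z0 f f0) bg; rewrite sintegral0 add0e//.
have Sf_le (b : {nnsfun T >-> R}) : (forall t, (b t)%:E <= ((fun t =>
  (g t)%:E) \_ D) t) -> ereal_sup Sf <= S - sintegral nu b.
  move=> bg; apply: ge_ereal_sup => _ [a af <-].
  by rewrite leeBrDr ?Sb//; exact: key.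
have Sffin : ereal_sup Sf \is a fin_num.
  rewrite ge0_fin_numE; last first.
    by apply: ereal_sup_ubound; exists nnsfun0; [exact: z0|exact: sintegral0].
  apply: le_lt_trans (Sf_le nnsfun0 (z0 g g0)) _.
  by rewrite sintegral0 sube0 lt_neqAle Soo leey.
rewrite addeC -leeBrDr//; apply: ge_ereal_sup => _ [b bg <-].
have := Sf_le b bg; rewrite leeBrDr ?Sb// => h.
by rewrite leeBrDr// addeC.
Qed.

Lemma integral_superZ D (f : T -> R) (c : R) : (0 <= c)%R -> (forall t, D t -> 0 <= f t)%R ->
  c%:E * I D f <= I D (fun t => c * f t)%R.
Proof.
rewrite le_eqVlt => /predU1P[<- f0|c0 f0].
  by rewrite mul0e; apply: integral_ge0 => t _; rewrite mul0r.
rewrite !ge0_integralE//; last first.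
  by move=> t Dt; rewrite lee_fin mulr_ge0 ?f0// ltW.
rewrite -lee_pdivlMl//; apply: ge_ereal_sup => _ [a af <-].
rewrite lee_pdivlMl// -sintegralrM; apply: ereal_sup_ubound.
exists (scale_nnsfun a (ltW c0)) => // t /=.
have := af t; rewrite /patch; case: ifPn => _ /= h1.
  by move: h1; rewrite !lee_fin => h1; rewrite ler_pM2l.
by move: h1; rewrite !lee_fin => h1; rewrite pmulr_rle0.
Qed.

Lemma integral_supersum D (V : choiceType) (A : seq V) (c : V -> R) (f : V -> T -> R) :
  (forall y, 0 <= c y)%R -> (forall y t, D t -> 0 <= f y t)%R ->
  \sum_(y <- A) (c y)%:E * I D (f y) <= I D (fun t => \sum_(y <- A) c y * f y t)%R.
Proof.
move=> c0 f0; elim: A => [|y A IH].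
  by rewrite big_nil; apply: integral_ge0 => t _; rewrite big_nil.
rewrite big_cons; apply: (@le_trans _ _ (I D (fun t => c y * f y t)%R + I D (fun t =>
  \sum_(y <- A) c y * f y t)%R)).
  by apply: leeD => //; apply: integral_superZ => // t; exact: f0.
apply: le_trans (integral_superadd _ _) _.
- by move=> t Dt; rewrite mulr_ge0 ?f0.
- by move=> t Dt; apply: sumr_ge0 => z _; rewrite mulr_ge0 ?f0.
by rewrite le_eqVlt; apply/orP; left; apply/eqP; apply: eq_integral => t _; rewrite big_cons.
Qed.

Lemma Rintegral_fin D (f : T -> R) : (forall t, D t -> 0 <= f t)%R -> I D f < +oo ->
  I D f = (Rintegral nu D f)%:E.
Proof.
move=> f0 foo; rewrite /Rintegral fineK// ge0_fin_numE//.
by apply: integral_ge0 => t Dt; rewrite lee_fin f0.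
Qed.

End LowerIntegral.

(** * Integrals of powers of the time variable *)

Section PowerIntegrals.
Context {R : realType}.
Notation nu := (@lebesgue_measure R).

Lemma is_derive_powR (r t : R) : 0 < t ->
  is_derive t (1 : R) (fun x => x `^ r) (r * t `^ (r - 1)).
Proof.
move=> t0; have tI : t \in `]0, +oo[ by rewrite in_itv /= t0.
apply: DeriveDef; first exact: derivable_powR.
by rewrite -derive1E powR_derive1.
Qed.

Lemma integral_powR (a b r : R) : 0 < a -> a < b -> r != 0 ->
  (\int[nu]_(t in `[a, b]) (t `^ (r - 1))%:E = ((b `^ r - a `^ r) / r)%:E)%E.
Proof.
move=> a0 ab r0.
pose F (t : R) := r^-1 * t `^ r.
have dF (t : R) : 0 < t -> is_derive t (1 : R) F (t `^ (r - 1)).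
  move=> t0; have := @is_deriveZ _ _ _ _ r^-1 _ _ _ (is_derive_powR r t0).
  by rewrite /GRing.scale /= mulrA mulVf// mul1r.
have cF (t : R) : 0 < t -> {for t, continuous F}.
  by move=> t0; have [dFt _] := dF t t0; apply: differentiable_continuous; apply/derivable1_diffP.
rewrite (@continuous_FTC2 _ (fun t => t `^ (r - 1)) F a b)//.
- by rewrite -EFinB /F; congr EFin; field.
- apply: derivable_within_continuous => t; rewrite in_itv /= => /andP[at_ _].
  by apply: derivable_powR; rewrite in_itv /= (lt_le_trans a0 at_).
- split.
  + by move=> t; rewrite in_itv /= => /andP[at_ _]; have [] := dF t (lt_trans a0 at_).
  + by apply: cvg_at_right_filter; exact: cF.
  + by apply: cvg_at_left_filter; apply: cF; exact: lt_trans ab.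
- move=> t; rewrite in_itv /= => /andP[at_ _].
  by rewrite derive1E; have [_ ->] := dF t (lt_trans a0 at_).
Qed.

Lemma integral_bigcup_le (F : nat -> set R) (f : R -> R) (C : \bar R) :
  (forall n, measurable (F n)) -> (forall n k, (n <= k)%N -> F n `<=` F k) ->
  measurable_fun setT f -> (forall n t, F n t -> 0 <= f t) ->
  (forall n, \int[nu]_(t in F n) (f t)%:E <= C)%E ->
  (\int[nu]_(t in \bigcup_n F n) (f t)%:E <= C)%E.
Proof.
move=> mF ndF mf f0 FC.
have h : ((fun i => \int[nu]_(x in F i) (f x)%:E) @ \oo --> \int[nu]_(x in \bigcup_i F i) (f
  x)%:E)%E.
  apply: ge0_nondecreasing_set_cvg_integral => //.
  - by move=> n k nk; rewrite subsetEset; exact: ndF.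
  - by move=> n; apply/measurable_EFinP; exact: measurable_funTS.
rewrite -(cvg_lim _ h)//; apply: lime_le; first by apply/cvg_ex; eexists; exact: h.
exact: nearW.
Qed.

Lemma integral_powR_01 (s : R) : 0 < s -> s < 1 ->
  (\int[nu]_(t in `]0%R, 1%R]) (t `^ (- s))%:E <= ((1 - s)^-1)%:E)%E.
Proof.
move=> s0 s1.
have -> : `]0, 1]%classic = \bigcup_n `[(n.+2%:R)^-1 : R, 1]%classic.
  apply/seteqP; split => t /=; rewrite in_itv /=.
    move=> /andP[t0 t1]; exists (Num.trunc t^-1) => //=; rewrite in_itv /= t1 andbT.
    rewrite -[leRHS]invrK lef_pV2 ?posrE ?invr_gt0// ltW// (lt_trans (truncnS_gt _))//.
    by rewrite ltr_nat.
  by move=> [n _] /=; rewrite in_itv /= => /andP[h ->]; rewrite andbT (lt_le_trans _ h).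
apply: integral_bigcup_le => //.
- move=> n k nk t /=; rewrite !in_itv /= => /andP[h ->]; rewrite andbT (le_trans _ h)//.
  by rewrite lef_pV2 ?posrE// ler_nat !ltnS.
- by move=> n t _; exact: powR_ge0.
move=> n; have s1' : 1 - s != 0 by lra.
have n1 : n.+2%:R^-1 < 1 :> R by rewrite invf_lt1// ltr1n.
have := @integral_powR n.+2%:R^-1 1 (1 - s) _ n1 s1'; rewrite (_ : 1 - s - 1 = - s); last lra.
move=> ->//.
rewrite lee_fin powR1 ler_pdivrMr; last lra.
by rewrite mulVf; [rewrite lerBlDr lerDl powR_ge0|lra].
Qed.

Lemma integral_powR_1y (s : R) : 0 < s ->
  (\int[nu]_(t in `]1%R, +oo[) (t `^ (- 1 - s))%:E <= (s^-1)%:E)%E.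
Proof.
move=> s0; apply: (@le_trans _ _ (\int[nu]_(t in `[1%R, +oo[) (t `^ (- 1 - s))%:E)%E).
  apply: ge0_subset_integral => //.
  - by apply/measurable_EFinP; exact: measurable_funTS.
  - by move=> t _; rewrite lee_fin powR_ge0.
  - by move=> t /=; rewrite !in_itv /= !andbT => /ltW.
have -> : `[1%R, +oo[%classic = \bigcup_n `[1 : R, n.+2%:R]%classic.
  apply/seteqP; split => t /=; rewrite in_itv /= ?andbT.
    move=> t1; exists (Num.trunc t) => //=; rewrite in_itv /= t1 /=.
    by rewrite ltW// (lt_trans (truncnS_gt _))// ltr_nat.
  by move=> [n _] /=; rewrite in_itv /= => /andP[].
apply: integral_bigcup_le => //.
- move=> n k nk t /=; rewrite !in_itv /= => /andP[-> h]; rewrite (le_trans h)//.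
  by rewrite ler_nat !ltnS.
- by move=> n t _; exact: powR_ge0.
move=> n; have -> : - 1 - s = (- s) - 1 by lra.
rewrite integral_powR//; [|by rewrite ltr1n|lra].
rewrite lee_fin powR1 invrN mulrN -mulNr opprB ler_pdivrMr// mulVf ?gt_eqF//.
Qed.

(** [t^-s] is integrable near 0 and [t^(-1-s)] near infinity. *)
Lemma integral_0y_lty (s C : R) (f : R -> R) : 0 < s -> s < 1 -> 0 <= C ->
  measurable_fun setT f -> (forall t, 0 < t -> 0 <= f t) ->
  (forall t, 0 < t -> t <= 1 -> f t <= C * t `^ (- s)) ->
  (forall t, 1 <= t -> f t <= C * t `^ (- 1 - s)) ->
  (\int[nu]_(t in `]0%R, +oo[) (f t)%:E < +oo)%E.
Proof.
move=> s0 s1 C0 mf f0 f01 f1y.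
have -> : `]0, +oo[%classic = `]0, 1]%classic `|` `]1, +oo[%classic :> set R.
  apply/seteqP; split => t /=; rewrite !in_itv /= ?andbT.
    by move=> t0; have [t1|t1] := leP t 1; [left|right]; rewrite ?t0.
  by move=> [/andP[]|/(lt_trans ltr01)].
rewrite ge0_integral_setU//; first last.
- apply/disj_setPS => t /= []; rewrite !in_itv /= andbT => /andP[_ t1].
  by rewrite ltNge t1.
- by move=> t /= [|]; rewrite in_itv /= ?andbT lee_fin => h; apply: f0;
  [case/andP: h|exact: lt_trans h].
- by apply/measurable_EFinP; exact: measurable_funTS.
have mp r : measurable_fun setT (fun t : R => (t `^ r)%:E).
  by apply/measurable_EFinP.
apply: lte_add_pinfty.
  apply: (@le_lt_trans _ _ (\int[nu]_(t in `]0%R, 1%R]) (C%:E * (t `^ (- s))%:E))%E).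
    apply: le_integral_ge0 => t /=; rewrite in_itv /= => /andP[t0 t1].
      by rewrite lee_fin f0.
    by rewrite -EFinM lee_fin f01.
  rewrite ge0_integralZl_EFin//; try by [move=> t _;
    rewrite lee_fin powR_ge0|apply/measurable_EFinP; exact: measurable_funTS].
  apply: le_lt_trans (lee_wpmul2l _ (integral_powR_01 s0 s1)) _; first by rewrite lee_fin.
  by rewrite -EFinM ltry.
apply: (@le_lt_trans _ _ (\int[nu]_(t in `]1%R, +oo[) (C%:E * (t `^ (- 1 - s))%:E))%E).
  apply: le_integral_ge0 => t /=; rewrite in_itv /= andbT => t1.
    by rewrite lee_fin f0// (lt_trans _ t1).
  by rewrite -EFinM lee_fin f1y// ltW.
rewrite ge0_integralZl_EFin//; try by [move=> t _;
  rewrite lee_fin powR_ge0|apply/measurable_EFinP; exact: measurable_funTS].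
apply: le_lt_trans (lee_wpmul2l _ (integral_powR_1y s0)) _; first by rewrite lee_fin.
by rewrite -EFinM ltry.
Qed.

Lemma integral_0y_gt0 (f : R -> R) (a b c : R) : 0 < a -> a < b -> 0 < c ->
  (forall t, 0 < t -> 0 <= f t) -> (forall t, a <= t -> t <= b -> c <= f t) ->
  (0 < \int[nu]_(t in `]0%R, +oo[) (f t)%:E)%E.
Proof.
move=> a0 ab c0 f0 fc.
apply: (@lt_le_trans _ _ (c%:E * \int[nu]_(t in `]0%R, +oo[) (\1_(`[a, b]%classic) t)%:E)%E).
  rewrite integral_indic//= setIidl; last first.
    by move=> t /=; rewrite !in_itv /= andbT => /andP[/(lt_le_trans a0)].
  by rewrite mule_gt0 ?lte_fin// lebesgue_measure_itv /= lte_fin ab -EFinB lte_fin subr_gt0.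
apply: le_trans (integral_superZ nu (D := `]0%R, +oo[%classic) (f := \1_`[a, b]) (ltW c0) _) _;
  first by move=> t _; rewrite indicE.
apply: le_integral_ge0 => t /=; rewrite in_itv /= andbT => t0.
  by rewrite lee_fin mulr_ge0 ?(ltW c0).
rewrite lee_fin indicE; case: (boolP (t \in _)) => [|_]; last by rewrite mulr0 f0.
by rewrite inE /= in_itv /= => /andP[h1 h2]; rewrite mulr1 fc.
Qed.

(** The integral converges since [exp(-t) <= 1] and [exp(-t) <= 1 / t]; a divergent one
    would have the value 0 by convention. *)
Lemma Gamma_gt0 (s : R) : 0 < s -> s < 1 -> 0 < Gamma (1 - s).
Proof.
move=> s0 s1; rewrite /Gamma.
have -> : 1 - s - 1 = - s by lra.
pose f (t : R) := t `^ (- s) * expR (- t).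
have f0 t : 0 <= f t by rewrite mulr_ge0 ?powR_ge0 ?expR_ge0.
have mf : measurable_fun setT f.
  apply: measurable_funM; first exact: measurable_powR.
  by apply: measurableT_comp => //; exact: oppr_measurable.
have foo : (\int[nu]_(t in `]0%R, +oo[) (f t)%:E < +oo)%E.
  apply: (@integral_0y_lty s 1) => //.
    move=> t t0 t1; rewrite mul1r /f ler_piMr ?powR_ge0//.
    by rewrite -expR0 ler_expR lerNl oppr0 ltW.
  move=> t t1; rewrite mul1r /f.
  have t0 : 0 < t by rewrite (lt_le_trans _ t1).
  have -> : - 1 - s = - s + - 1 by lra.
  rewrite powRD; last by rewrite (gt_eqF t0) implybT.
  rewrite ler_wpM2l ?powR_ge0// (powR_inv1 (ltW t0)) expRN lef_pV2 ?posrE ?expR_gt0//.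
  by apply: le_trans (expR_ge1Dx t); rewrite lerDr.
rewrite -lte_fin -(Rintegral_fin _ foo)//.
apply: (@integral_0y_gt0 _ 1 2 (expR (- 2) * 2 `^ (- s))) => //.
- by rewrite ltr1n.
- move=> t t1 t2; rewrite /f mulrC ler_pM ?powR_ge0 ?expR_ge0//.
    by rewrite !powRN lef_pV2 ?posrE ?powR_gt0 ?(lt_le_trans _ t1)// le_powR ?(ltW s0)//
      (le_trans _ t1).
  by rewrite ler_expR lerN2.
Qed.
End PowerIntegrals.

#[local] Existing Instance summability.totally_filter.

(** * The exponential series as a limit of binomial expansions *)

Section NatSums.
Context {R : realType}.
Implicit Types a : nat -> R.

Lemma psum_iota a n : psum a (seq_fset tt (iota 0 n)) = series a n.
Proof.
rewrite /psum /series /= /index_iota subn0.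
apply: perm_big; apply: uniq_perm; [exact: (fset_uniq (seq_fset tt (iota 0 n)))|exact: iota_uniq|].
by move=> k; rewrite (seq_fsetE tt).
Qed.

Lemma fset_iota (A : {fset nat}) : exists N, (A `<=` seq_fset tt (iota 0 N))%fset.
Proof.
exists (\max_(i <- A) i).+1; apply/fsubsetP => k kA.
by rewrite seq_fsetE mem_iota /= add0n ltnS (big_fsetD1 k)//= leq_maxl.
Qed.

Lemma series_tsum a : summ a -> series a @ \oo --> tsum a.
Proof.
move=> /tsum_cvg /cvgrPdist_le h; apply/cvgrPdist_le => e e0.
have [A _ hA] := h e e0; have [N AN] := fset_iota A.
exists N => // n /= Nn; rewrite -psum_iota; apply: hA => /=.
apply: fsubset_trans AN _; apply/fsubsetP => k; rewrite !(seq_fsetE tt) !mem_iota /= !add0n.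
by move=> /leq_trans; apply.
Qed.

Lemma exp_summ (x : R) : 0 <= x -> summ (exp_coeff x).
Proof.
move=> x0; have c0 k : 0 <= exp_coeff x k by rewrite exp_coeff_ge0.
apply: (@summ_bound _ _ _ (expR x) c0) => A.
have [N AN] := fset_iota A; apply: le_trans (psum_subset c0 AN) _.
rewrite psum_iota; apply: nondecreasing_cvgn_le; last exact: is_cvg_series_exp_coeff.
by apply: nondecreasing_series.
Qed.

Lemma ffact_le_expn n k : (n ^_ k <= n ^ k)%N.
Proof.
elim: k => [|k IH]; first by rewrite ffactn0.
by rewrite ffactnSr expnSr leq_mul// leq_subr.
Qed.

Lemma ffact_aux (A B N K : R) : B != 0 -> N != 0 ->
  A / B * (1 - K / N) = A * (N - K) / (B * N).
Proof. by move=> B0 N0; field; rewrite B0 N0. Qed.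

(** The coefficients of [(1 + x / n)^n] converge to those of the exponential series. By
    [bin_expn_le] they are also dominated by them, so that the expansions converge. *)
Lemma bin_expn_cvg k :
  (fun n => 'C(n.+1, k)%:R / n.+1%:R ^+ k : R) @ \oo --> (k`!%:R^-1 : R).
Proof.
have ff : (fun n => (n.+1 ^_ k)%:R / n.+1%:R ^+ k : R) @ \oo --> (1 : R).
  elim: k => [|k IH].
    by under eq_fun do rewrite ffactn0 expr0 divr1; exact: cvg_cst.
  rewrite -[X in _ --> X]mulr1.
  have h1 : (fun n : nat => 1 - k%:R * n.+1%:R^-1 : R) @ \oo --> (1 : R).
    rewrite -[X in _ --> X]subr0 -[X in _ --> _ - X](mulr0 k%:R).
    by apply: cvgB; [exact: cvg_cst|apply: cvgMr; exact: cvg_harmonic].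
  apply: cvg_trans (cvgM IH h1); apply: near_eq_cvg.
  exists k => // n /= kn.
  rewrite ffactnSr natrM natrB ?(leq_trans kn)// exprSr.
  have n0 : n.+1%:R != 0 :> R by [].
  have k0 : n.+1%:R ^+ k != 0 :> R by rewrite expf_neq0.
  exact: ffact_aux.
have -> : (fun n => 'C(n.+1, k)%:R / n.+1%:R ^+ k : R) =
    (fun n => k`!%:R^-1 * ((n.+1 ^_ k)%:R / n.+1%:R ^+ k)).
  apply/funext => n; rewrite -bin_ffact natrM.
  have k0 : k`!%:R != 0 :> R by rewrite pnatr_eq0 -lt0n fact_gt0.
  have n0 : n.+1%:R ^+ k != 0 :> R by rewrite expf_neq0.
  by move: (k`!%:R) (n.+1%:R ^+ k) k0 n0 => A B A0 B0; field; rewrite A0 B0.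
by rewrite -[X in _ --> X]mulr1; apply: cvgMr.
Qed.

Lemma bin_expn_le n k : 'C(n.+1, k)%:R / n.+1%:R ^+ k <= k`!%:R^-1 :> R.
Proof.
rewrite ler_pdivrMr ?exprn_gt0// mulrC ler_pdivlMr ?ltr0n ?fact_gt0//.
by rewrite -natrM bin_ffact -natrX ler_nat ffact_le_expn.
Qed.

End NatSums.

(** * Heat kernels *)

Section Dirichlet.
Context {R : realType} {V : countType} (G : weighted_graph R V).
Hypothesis Glf : locally_finite G.
Implicit Types (u v f : V -> R) (Om : set V) (x y : V).

Notation m := (mu G).
Notation L Om := (dirichlet_laplacian G Om).

Definition nbr x := fset_set [set y | edge G x y].

Lemma in_nbr x y : (y \in nbr x) = edge G x y.
Proof.
rewrite in_fset_set; last exact: Glf.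
by apply/idP/idP; rewrite inE.
Qed.

Lemma laplacianE u x :
  laplacian G u x = (m x)^-1 * \sum_(y <- nbr x) weight G x y * (u y - u x).
Proof. by rewrite /laplacian fsbig_finite//=; exact: Glf. Qed.

(** The total rate of the jumps from [x] to other vertices. The Laplacian does not see
    loops, so they are left out. *)
Definition deg x : R := (m x)^-1 * \sum_(y <- nbr x | y != x) weight G x y.

Lemma wsum_ge0 x : 0 <= \sum_(y <- nbr x | y != x) weight G x y.
Proof.
rewrite big_seq_cond; apply: sumr_ge0 => y /andP[]; rewrite in_nbr => xy _.
exact/ltW/weight_gt0.
Qed.

Lemma deg_ge0 x : 0 <= deg x.
Proof. by rewrite mulr_ge0 ?wsum_ge0// invr_ge0 ltW// mu_gt0. Qed.

Lemma laplacian_deg u x : laplacian G u x =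
  (m x)^-1 * (\sum_(y <- nbr x | y != x) weight G x y * u y) - deg x * u x.
Proof.
rewrite laplacianE /deg -mulrA -mulrBr; congr (_ * _).
rewrite (bigID (fun y => y != x)) /= [X in _ + X]big1 ?addr0; last first.
  by move=> y; rewrite negbK => /eqP ->; rewrite subrr mulr0.
by rewrite mulr_suml -sumrB; apply: eq_bigr => y _; rewrite mulrBr.
Qed.

Lemma dirichletE Om u x : L Om u x = \1_Om x *
  ((m x)^-1 * (\sum_(y <- nbr x | y != x) weight G x y * (\1_Om y * u y)) - deg x * u x).
Proof.
rewrite /dirichlet_laplacian laplacian_deg !mulrBr; congr (_ - _).
by rewrite indicE; case: (x \in Om); rewrite ?mul1r// !mul0r.
Qed.

Lemma indic01 Om x : (\1_Om x = 0 :> R) \/ (\1_Om x = 1 :> R).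
Proof. by rewrite indicE; case: (x \in Om); [right|left]. Qed.

Lemma nbr_sum_le Om u (M : R) x : (forall y, `|u y| <= M) ->
  `|(m x)^-1 * (\sum_(y <- nbr x | y != x) weight G x y * (\1_Om y * u y))| <= deg x * M.
Proof.
move=> uM; have M0 : 0 <= M by apply: le_trans (uM x).
have mx := mu_gt0 G x.
rewrite normrM ger0_norm ?invr_ge0 ?(ltW mx)// /deg -mulrA ler_wpM2l ?invr_ge0 ?(ltW mx)//.
apply: le_trans (ler_norm_sum _ _ _) _; rewrite mulr_suml.
rewrite big_seq_cond [leRHS]big_seq_cond; apply: ler_sum => y /andP[]; rewrite in_nbr => xy _.
have w0 := weight_gt0 xy.
rewrite normrM gtr0_norm// ler_wpM2l ?(ltW w0)//.
by case: (indic01 Om y) => ->; rewrite ?mul0r ?mul1r ?normr0.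
Qed.

Lemma dirichlet_le Om (D : R) u (M : R) x : (forall x, Om x -> deg x <= D) -> 0 <= D ->
  (forall y, `|u y| <= M) -> `|L Om u x| <= (2 * D) * M.
Proof.
move=> degD D0 uM; have M0 : 0 <= M by apply: le_trans (uM x).
rewrite dirichletE indicE; case: (boolP (x \in Om)) => /=; last first.
  by move=> _; rewrite mul0r normr0 !mulr_ge0.
move/set_mem => xOm; rewrite mul1r; apply: le_trans (ler_normB _ _) _.
have := nbr_sum_le Om x uM.
have : `|deg x * u x| <= deg x * M by rewrite normrM ger0_norm ?deg_ge0// ler_wpM2l ?deg_ge0.
have := ler_wpM2r M0 (degD _ xOm).
by move: `|_ * \sum_(_ <- _ | _) _| `|deg x * u x| (deg x * M) => a b c; lra.
Qed.

(** One step, of length [a], of the explicit Euler scheme for the Dirichlet heat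
    equation. *)
Definition euler Om (a : R) u : V -> R := fun x => u x + a * L Om u x.

(** For [a * deg x <= 1] the new value at [x] is a combination with nonnegative
    coefficients of total mass at most 1 of the old values at [x] and its neighbours. *)
Lemma euler_le Om (D a : R) u (M : R) x : (forall x, Om x -> deg x <= D) ->
  0 <= a -> a * D <= 1 -> (forall y, `|u y| <= M) -> `|euler Om a u x| <= M.
Proof.
move=> degD a0 aD uM; have M0 : 0 <= M by apply: le_trans (uM x).
rewrite /euler dirichletE indicE; case: (boolP (x \in Om)) => /=; last by rewrite mul0r mulr0 addr0.
move/set_mem => xOm; rewrite mul1r.
have ad : a * deg x <= 1 by apply: le_trans aD; rewrite ler_wpM2l// degD.
set S := _^-1 * _.
have -> : u x + a * (S - deg x * u x) = (1 - a * deg x) * u x + a * S by ring.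
apply: le_trans (ler_normD _ _) _.
have h1 : `|(1 - a * deg x) * u x| <= (1 - a * deg x) * M.
  by rewrite normrM ger0_norm ?subr_ge0// ler_wpM2l// subr_ge0.
have h2 : `|a * S| <= a * (deg x * M).
  by rewrite normrM ger0_norm// ler_wpM2l//; exact: nbr_sum_le.
by move: h1 h2; move: `|_ * u x| `|_ * S| => b c; rewrite mulrA mulrBl mul1r; lra.
Qed.

Lemma dirichletD Om u v x : L Om (fun z => u z + v z) x = L Om u x + L Om v x.
Proof.
rewrite !dirichletE.
have -> : \sum_(y <- nbr x | y != x) weight G x y * (\1_Om y * (u y + v y)) =
  \sum_(y <- nbr x | y != x) weight G x y * (\1_Om y * u y) +
  \sum_(y <- nbr x | y != x) weight G x y * (\1_Om y * v y).
  by rewrite -big_split /=; apply: eq_bigr => y _; ring.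
by ring.
Qed.

Lemma dirichletZ Om c u x : L Om (fun z => c * u z) x = c * L Om u x.
Proof.
rewrite !dirichletE.
have -> : \sum_(y <- nbr x | y != x) weight G x y * (\1_Om y * (c * u y)) =
  c * \sum_(y <- nbr x | y != x) weight G x y * (\1_Om y * u y).
  by rewrite mulr_sumr; apply: eq_bigr => y _; ring.
by ring.
Qed.

Lemma dirichlet0 Om x : L Om (fun=> 0) x = 0.
Proof.
rewrite dirichletE big1 => [|y _]; last by rewrite !mulr0.
by rewrite !mulr0 subr0 mulr0.
Qed.

Lemma dirichlet_sum Om (c : nat -> R) (g : nat -> V -> R) n x :
  L Om (fun z => \sum_(k < n) c k * g k z) x = \sum_(k < n) c k * L Om (g k) x.
Proof.
elim: n => [|n IH].
  rewrite big_ord0; under eq_fun do rewrite big_ord0.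
  exact: dirichlet0.
under eq_fun do rewrite big_ord_recr /=.
by rewrite dirichletD IH dirichletZ big_ord_recr.
Qed.

Lemma euler_iter Om a f n x : iter n (euler Om a) f x =
  \sum_(k < n.+1) ('C(n, k)%:R * a ^+ k) * iter k (L Om) f x.
Proof.
elim: n x => [|n IH] x; first by rewrite big_ord1 /= bin0 expr0 !mul1r.
rewrite iterS /euler.
have -> : iter n (euler Om a) f =
    (fun z => \sum_(k < n.+1) ('C(n, k)%:R * a ^+ k) * iter k (L Om) f z).
  by apply/funext => z; exact: IH.
rewrite (dirichlet_sum _ (fun k =>
  'C(n, k)%:R * a ^+ k)) [RHS]big_ord_recl /= bin0 expr0 mul1r mul1r.
under [X in _ = _ + X]eq_bigr => k _ do
  rewrite /bump leq0n add1n binS natrD mulrDl mulrDl.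
rewrite big_split /= addrA; congr (_ + _); last first.
  by rewrite mulr_sumr; apply: eq_bigr => k _; rewrite exprS; ring.
rewrite [X in _ = _ + X]big_ord_recr /= bin_small// !mul0r addr0.
rewrite [LHS]big_ord_recl /= bin0 expr0 !mul1r; congr (_ + _).
Qed.

(** The initial datum of the Dirichlet heat kernel, the point mass at [y] normalised
    with respect to [mu]. *)
Definition datum Om y : V -> R := fun z => \1_Om z * \1_[set y] z / m y.

Lemma datum_off Om y z : z != y -> datum Om y z = 0.
Proof.
move=> zy; rewrite /datum (indicE _ [set y]) memNset ?mulr0 ?mul0r// => /eqP.
by rewrite (negbTE zy).
Qed.

Lemma datum_on Om y : Om y -> datum Om y y = (m y)^-1.
Proof. by move=> Oy; rewrite /datum !indicE !mem_set// !mul1r. Qed.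

Lemma datum_le Om y z : `|datum Om y z| <= (m y)^-1.
Proof.
have mi : 0 <= (m y)^-1 by rewrite invr_ge0 ltW// mu_gt0.
rewrite /datum normrM (ger0_norm mi) ler_piMl//.
by case: (indic01 Om z) => ->; case: (indic01 [set y] z) => ->;
  rewrite ?mul0r ?mul1r ?normr0 ?normr1.
Qed.

Lemma deg_bounded Om : finite_set Om -> exists2 D : R, 0 <= D & forall x, Om x -> deg x <= D.
Proof.
move=> fOm; exists (\sum_(x <- fset_set Om) deg x).
  by apply: sumr_ge0 => x _; exact: deg_ge0.
move=> x Ox; rewrite (big_fsetD1 x) /=; last by rewrite in_fset_set// inE.
by rewrite lerDl; apply: sumr_ge0 => z _; exact: deg_ge0.
Qed.

Lemma iter_dirichlet_le Om (D : R) u (M : R) k x : (forall x, Om x -> deg x <= D) -> 0 <= D ->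
  (forall y, `|u y| <= M) -> `|iter k (L Om) u x| <= (2 * D) ^+ k * M.
Proof.
move=> degD D0 uM; elim: k x => [|k IH] x; first by rewrite expr0 mul1r.
by rewrite iterS exprS -mulrA; exact: dirichlet_le.
Qed.

Definition hkterm Om (t : R) x y (k : nat) : R :=
  t ^+ k / k`!%:R * iter k (L Om) (datum Om y) x.

Lemma hkterm_le Om (D t : R) x y k : (forall x, Om x -> deg x <= D) -> 0 <= D -> 0 <= t ->
  `|hkterm Om t x y k| <= (m y)^-1 * exp_coeff (2 * D * t) k.
Proof.
move=> degD D0 t0; rewrite /hkterm /exp_coeff /= normrM ger0_norm ?divr_ge0 ?exprn_ge0//.
have h1 := iter_dirichlet_le k x degD D0 (datum_le Om y).
apply: (@le_trans _ _ (t ^+ k / k`!%:R * ((2 * D) ^+ k * (m y)^-1))).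
  by rewrite ler_wpM2l// divr_ge0 ?exprn_ge0.
by rewrite [(2 * D * t) ^+ k]exprMn le_eqVlt; apply/orP; left; apply/eqP; ring.
Qed.

Lemma hkterm_summ Om t x y : finite_set Om -> 0 <= t -> summ (hkterm Om t x y).
Proof.
move=> fOm t0; have [D D0 degD] := deg_bounded fOm.
apply: (summ_le (k := fun k => (m y)^-1 * exp_coeff (2 * D * t) k)).
  by apply: summZ; apply: exp_summ; rewrite !mulr_ge0.
by move=> k; apply: hkterm_le.
Qed.

Lemma dirichlet_heat_kernelE Om t x y : finite_set Om -> 0 <= t ->
  dirichlet_heat_kernel G Om t x y = tsum (hkterm Om t x y).
Proof.
by move=> fOm t0; apply: cvg_lim => //; exact/series_tsum/hkterm_summ.
Qed.

Lemma euler_iter_le Om (D a : R) y n x : (forall x, Om x -> deg x <= D) ->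
  0 <= a -> a * D <= 1 -> `|iter n (euler Om a) (datum Om y) x| <= (m y)^-1.
Proof.
move=> degD a0 aD; elim: n x => [|n IH] x; first exact: datum_le.
by rewrite iterS; apply: (euler_le _ degD a0 aD).
Qed.

(** The kernel is the limit of Euler's scheme with [n] steps of length [t / n]. Once [t
    / n] is below the inverse of the rates [deg] on [Om], every step contracts the sup
    norm, and the initial datum is bounded by [1 / mu y]. *)
Lemma dirichlet_heat_kernel_le Om t x y : finite_set Om -> 0 <= t ->
  dirichlet_heat_kernel G Om t x y <= (m y)^-1.
Proof.
move=> fOm t0; rewrite dirichlet_heat_kernelE//.
have [D D0 degD] := deg_bounded fOm.
(* [g_ n k] is the k-th term of the expansion of n.+1 Euler steps of length t / n.+1. *)
pose g_ n k := 'C(n.+1, k)%:R * (t / n.+1%:R) ^+ k * iter k (L Om) (datum Om y) x.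
have gE n k : g_ n k = 'C(n.+1, k)%:R / n.+1%:R ^+ k * k`!%:R * hkterm Om t x y k.
  rewrite /g_ /hkterm exprMn exprVn.
  have k0 : k`!%:R != 0 :> R by rewrite pnatr_eq0 -lt0n fact_gt0.
  have n0 : n.+1%:R ^+ k != 0 :> R by rewrite expf_neq0.
  by move: k0 n0; move: (iter k _ _ x) (k`!%:R) (_ ^+ _) (t ^+ k) ('C(_,_)%:R) =>
    a b e d f b0 e0; field; rewrite b0.
have dom := @dominated_tsum _ _ _ \oo _ g_ (hkterm Om t x y)
  (fun k => (m y)^-1 * exp_coeff (2 * D * t) k).
have [||k|_ cg] := dom.
- by apply: summZ; apply: exp_summ; rewrite !mulr_ge0.
- apply: nearW => n k; rewrite gE normrM ger0_norm; last first.
    by rewrite !mulr_ge0// invr_ge0 exprn_ge0.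
  apply: (@le_trans _ _ (1 * `|hkterm Om t x y k|)).
    rewrite ler_wpM2r// -ler_pdivlMr ?ltr0n ?fact_gt0// div1r; exact: bin_expn_le.
  by rewrite mul1r hkterm_le.
- rewrite (_ : (fun n => g_ n k) =
    (fun n => 'C(n.+1, k)%:R / n.+1%:R ^+ k * k`!%:R * hkterm Om t x y k)); last first.
    by apply/funext => n; rewrite gE.
  rewrite (_ : nbhs (hkterm Om t x y k) = nbhs (k`!%:R^-1 * k`!%:R * hkterm Om t x y k));
    last first.
    by rewrite mulVf ?mul1r// pnatr_eq0 -lt0n fact_gt0.
  by apply: cvgMl; apply: cvgMl; exact: bin_expn_cvg.
apply: (cvgr_to_le cg).
exists (Num.trunc (t * D)) => // n /= tn.
have gs : tsum (g_ n) = iter n.+1 (euler Om (t / n.+1%:R)) (datum Om y) x.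
  rewrite euler_iter.
  have [|_ ->] := @summ_finsupp _ _ (g_ n) (seq_fset tt (iota 0 n.+2)).
    move=> k; rewrite (seq_fsetE tt) mem_iota /= add0n -leqNgt => nk.
    by rewrite /g_ bin_small ?mul0r.
  by rewrite psum_iota /series /= big_mkord.
rewrite gs; apply: le_trans (ler_norm _) _.
have a0 : 0 <= t / n.+1%:R by rewrite divr_ge0.
have aD : t / n.+1%:R * D <= 1.
  rewrite mulrAC ler_pdivrMr// mul1r.
  apply: le_trans (ltW (truncnS_gt (t * D))) _.
  by rewrite ler_nat ltnS.
exact: euler_iter_le degD a0 aD.
Qed.

Lemma heat_kernel_bounded t x y : 0 <= t ->
  has_sup [set dirichlet_heat_kernel G Om t x y | Om in [set Om | finite_set Om]].
Proof.
move=> t0; split; first by exists (dirichlet_heat_kernel G set0 t x y), set0; rewrite /=.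
by exists (m y)^-1 => _ [Om /= fOm <-]; exact: dirichlet_heat_kernel_le.
Qed.

Lemma heat_kernel_ge Om t x y : finite_set Om -> 0 <= t ->
  dirichlet_heat_kernel G Om t x y <= heat_kernel G t x y.
Proof.
by move=> fOm t0; apply: ub_le_sup; [exact: (heat_kernel_bounded x y t0).2|exists Om].
Qed.

Lemma iter_off Om k y x : ~ Om x -> iter k (L Om) (datum Om y) x = 0.
Proof.
move=> xOm; have x0 : \1_Om x = 0 :> R by rewrite indicE memNset.
by case: k => [|k]; rewrite ?iterS /= ?dirichletE /datum x0 !mul0r.
Qed.

Lemma iter_off_datum Om k y x : ~ Om y -> iter k (L Om) (datum Om y) x = 0.
Proof.
move=> yOm.
have s0 : datum Om y = fun=> 0.
  apply/funext => z; rewrite /datum indicE indicE.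
  case: (boolP (z \in [set y])) => [|_]; last by rewrite mulr0 mul0r.
  by rewrite inE /= => ->; rewrite memNset// !mul0r.
rewrite s0; elim: k x => [//|k IH] x; rewrite iterS.
have -> : iter k (L Om) (fun=> 0) = (fun=> 0) by apply/funext => z; exact: IH.
exact: dirichlet0.
Qed.

Lemma heat_kernel_ge0 t x y : 0 <= t -> 0 <= heat_kernel G t x y.
Proof.
move=> t0; apply: le_trans (heat_kernel_ge x y (finite_set0 V) t0).
rewrite dirichlet_heat_kernelE//; apply: tsum_ge0 => k.
by rewrite /hkterm iter_off// mulr0.
Qed.

(** The inner product of [l^2(mu)] on functions supported in [Om]; the Dirichlet
    Laplacian is selfadjoint for it, which makes the kernel symmetric. *)
Definition dotp Om u v : R := \sum_(z <- fset_set Om) m z * u z * v z.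

Definition conductance x y : R := if edge G x y && (y != x) then weight G x y else 0.

Lemma conductanceC x y : conductance x y = conductance y x.
Proof.
rewrite /conductance edge_sym (eq_sym y x); case: ifP => // /andP[yx _].
by rewrite weight_sym// edge_sym.
Qed.

Lemma dirichlet_conductance Om u x : finite_set Om -> Om x ->
  m x * L Om u x = \sum_(y <- fset_set Om) conductance x y * u y - m x * deg x * u x.
Proof.
move=> fOm Ox; have mx : m x != 0 by rewrite gt_eqF// mu_gt0.
rewrite dirichletE indicE mem_set// mul1r mulrBr mulrA mulfV// mul1r mulrA; congr (_ - _).
pose g y := conductance x y * (\1_Om y * u y).
transitivity (psum g (nbr x)).
  rewrite /psum big_mkcond /= big_seq [RHS]big_seq; apply: eq_bigr => y.
  by rewrite in_nbr /g /conductance => ->; case: ifP; rewrite ?mul0r.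
have [|_ <-] := @summ_finsupp _ _ g (nbr x).
  by move=> y; rewrite in_nbr /g /conductance => /negbTE ->; rewrite mul0r.
have [|_ ->] := @summ_finsupp _ _ g (fset_set Om).
  by move=> y; rewrite in_fset_set// notin_setE /g indicE => yOm; rewrite memNset// mul0r mulr0.
rewrite /psum big_seq [RHS]big_seq; apply: eq_bigr => y; rewrite in_fset_set//.
by rewrite /g indicE => ->; rewrite mul1r.
Qed.

Lemma dotp_dirichlet Om u v : finite_set Om -> dotp Om (L Om u) v = dotp Om u (L Om v).
Proof.
move=> fOm; rewrite /dotp.
have E (a b : V -> R) : \sum_(z <- fset_set Om) m z * L Om a z * b z =
    \sum_(z <- fset_set Om) \sum_(y <- fset_set Om) conductance z y * a y * b z
    - \sum_(z <- fset_set Om) m z * deg z * a z * b z.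
  rewrite -sumrB big_seq [RHS]big_seq; apply: eq_bigr => z.
  by rewrite in_fset_set// inE => zOm; rewrite dirichlet_conductance// mulrBl mulr_suml.
have -> : \sum_(z <- fset_set Om) m z * u z * L Om v z = \sum_(z <- fset_set Om) m z * L Om v z *
  u z.
  by apply: eq_bigr => z _; rewrite mulrAC.
rewrite !E; congr (_ - _); last by apply: eq_bigr => z _; rewrite mulrAC.
rewrite exchange_big /=; apply: eq_bigr => y _; apply: eq_bigr => z _.
by rewrite conductanceC; ring.
Qed.

Lemma dotp_iter Om k u v : finite_set Om ->
  dotp Om (iter k (L Om) u) v = dotp Om u (iter k (L Om) v).
Proof.
move=> fOm; elim: k u v => [//|k IH] u v.
by rewrite iterS dotp_dirichlet// IH -iterSr.
Qed.

Lemma dotp_datum Om u x : finite_set Om -> Om x -> dotp Om u (datum Om x) = u x.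
Proof.
move=> fOm Ox; have mx : m x != 0 by rewrite gt_eqF// mu_gt0.
rewrite /dotp (big_fsetD1 x) /=; last by rewrite in_fset_set// inE.
rewrite big_seq big1 ?addr0; last first.
  by move=> z; rewrite !inE => /andP[zx _]; rewrite datum_off ?mulr0.
by rewrite datum_on//; field.
Qed.

Lemma dirichlet_heat_kernelC Om t x y : finite_set Om -> 0 <= t ->
  dirichlet_heat_kernel G Om t x y = dirichlet_heat_kernel G Om t y x.
Proof.
move=> fOm t0; rewrite !dirichlet_heat_kernelE//; congr tsum; apply/funext => k.
rewrite /hkterm; congr (_ * _).
have [Ox|Ox] := pselect (Om x); last by rewrite iter_off// iter_off_datum.
have [Oy|Oy] := pselect (Om y); last by rewrite iter_off_datum// iter_off.
rewrite -(dotp_datum _ fOm Ox) dotp_iter//.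
rewrite -[RHS](dotp_datum _ fOm Oy) /dotp; apply: eq_bigr => z _.
by rewrite mulrAC.
Qed.

Lemma heat_kernelC t x y : 0 <= t -> heat_kernel G t x y = heat_kernel G t y x.
Proof.
move=> t0; rewrite /heat_kernel; congr sup; apply/seteqP; split => _ [Om /= fOm <-];
  by exists Om => //; rewrite dirichlet_heat_kernelC.
Qed.

(** On the set of the single vertex [x] the Dirichlet Laplacian is multiplication by [-
    deg x], so that its kernel is [exp(- deg(x) t) / mu(x)]. *)
Lemma heat_kernel_diag t x : 0 <= t -> 1 - deg x * t <= heat_kernel G t x x * m x.
Proof.
move=> t0; have mx := mu_gt0 G x.
have f1 := finite_set1 x.
rewrite -ler_pdivrMr//; apply: le_trans (heat_kernel_ge x x f1 t0).
have it k : iter k (L [set x]) (datum [set x] x) x = (- deg x) ^+ k * (m x)^-1.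
  elim: k => [|k IH]; first by rewrite /= /datum indicE mem_set// !mul1r.
  rewrite iterS dirichletE big1; last first.
    by move=> y yx; rewrite indicE memNset ?mul0r ?mulr0// => /eqP; rewrite (negbTE yx).
  by rewrite IH indicE mem_set// mulr0 mul1r exprS; ring.
rewrite dirichlet_heat_kernelE// (_ : hkterm _ _ _ _ = fun k =>
  (m x)^-1 * exp_coeff (- (deg x * t)) k); last first.
  apply/funext => k; rewrite /hkterm it /exp_coeff /= -(mulNr (deg x) t) (exprMn_comm _ (mulrC (-
    deg x) t)).
  move: ((- deg x) ^+ k) => a.
  by ring.
have es : summ (exp_coeff (- (deg x * t))).
  apply: (summ_le (exp_summ (x := deg x * t) _)) => [|k].
    by rewrite mulr_ge0 ?deg_ge0.
  rewrite /exp_coeff /= normrM normrX normrN (ger0_norm (mulr_ge0 (deg_ge0 x) t0)).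
  by rewrite ger0_norm ?invr_ge0.
rewrite tsumZ// mulrC ler_wpM2l ?invr_ge0 ?(ltW mx)//.
have <- : expR (- (deg x * t)) = tsum (exp_coeff (- (deg x * t))).
  by apply: cvg_lim => //; exact: series_tsum.
exact: expR_ge1Dx.
Qed.

(** On the set of the two vertices [x] and [y] the kernel divided by [t] tends, as [t]
    tends to 0, to the Laplacian of the initial datum at [x], which is [w_xy / (mu(x)
    mu(y)) > 0]. *)
Lemma heat_kernel_edge x y : x != y -> edge G x y ->
  exists2 c : R, 0 < c & \forall t \near (0 : R)^'+, c * t <= heat_kernel G t x y.
Proof.
move=> xy exy; pose Om := [set x; y].
have fOm : finite_set Om by exact: finite_set2.
have [D D0 degD] := deg_bounded fOm.
have mx := mu_gt0 G x; have my := mu_gt0 G y; have wxy := weight_gt0 exy.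
have a0 : datum Om y x = 0.
  by rewrite datum_off.
pose a1 := L Om (datum Om y) x.
have a1E : a1 = (m x)^-1 * (weight G x y * (m y)^-1).
  rewrite /a1 dirichletE a0 mulr0 subr0 indicE mem_set ?mul1r; last by left.
  congr (_ * _); rewrite big_mkcond (big_fsetD1 y) ?in_nbr//= eq_sym xy.
  rewrite big_seq big1 ?addr0; last first.
    move=> z; rewrite !inE => /andP[zy _]; case: ifP => // _.
    by rewrite datum_off// !mulr0.
  have Oy : Om y by right.
  by rewrite datum_on// indicE mem_set// mul1r.
have a1p : 0 < a1 by rewrite a1E !mulr_gt0 ?invr_gt0.
(* [g_ t] is the heat series divided by t: its term of order 0 vanishes because x and y
   are distinct. *)
pose g_ t k : R := if k is k'.+1 then t ^+ k' / k`!%:R * iter k (L Om) (datum Om y) x else 0.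
pose g k : R := if k == 1%N then a1 else 0.
have [||k|gs cg] := @dominated_tsum _ _ _ (0^'+ : set_system R) _ g_ g
  (fun k => (m y)^-1 * exp_coeff (2 * D) k).
- by apply/summZ/exp_summ/mulr_ge0.
- near=> t => k; have t0 : 0 < t by near: t; exact: nbhs_right_gt.
  have t1 : t <= 1 by near: t; apply: nbhs_right_le.
  have e0 : 0 <= (m y)^-1 * exp_coeff (2 * D) k.
    by rewrite mulr_ge0 ?invr_ge0 ?(ltW my)// exp_coeff_ge0// mulr_ge0.
  case: k e0 => [|k] e0; first by rewrite /g_ normr0.
  rewrite /g_ normrM ger0_norm ?divr_ge0 ?exprn_ge0 ?(ltW t0)//.
  apply: le_trans (ler_wpM2l _ (iter_dirichlet_le k.+1 x degD D0 (datum_le Om y))) _.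
    by rewrite divr_ge0 ?exprn_ge0 ?(ltW t0).
  rewrite /exp_coeff /=.
  have tk : t ^+ k <= 1 by rewrite exprn_ile1// ltW.
  have pos : 0 <= k.+1`!%:R^-1 * ((2 * D) ^+ k.+1 * (m y)^-1).
    by rewrite !mulr_ge0 ?invr_ge0 ?exprn_ge0 ?(ltW my)// mulr_ge0.
  have := ler_wpM2r pos tk; rewrite mul1r mulrA => /le_trans; apply.
  by rewrite le_eqVlt; apply/orP; left; apply/eqP; ring.
- rewrite /g_ /g; case: k => [|[|k]] /=; first exact: cvg_cst.
    rewrite -/a1; under eq_fun do rewrite expr0 invr1 !mul1r; exact: cvg_cst.
  have h : (fun t : R => t ^+ k.+1) @ (0 : R)^'+ --> (0 : R).
    suff: (fun t : R => t ^+ k.+1) @ (0 : R)^'+ --> ((0 : R) ^+ k.+1) by rewrite expr0n.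
    by apply: cvg_at_right_filter; exact: exprn_continuous.
  by have := cvgMr_tmp (b := iter k.+2 (L Om) (datum Om y) x) (cvgMr_tmp (b := k.+2`!%:R^-1) h)
    => h2; rewrite !mul0r in h2; exact: h2.
have [_ tg] := @tsum1 _ _ g 1%N (fun k k1 => ifN_eq _ _ k1).
rewrite tg /g eqxx in cg.
exists (a1 / 2); first by rewrite divr_gt0.
have a12 : a1 / 2 < a1 by lra.
have /= ha := cvgr_gt _ cg _ a12.
near=> t; have t0 : 0 < t by near: t; exact: nbhs_right_gt.
apply: le_trans (heat_kernel_ge x y fOm (ltW t0)).
rewrite (dirichlet_heat_kernelE _ _ fOm (ltW t0)).
have E : hkterm Om t x y = fun k => t * g_ t k.
  apply/funext => -[|k]; rewrite /hkterm /g_ /=; first by rewrite a0 !mulr0.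
  by rewrite exprS; ring.
have gts : summ (g_ t).
  have := summZ t^-1 (hkterm_summ x y fOm (ltW t0)); rewrite E.
  by under eq_fun do rewrite mulKf ?gt_eqF//.
rewrite E tsumZ// mulrC ler_pM2l//; apply: ltW.
near: t; exact: ha.
Unshelve. all: by end_near. Qed.

(** By stochastic completeness the mass off the diagonal is [1 - p(t,x,x) mu(x)], which
    [heat_kernel_diag] bounds. *)
Lemma heat_kernel_offdiag (t : R) x (A : {fset V}) :
  stochastically_complete G -> 0 < t -> x \notin A ->
  psum (fun y => heat_kernel G t x y * m y) A <= Num.min 1 (deg x * t).
Proof.
move=> /(_ t x)sc t0 xA; have := sc t0 => {}sc.
have le1 B : psum (fun y => heat_kernel G t x y * m y) B <= 1.
  by move: B; apply/esum_le_psum; rewrite sc.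
have hk0 y : 0 <= heat_kernel G t x y * m y.
  by rewrite mulr_ge0 ?heat_kernel_ge0 ?(ltW t0)// ltW// mu_gt0.
rewrite le_min le1 /=.
have := le1 (x |` A)%fset; rewrite /psum big_fsetU1//=.
have := heat_kernel_diag x (ltW t0).
by move: (heat_kernel _ _ _ _ * _) (deg x * t) (\sum_(_ <- _) _) => a b d; lra.
Qed.

End Dirichlet.

(** * The weights *)

Section Weights.
Context {R : realType} {V : countType} (G : weighted_graph R V) (s : R).
Hypothesis Glf : locally_finite G.
Hypothesis Gsc : stochastically_complete G.
Hypothesis s_gt0 : 0 < s.
Hypothesis s_lt1 : s < 1.
Implicit Types (x y : V).

Notation m := (mu G).
Notation nu := (@lebesgue_measure R).
Notation I f := (\int[nu]_(t in `]0%R, +oo[) (f t)%:E)%E.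

Definition hkint x y (t : R) := heat_kernel G t x y * t `^ (-1 - s).

Lemma hkint_ge0 x y (t : R) : `]0, +oo[%classic t -> 0 <= hkint x y t.
Proof.
by rewrite /= in_itv /= andbT => t0; rewrite mulr_ge0 ?powR_ge0 ?heat_kernel_ge0 ?(ltW t0).
Qed.

Definition hkcst : R := s / Gamma (1 - s).

Lemma hkcst_gt0 : 0 < hkcst.
Proof. by rewrite divr_gt0 ?Gamma_gt0. Qed.

Definition hkJ x y : R := Rintegral nu `]0, +oo[ (hkint x y).

Lemma WsE x y : Ws G s x y = hkcst * m x * m y * hkJ x y.
Proof. by []. Qed.

Lemma hkJ_ge0 x y : 0 <= hkJ x y.
Proof. by apply/fine_ge0/integral_ge0 => t t0; rewrite lee_fin hkint_ge0. Qed.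

Lemma hkJC x y : hkJ x y = hkJ y x.
Proof.
have E : I (hkint x y) = I (hkint y x).
  apply: eq_integral => t; rewrite inE /= in_itv /= andbT => t0.
  by rewrite /hkint heat_kernelC// ltW.
by rewrite -[LHS]/(fine (I (hkint x y))) E.
Qed.

Lemma hkmu_ge0 x y : 0 <= hkcst * m x * m y.
Proof. exact: mulr_ge0 (mulr_ge0 (ltW hkcst_gt0) (ltW (mu_gt0 G x))) (ltW (mu_gt0 G y)). Qed.

Lemma Ws_ge0 x y : 0 <= Ws G s x y.
Proof. rewrite WsE; exact: mulr_ge0 (hkmu_ge0 x y) (hkJ_ge0 x y). Qed.

Lemma Ws_sym x y : Ws G s x y = Ws G s y x.
Proof. by rewrite !WsE hkJC (mulrAC hkcst). Qed.

(** A majorant of [sum_(y <> x) p(t,x,y) mu(y) t^(-1-s)], integrable in [t] since [0 < s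
    < 1]. *)
Definition hkdom x (t : R) := Num.min 1 (deg G x * t) * t `^ (-1 - s).

Lemma hkdom_ge0 x (t : R) : `]0, +oo[%classic t -> 0 <= hkdom x t.
Proof.
rewrite /= in_itv /= andbT => t0.
by rewrite mulr_ge0 ?powR_ge0// le_min ler01 mulr_ge0 ?deg_ge0// ltW.
Qed.

Lemma hkdom_lty x : (I (hkdom x) < +oo)%E.
Proof.
have d0 := deg_ge0 Glf x.
apply: (@integral_0y_lty _ s (1 + deg G x)) => //.
- by rewrite addr_ge0.
- apply: measurable_funM; last exact: measurable_powR.
  by apply: measurable_minr => //; exact: measurable_funM.
- by move=> t t0; apply: hkdom_ge0; rewrite /= in_itv /= t0.
- move=> t t0 t1; rewrite /hkdom.
  have tE : t `^ (- s) = t * t `^ (-1 - s).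
    have /(congr1 (powR t)) -> : - s = 1 + (-1 - s) by ring.
    by rewrite powRD ?(gt_eqF t0) ?implybT// powRr1// ltW.
  rewrite tE mulrA ler_wpM2r ?powR_ge0//.
  by rewrite ge_min; apply/orP; right; rewrite ler_wpM2r ?(ltW t0)// lerDr.
- move=> t t1; rewrite /hkdom ler_wpM2r ?powR_ge0//.
  by rewrite ge_min; apply/orP; left; rewrite lerDl.
Qed.

Lemma hkint_dom x y (t : R) : x != y -> 0 < t -> m y * hkint x y t <= hkdom x t.
Proof.
move=> xy t0; rewrite /hkint /hkdom mulrA ler_wpM2r ?powR_ge0//.
have := @heat_kernel_offdiag _ _ _ Glf t x [fset y]%fset Gsc t0.
by rewrite inE xy /psum big_seq_fset1 mulrC; exact.
Qed.

Lemma hkint_lty x y : x != y -> (I (hkint x y) < +oo)%E.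
Proof.
move=> xy; have my := mu_gt0 G y.
rewrite -(@lte_pmul2l _ (m y)%:E)// ?lte_fin//.
have h := @integral_superZ _ _ _ nu `]0, +oo[%classic (hkint x y) _ (ltW my) (hkint_ge0 x y).
rewrite (gt0_muley _) ?lte_fin//; apply: le_lt_trans h _.
apply: le_lt_trans (hkdom_lty x); apply: le_integral_ge0 => t t0.
  by rewrite lee_fin mulr_ge0 ?(ltW my)// hkint_ge0.
by rewrite lee_fin hkint_dom//; move: t0; rewrite /= in_itv /= andbT.
Qed.

Lemma hkdomE x : I (hkdom x) = (Rintegral nu `]0, +oo[ (hkdom x))%:E.
Proof. by apply: Rintegral_fin; [exact: hkdom_ge0|exact: hkdom_lty]. Qed.

Lemma hkintE x y : x != y -> I (hkint x y) = (hkJ x y)%:E.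
Proof. by move=> xy; apply: Rintegral_fin; [exact: hkint_ge0|exact: hkint_lty]. Qed.

(** The sum over [y] goes inside the integral by superadditivity, and is dominated
    there. *)
Lemma Ws_psum x (A : {fset V}) : x \notin A ->
  psum (Ws G s x) A <= hkcst * m x * Rintegral nu `]0, +oo[ (hkdom x).
Proof.
move=> xA.
rewrite (_ : psum _ _ = hkcst * m x * \sum_(y <- A) m y * hkJ x y); last first.
  by rewrite /psum mulr_sumr; apply: eq_bigr => y _; rewrite WsE mulrA.
rewrite (ler_wpM2l (mulr_ge0 (ltW hkcst_gt0) (ltW (mu_gt0 G x))))//.
rewrite -lee_fin -(hkdomE x) -sumEFin.
have -> : (\sum_(y <- A) (m y * hkJ x y)%:E =
    \sum_(y <- A) (m y)%:E * I (hkint x y))%E.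
  rewrite big_seq [RHS]big_seq; apply: eq_bigr => y yA.
  rewrite hkintE//.
  by apply: contraNneq xA => ->.
apply: le_trans (integral_supersum nu A (fun y => ltW (mu_gt0 G y)) (hkint_ge0 x)) _.
apply: le_integral_ge0 => t t0.
  by rewrite lee_fin sumr_ge0// => y _; rewrite mulr_ge0 ?(ltW (mu_gt0 _ _))// hkint_ge0.
move: (t0); rewrite /= in_itv /= andbT => t0'.
rewrite lee_fin /hkdom; apply: le_trans (ler_wpM2r _ (heat_kernel_offdiag Glf Gsc t0' xA)).
  by rewrite /psum mulr_suml; apply: ler_sum => y _; rewrite /hkint mulrA (mulrC (m y)).
exact: powR_ge0.
Qed.

Lemma Ws_summ x : summ (Ws G s x).
Proof.
apply: (@summ_bound _ _ _ (Ws G s x x + hkcst * m x * Rintegral nu `]0,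
  +oo[ (hkdom x)) (Ws_ge0 x)) => A.
apply: le_trans (psum_subset (B := (x |` A)%fset) (Ws_ge0 x) _) _; first exact: fsubsetU1.
rewrite /psum (big_fsetD1 x) ?inE ?eqxx//= lerD2l.
by apply: Ws_psum; rewrite !inE eqxx.
Qed.

(** The integrand is bounded below on a compact interval of small positive times. *)
Lemma Ws_gt0 x y : x != y -> edge G x y -> 0 < Ws G s x y.
Proof.
move=> xy exy; rewrite WsE;
  apply: (mulr_gt0 (mulr_gt0 (mulr_gt0 hkcst_gt0 (mu_gt0 G x)) (mu_gt0 G y))).
have [c c0 [d /= d0 hd]] := heat_kernel_edge Glf xy exy.
rewrite -lte_fin -hkintE//.
have d40 : 0 < d / 4 by rewrite divr_gt0.
have d42 : d / 4 < d / 2 by lra.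
apply: (integral_0y_gt0 (c := c * (d / 4) * (d / 2) `^ (-1 - s)) d40 d42).
- by rewrite !mulr_gt0 ?powR_gt0//; lra.
- by move=> t t0; apply: hkint_ge0; rewrite /= in_itv /= t0.
move=> t td4 td2; have t0 : 0 < t by lra.
rewrite /hkint; apply: ler_pM; [exact: mulr_ge0 (ltW c0) (ltW d40)|exact: powR_ge0| |].
  apply: (@le_trans _ _ (c * t)); first by rewrite ler_pM2l.
  by apply: hd => //=; rewrite sub0r normrN gtr0_norm//; lra.
rewrite (_ : -1 - s = - (1 + s)); last by ring.
rewrite !powRN lef_pV2 ?posrE ?powR_gt0//; last by lra.
by apply: le_powR; [rewrite addr_ge0 ?(ltW s_gt0)|exact: ltW|].
Qed.

End Weights.

(** * The truncated nonlinearity *)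

Section Nonlinearity.
Context {R : realType} {V : countType} (p : R) (f : V -> R -> R) (alpha : R).
Hypothesis p2 : 2 <= p.
Hypothesis A1 : forall x : V, {within `[0, +oo[, continuous (f x)} /\ f x 0 = 0.
Hypothesis A2 : forall M : R, 0 < M -> exists C : R, forall (x : V) (y : R),
        0 <= y <= M -> f x y <= C.
Hypothesis alpha_gt : p < alpha.
Hypothesis A3 : forall (x : V) (y : R), 0 < y ->
        0 < alpha * primitive f x y /\ alpha * primitive f x y <= y * f x y.
Hypothesis A5 : forall (x : V) (y z : R), 0 < y -> y < z ->
        f x y / y `^ (p - 1) < f x z / z `^ (p - 1).
Implicit Types (x : V) (y z a b : R).

Notation nu := (@lebesgue_measure R).

(** The extension of [f x] by 0 to negative arguments is continuous on the whole line
    because [f x 0 = 0], and [Fpos x] is its primitive, a C^1 function. *)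
Definition fpos x y : R := f x (Num.max y 0).
Definition Fpos x y : R := primitive f x (Num.max y 0).

Lemma pge0 : 0 < p. Proof. by apply: lt_le_trans p2. Qed.
Lemma pgt1 : 1 < p. Proof. by apply: lt_le_trans p2; rewrite ltr1n. Qed.
Lemma alpha_gt0 : 0 < alpha. Proof. exact: lt_trans pge0 alpha_gt. Qed.

Lemma fpos_neg x y : y <= 0 -> fpos x y = 0.
Proof. by move=> y0; rewrite /fpos max_r// (A1 x).2. Qed.

Lemma fpos_pos x y : 0 <= y -> fpos x y = f x y.
Proof. by move=> y0; rewrite /fpos max_l. Qed.

Lemma fpos_continuous x : continuous (fpos x).
Proof.
move=> y; have /subspace_continuousP h := (A1 x).1.
have m0 : `[0, +oo[%classic (Num.max y 0) by rewrite /= in_itv /= andbT le_max lexx orbT.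
apply: (cvg_comp (fun z : R => Num.max z 0) (f x) _ (h _ m0)).
move=> A [e /= e0 hA].
have /cvgrPdist_lt /(_ _ e0) : (fun z : R => Num.max z 0) @ y --> Num.max y 0.
  by apply: continuous_max; [exact: cvg_id|exact: cvg_cst].
by apply: filterS => z zA; apply: hA => //=; rewrite in_itv /= andbT le_max lexx orbT.
Qed.

Lemma Fpos_neg x y : y <= 0 -> Fpos x y = 0.
Proof.
move=> y0; rewrite /Fpos max_r// /primitive set_itv1 /Rintegral.
by rewrite integral_set1.
Qed.

Lemma Fpos_integral x y a : a < 0 -> a < y ->
  Fpos x y = \int[nu]_(t in `[a, y]) fpos x t.
Proof.
move=> a0 ay; rewrite /Fpos /primitive Rintegral_mkcond [RHS]Rintegral_mkcond.
congr (Rintegral _ _); apply/funext => t; rewrite /patch.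
have [t0|t0] := ltP t 0.
  rewrite memNset; last by rewrite /= in_itv /= leNgt t0.
  by case: ifP => // _; rewrite fpos_neg// ltW.
rewrite fpos_pos//.
have [ty|yt] := leP t y.
  by rewrite !mem_set//= in_itv /= ?ty ?t0 ?andbT ?le_max ?ty// (le_trans (ltW a0)).
rewrite [t \in `[a, y]%classic]memNset; last by rewrite /= in_itv /= => /andP[_]; rewrite leNgt yt.
case: ifP => //; rewrite inE /= in_itv /= t0 /= le_max leNgt yt /= => t0'.
have -> : t = 0 by apply: le_anti; rewrite t0' t0.
by rewrite (A1 x).2.
Qed.

Lemma Fpos_derive x y : is_derive y (1 : R) (Fpos x) (fpos x y).
Proof.
pose a := Num.min y 0 - 1.
have a0 : a < 0 by rewrite /a ltrBlDr add0r gt_min ltr01 orbT.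
have ay : a < y by rewrite /a ltrBlDr gt_min ltrDl ltr01.
have yu : y < y + 1 by rewrite ltrDl.
have au : a < y + 1 by apply: lt_trans yu.
have ig : nu.-integrable `[a, y + 1] (EFin \o fpos x).
  apply: continuous_compact_integrable; first exact: segment_compact.
  exact/continuous_subspaceT/fpos_continuous.
have cf : {for y, continuous (fpos x)} by exact: fpos_continuous.
have [dG DG] := continuous_FTC1_closed yu ig ay cf.
set F := (fun x0 : R => _) in dG DG.
have FE : \near y, F y = Fpos x y.
  near=> z; rewrite /F (@Fpos_integral x z a)//.
  by near: z; exact: lt_nbhsr.
apply: DeriveDef.
  exact: near_eq_derivable FE dG.
by rewrite -DG derive1E; apply/esym/near_eq_derive.
Unshelve. all: by end_near. Qed.

Lemma Fpos_continuous x : continuous (Fpos x).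
Proof.
move=> y; apply: differentiable_continuous; apply/derivable1_diffP.
by have [] := Fpos_derive x y.
Qed.

Lemma Fpos_MVT x a b : exists2 c, Num.min a b <= c <= Num.max a b &
  Fpos x b - Fpos x a = fpos x c * (b - a).
Proof.
have H a' b' : a' < b' -> exists2 c, a' <= c <= b' & Fpos x b' - Fpos x a' = fpos x c * (b' - a').
  move=> ab; have [|c] := @MVT _ (Fpos x) (fpos x) a' b' ab (fun z _ => Fpos_derive x z).
    exact/continuous_subspaceT/Fpos_continuous.
  by rewrite in_itv /= => /andP[h1 h2] h3; exists c => //; rewrite !ltW.
have [ab|ba|<-] := ltgtP a b.
- exact: H.
- have [c h1 h2] := H _ _ ba; exists c => //.
  by rewrite -opprB h2 -mulrN opprB.
- by exists a; rewrite ?lexx// !subrr mulr0.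
Qed.

Lemma ambrosetti_rabinowitz x y : 0 < y -> 0 < Fpos x y /\ alpha * Fpos x y <= y * fpos x y.
Proof.
move=> y0; have [h1 h2] := A3 x y0; rewrite /Fpos (fpos_pos _ (ltW y0)) (max_l (ltW y0)).
by split; [move: h1; rewrite pmulr_rgt0 ?alpha_gt0|exact: h2].
Qed.

Lemma Fpos_ge0 x y : 0 <= Fpos x y.
Proof.
have [y0|y0] := leP y 0; first by rewrite Fpos_neg.
by have [/ltW] := ambrosetti_rabinowitz x y0.
Qed.

Lemma fpos_gt0 x y : 0 < y -> 0 < fpos x y.
Proof.
move=> y0; have [h1 h2] := ambrosetti_rabinowitz x y0.
by rewrite -(pmulr_rgt0 _ y0); apply: lt_le_trans h2; rewrite mulr_gt0 ?alpha_gt0.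
Qed.

Lemma fpos_ge0 x y : 0 <= fpos x y.
Proof.
have [y0|y0] := leP y 0; first by rewrite fpos_neg.
exact/ltW/fpos_gt0.
Qed.

(** By [A5] this quotient is increasing in [y > 0]; it is also the derivative of [Fpos
    x] with respect to [y^p / p]. *)
Definition slope x y := fpos x y / y `^ (p - 1).

Lemma slope_lt x y z : 0 < y -> y < z -> slope x y < slope x z.
Proof.
move=> y0 yz; have z0 := lt_trans y0 yz.
by rewrite /slope (fpos_pos _ (ltW y0)) (fpos_pos _ (ltW z0)); exact: A5.
Qed.

Lemma slope_gt0 x y : 0 < y -> 0 < slope x y.
Proof. by move=> y0; rewrite divr_gt0 ?fpos_gt0 ?powR_gt0. Qed.

Lemma slopeE x y : 0 < y -> fpos x y = slope x y * y `^ (p - 1).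
Proof. by move=> y0; rewrite /slope divfK// gt_eqF// powR_gt0. Qed.

Lemma slope_mul x y : 0 < y -> y * fpos x y = slope x y * y `^ p.
Proof. by move=> y0; rewrite slopeE// mulrCA mulr_powRB1 ?pge0// ltW. Qed.

(** As a function of [y^p], [Fpos x] has an increasing derivative, so it lies above its
    tangent at [b^p]. *)
Lemma Fpos_pconvex x a b : 0 < a -> 0 < b ->
  Fpos x b + slope x b * (a `^ p - b `^ p) / p <= Fpos x a.
Proof.
move=> a0 b0; pose c := slope x b.
pose phi (t : R) := Fpos x t - c * (p^-1 * t `^ p).
have dphi (t : R) : 0 < t -> is_derive t (1 : R) phi (fpos x t - c * t `^ (p - 1)).
  move=> t0; have d1 := Fpos_derive x t.
  have d2 := @is_deriveZ _ _ _ _ c _ _ _ (@is_deriveZ _ _ _ _ p^-1 _ _ _ (is_derive_powR p t0)).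
  have := is_deriveB d1 d2; rewrite /GRing.scale /= (mulrA p^-1) mulVf ?mul1r//.
  by rewrite gt_eqF// pge0.
have key (u v : R) : 0 < u -> u < v -> exists2 t,
  u < t < v & phi v - phi u = (fpos x t - c * t `^ (p - 1)) * (v - u).
  move=> u0 uv; have [t||t] := @MVT _ phi (fun t => fpos x t - c * t `^ (p - 1)) u v uv.
  - by rewrite in_itv /= => /andP[ut _]; exact: dphi (lt_trans u0 ut).
  - apply: derivable_within_continuous => t; rewrite in_itv /= => /andP[ut _].
    by have [] := dphi t (lt_le_trans u0 ut).
  - by rewrite in_itv /= => ut h; exists t.
suff : phi b <= phi a.
  rewrite /phi /c; move: (a `^ p) (b `^ p) (slope x b) (Fpos x a) (Fpos x b) p^-1 => A B C D E q;
    lra.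
have [ab|ba|<-//] := ltgtP a b.
- have [t /andP[at_ tb] h] := key _ _ a0 ab.
  have t0 := lt_trans a0 at_.
  rewrite -subr_le0 h mulr_le0_ge0 ?subr_ge0 ?(ltW ab)// subr_le0 slopeE//.
  by rewrite ler_wpM2r ?powR_ge0// ltW// slope_lt.
- have [t /andP[bt ta] h] := key _ _ b0 ba.
  have t0 := lt_trans b0 bt.
  rewrite -subr_ge0 h mulr_ge0 ?subr_ge0 ?(ltW ba)// slopeE// ler_wpM2r ?powR_ge0// ltW//.
  exact: slope_lt.
Qed.

(** The density of the functional minus [1 / p] times its derivative along [u] itself:
    the energies cancel. On the Nehari set the derivative vanishes and this is the
    density of the functional. *)
Definition Hpos x y := fpos x y * Num.max y 0 / p - Fpos x y.

Lemma Hpos_neg x y : y <= 0 -> Hpos x y = 0.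
Proof. by move=> y0; rewrite /Hpos fpos_neg// Fpos_neg// !mul0r subrr. Qed.

Lemma Hpos_gt0 x y : 0 < y -> 0 < Hpos x y.
Proof.
move=> y0; have [h1 h2] := ambrosetti_rabinowitz x y0; rewrite /Hpos subr_gt0 ltr_pdivlMr ?pge0//.
rewrite max_l ?(ltW y0)// (mulrC (fpos _ _)); apply: lt_le_trans h2.
by rewrite mulrC ltr_pM2r.
Qed.

(** [Fpos_pconvex] bounds the growth of [Fpos x] between [y] and [z] by that of [slope x
    z * y^p / p], and the slope is strictly increasing. *)
Lemma Hpos_lt x y z : 0 < y -> y < z -> Hpos x y < Hpos x z.
Proof.
move=> y0 yz; have z0 := lt_trans y0 yz.
have h1 := Fpos_pconvex x y0 z0.
have h2 := slope_lt x y0 yz.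
rewrite /Hpos !max_l ?(ltW y0) ?(ltW z0)// (mulrC (fpos x y)) (mulrC (fpos x z)) !slope_mul//.
have yp : 0 < y `^ p / p by rewrite divr_gt0 ?powR_gt0 ?pge0.
have h3 : slope x y * (y `^ p / p) < slope x z * (y `^ p / p) by rewrite ltr_pM2r.
move: h1 h3; rewrite mulrBr mulrBl !mulrA.
move: (slope x y * _ / p) (slope x z * y `^ p / p) (slope x z * z `^ p / p) (Fpos x y) (Fpos x z)
  => A B C D E; lra.
Qed.

Lemma Hpos_ge0 x y : 0 <= Hpos x y.
Proof.
have [y0|y0] := leP y 0; first by rewrite Hpos_neg.
exact/ltW/Hpos_gt0.
Qed.

(** The slope on [(0, M]] is at most its value at [M], which [A2] bounds uniformly in
    [x]. *)
Lemma fpos_growth M : 0 < M -> exists2 C, 0 <= C & forall x y, `|y| <= M ->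
  fpos x y <= C * `|y| `^ (p - 1).
Proof.
move=> M0; have [C0 hC0] := A2 M0.
have Mp : 0 < M `^ (p - 1) by rewrite powR_gt0.
exists (`|C0| / M `^ (p - 1)); first by rewrite divr_ge0// ltW.
move=> x y; have [y0|y0] := leP y 0.
  by move=> _; rewrite fpos_neg// mulr_ge0 ?powR_ge0// divr_ge0// ltW.
rewrite (gtr0_norm y0) => yM; rewrite slopeE// ler_wpM2r ?powR_ge0//.
apply: (@le_trans _ _ (slope x M)).
  by move: yM; rewrite le_eqVlt => /predU1P[->//|yM]; rewrite ltW// slope_lt.
rewrite /slope ler_wpM2r ?invr_ge0 ?(ltW Mp)// fpos_pos ?(ltW M0)//.
by apply: le_trans (ler_norm _); apply: hC0; rewrite lexx andbT ltW.
Qed.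

Lemma Fpos_le x y : Fpos x y <= fpos x y * Num.max y 0.
Proof.
have [y0|y0] := leP y 0; first by rewrite Fpos_neg// fpos_neg// mul0r.
have [h1 h2] := ambrosetti_rabinowitz x y0; rewrite mulrC; apply: le_trans h2.
by rewrite ler_peMl ?(ltW h1)// ltW// (lt_trans pgt1).
Qed.

(** Otherwise the increasing slope has a finite supremum [k]; for large [y] then [Fpos x
    y] is about [k y^p / p] and [A3] gives [alpha k / p <= k], against [p < alpha]. *)
Lemma slope_unbounded x K : exists2 t, 0 < t & K <= slope x t.
Proof.
have [[t t0 Kt]|nK] := pselect (exists2 t, 0 < t & K <= slope x t); first by exists t.
exfalso.
have sK t : 0 < t -> slope x t < K.
  by move=> t0; rewrite ltNge; apply/negP => Kt; apply: nK; exists t.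
pose S := [set slope x t | t in [set t | 0 < t]].
have hS : has_sup S.
  by split; [exists (slope x 1), 1 => /=|exists K => _ [t /= t0 <-]; exact/ltW/sK].
pose k := sup S.
have sk t : 0 < t -> slope x t <= k by move=> t0; apply: ub_le_sup; [exact: hS.2|exists t].
have k0 : 0 < k by apply: lt_le_trans (sk 1 ltr01); exact: slope_gt0.
have ap : 0 < 1 - p / alpha by rewrite subr_gt0 ltr_pdivrMr ?alpha_gt0// mul1r.
(* b is such that slope x b exceeds (p / alpha) k. *)
have [_ [b /= b0 <-] hb] := sup_adherent (mulr_gt0 k0 ap) hS.
rewrite -/k in hb.
have hb' : p / alpha * k < slope x b by move: hb; rewrite mulrBr mulr1 mulrC opprB addrC subrK.
have sb := slope_gt0 x b0.
pose eps := 1 - p / alpha * k / slope x b.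
have eps0 : 0 < eps by rewrite subr_gt0 ltr_pdivrMr// mul1r.
(* With a = b T, b^p is eps / 2 times a^p, negligible in the tangent bound of F at b. *)
pose T := (eps / 2) `^ (- p^-1).
have T0 : 0 < T by rewrite powR_gt0// divr_gt0.
have Tp : T `^ p = (eps / 2)^-1.
  rewrite /T -powRrM mulNr mulVf ?gt_eqF ?pge0// powRN powRr1// divr_ge0//.
  exact: ltW.
pose a := b * T.
have a0 : 0 < a by rewrite mulr_gt0.
have apE : a `^ p = b `^ p * (eps / 2)^-1 by rewrite /a powRM ?(ltW b0) ?(ltW T0)// Tp.
have h1 := Fpos_pconvex x a0 b0.
have [_ h2] := ambrosetti_rabinowitz x a0; rewrite slope_mul// in h2.
have h3 : alpha * (slope x b * (a `^ p - b `^ p) / p) <= k * a `^ p.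
  apply: (@le_trans _ _ (alpha * Fpos x a)).
    rewrite ler_pM2l ?alpha_gt0//; apply: le_trans h1; rewrite lerDr; exact: Fpos_ge0.
  by apply: (le_trans h2); rewrite ler_wpM2r ?powR_ge0// sk.
have bE : b `^ p = a `^ p * (eps / 2) by rewrite apE mulfVK// gt_eqF// divr_gt0.
have app : 0 < a `^ p by rewrite powR_gt0.
have h4 : alpha * (slope x b * (1 - eps / 2) / p) <= k.
  rewrite -(ler_pM2r app); apply: le_trans h3; rewrite bE.
  by rewrite le_eqVlt; apply/orP; left; apply/eqP; ring.
have h5 : slope x b * (1 - eps / 2) <= p / alpha * k.
  move: h4; rewrite mulrA ler_pdivrMr ?pge0// mulrC -ler_pdivlMr ?alpha_gt0// => h.
  by have -> : p / alpha * k = k * p / alpha by rewrite mulrC mulrA.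
have h6 : slope x b * (1 - eps) = p / alpha * k.
  by rewrite /eps; move: (p / alpha * k) => q; field; rewrite gt_eqF.
rewrite -h6 ler_pM2l// in h5.
by move: h5 eps0; lra.
Qed.

End Nonlinearity.

(** * Fractional gradients of bounded functions *)

Section Bounded.
Context {R : realType} {V : countType}.
Implicit Types u v : V -> R.

Definition fbounded u := exists M, forall x, `|u x| <= M.

Lemma fboundedD u v : fbounded u -> fbounded v -> fbounded (fun x => u x + v x).
Proof.
move=> [M uM] [N vN]; exists (M + N) => x.
by apply: le_trans (ler_normD _ _) _; rewrite lerD.
Qed.

Lemma fboundedZ c u : fbounded u -> fbounded (fun x => c * u x).
Proof. by move=> [M uM]; exists (`|c| * M) => x; rewrite normrM ler_wpM2l. Qed.

Lemma vsum_setC1 z (g : V -> R) : g z = 0 -> vsum [set~ z] g = tsum g.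
Proof.
move=> gz; rewrite /tsum /vsum esum_mkcond [in X in (_ - X)%E]esum_mkcond.
congr (fine (_ - _)%E); apply: eq_esum => x _; case: ifPn => // /negP xz;
  have -> : x = z by (apply: contrapT => xz'; apply: xz; rewrite inE).
- by rewrite funeposE /= gz maxxx.
- by rewrite funenegE /= gz oppr0 maxxx.
Qed.
End Bounded.

(* Unification would otherwise unfold the weights down to integrals. *)
#[local] Opaque Ws.

Section Energy.
Context {R : realType} {V : countType} (G : weighted_graph R V) (s p : R) (h : V -> R).
Hypothesis Wge0 : forall x y, 0 <= Ws G s x y.
Hypothesis Wsumm : forall x, summ (Ws G s x).
Hypothesis p2 : 2 <= p.
Hypothesis h0 : forall x, 0 < h x.
Variables (m0 hm : R).
Hypothesis m0_gt0 : 0 < m0.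
Hypothesis m_ge : forall x, m0 <= mu G x.
Hypothesis hm_gt0 : 0 < hm.
Hypothesis h_ge : forall x, hm <= h x.
Hypothesis Wsym : forall x y, Ws G s x y = Ws G s y x.
Implicit Types (u v w : V -> R) (x y z : V).

Notation W := (Ws G s).
Notation m := (mu G).
Notation Gm := (frac_grad_prod G s).
Notation N := (frac_grad_norm G s).

(** Summable in [y] for bounded [u] and [v], because the weights are summable; the
    gradient product is then bilinear. *)
Definition gterm u v x y := W x y * (u x - u y) * (v x - v y).

Lemma frac_grad_prodE u v x : Gm u v x = (2 * m x)^-1 * tsum (gterm u v x).
Proof. by rewrite /frac_grad_prod vsum_setC1// subrr mulr0 mul0r. Qed.

#[local] Opaque frac_grad_prod.

Lemma gterm_le u v x y (K L : R) : (forall x, `|u x| <= K) -> (forall x, `|v x| <= L) ->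
  `|gterm u v x y| <= (4 * K * L) * W x y.
Proof.
move=> uK vL; rewrite /gterm (normrM (_ * (u x - u y))) (normrM (W x y)) (ger0_norm (Wge0 x y))
  -(mulrA (W x y)) (mulrC (W x y)) ler_wpM2r//.
have -> : 4 * K * L = (K + K) * (L + L) by ring.
by apply: ler_pM => //; apply: le_trans (ler_normB _ _) _; rewrite lerD.
Qed.

Lemma gterm_summ u v x : fbounded u -> fbounded v -> summ (gterm u v x).
Proof.
move=> [K uK] [L vL]; apply: (summ_le (k := fun y => (4 * K * L) * W x y)).
  exact: summZ.
by move=> y; apply: gterm_le.
Qed.

Lemma gradC u v x : Gm u v x = Gm v u x.
Proof. by rewrite !frac_grad_prodE; congr (_ * _); congr tsum; apply/funext => y;
  rewrite /gterm mulrAC. Qed.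

Lemma gradDl u v w x : fbounded u -> fbounded v -> fbounded w ->
  Gm (fun y => u y + v y) w x = Gm u w x + Gm v w x.
Proof.
move=> bu bv bw; rewrite !frac_grad_prodE -mulrDr -tsumD; [|exact: gterm_summ|exact: gterm_summ].
by congr (_ * _); congr tsum; apply/funext => y; rewrite /gterm; ring.
Qed.

Lemma gradZl c u w x : fbounded u -> fbounded w ->
  Gm (fun y => c * u y) w x = c * Gm u w x.
Proof.
move=> bu bw; rewrite !frac_grad_prodE [RHS]mulrCA -[c * _]tsumZ; last by apply: gterm_summ.
by congr (_ * _); congr tsum; apply/funext => y; rewrite /gterm; ring.
Qed.

Lemma gradDr u v w x : fbounded u -> fbounded v -> fbounded w ->
  Gm w (fun y => u y + v y) x = Gm w u x + Gm w v x.
Proof. by move=> *; rewrite gradC gradDl// !(gradC w). Qed.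

Lemma gradZr c u w x : fbounded u -> fbounded w ->
  Gm w (fun y => c * u y) x = c * Gm w u x.
Proof. by move=> *; rewrite gradC gradZl// !(gradC w). Qed.

Lemma gterm_ge0 u x y : 0 <= gterm u u x y.
Proof. by rewrite /gterm -mulrA -expr2; exact: (mulr_ge0 (Wge0 x y) (sqr_ge0 _)). Qed.

Lemma grad_ge0 u x : 0 <= Gm u u x.
Proof.
rewrite frac_grad_prodE mulr_ge0//; first by rewrite invr_ge0 mulr_ge0// ltW// mu_gt0.
by apply: tsum_ge0 => y; exact: gterm_ge0.
Qed.

Lemma grad_norm_ge0 u x : 0 <= N u x.
Proof. exact: sqrtr_ge0. Qed.

Lemma grad_norm_sqr u x : N u x ^+ 2 = Gm u u x.
Proof. by rewrite /frac_grad_norm sqr_sqrtr// grad_ge0. Qed.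

(** The quadratic polynomial [t |-> |grad (u + t v)|^2] is nonnegative. *)
Lemma grad_CS_sqr u v x : fbounded u -> fbounded v ->
  Gm u v x ^+ 2 <= Gm u u x * Gm v v x.
Proof.
move=> bu bv.
have Q t : 0 <= Gm u u x + 2 * t * Gm u v x + t ^+ 2 * Gm v v x.
  have btv := fboundedZ t bv.
  have := grad_ge0 (fun y => u y + t * v y) x.
  rewrite gradDl ?gradDr ?gradZl ?gradZr//; try exact: fboundedD.
  by rewrite (gradC v u); congr (_ <= _); ring.
have [v0|v0] := eqVneq (Gm v v x) 0.
  rewrite v0 mulr0.
  have [->|c0] := eqVneq (Gm u v x) 0; first by rewrite expr0n.
  have := Q (- (Gm u u x + 1) / (2 * Gm u v x)).
  rewrite v0 mulr0 addr0.
  rewrite (_ : _ + _ = - 1); first by rewrite oppr_ge0 ler10.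
  by field.
have vp : 0 < Gm v v x by rewrite lt_neqAle eq_sym v0 grad_ge0.
have := Q (- Gm u v x / Gm v v x).
rewrite (_ : _ + _ + _ = Gm u u x - Gm u v x ^+ 2 / Gm v v x); last by field.
by rewrite subr_ge0 ler_pdivrMr.
Qed.

Lemma grad_CS u v x : fbounded u -> fbounded v -> `|Gm u v x| <= N u x * N v x.
Proof.
move=> bu bv; rewrite -(@ler_pXn2r _ 2)// ?nnegrE ?mulr_ge0 ?grad_norm_ge0//.
by rewrite exprMn !grad_norm_sqr real_normK ?num_real//; exact: grad_CS_sqr.
Qed.

Lemma grad_cvg {T : Type} (F : set_system T) {FF : ProperFilter F}
    (u_ v_ : T -> V -> R) u v (K L : R) x :
  (\forall i \near F, forall x, `|u_ i x| <= K) ->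
  (\forall i \near F, forall x, `|v_ i x| <= L) ->
  (forall x, (fun i => u_ i x) @ F --> u x) ->
  (forall x, (fun i => v_ i x) @ F --> v x) ->
  (fun i => Gm (u_ i) (v_ i) x) @ F --> Gm u v x.
Proof.
move=> uK vL uF vF; rewrite frac_grad_prodE.
under eq_fun do rewrite frac_grad_prodE.
apply: cvgMr.
apply: (proj2 (@dominated_tsum _ _ _ F _ (fun i => gterm (u_ i) (v_ i) x) (gterm u v x)
  (fun y => (4 * K * L) * W x y) (summZ _ (Wsumm x)) _ _)).
  near=> i => y; apply: gterm_le; by near: i.
move=> y; apply: cvgM; last by apply: cvgB.
by apply: cvgMr; apply: cvgB.
Unshelve. all: by end_near. Qed.

Lemma grad_norm_cvg {T : Type} (F : set_system T) {FF : ProperFilter F}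
    (u_ : T -> V -> R) u (K : R) x :
  (\forall i \near F, forall x, `|u_ i x| <= K) ->
  (forall x, (fun i => u_ i x) @ F --> u x) ->
  (fun i => N (u_ i) x) @ F --> N u x.
Proof.
move=> uK uF; apply: (continuous_cvg _ (f := fun i => Gm (u_ i) (u_ i) x) (a := Gm u u x)).
  exact: sqrt_continuous.
exact: (@grad_cvg _ F _ _ _ _ _ K K).
Qed.

Lemma grad_norm_Z c u x : fbounded u -> N (fun y => c * u y) x = `|c| * N u x.
Proof.
move=> bu; rewrite /frac_grad_norm gradZl ?gradZr//; last exact: fboundedZ.
by rewrite mulrA -expr2 sqrtrM ?sqr_ge0// sqrtr_sqr.
Qed.

#[local] Opaque frac_grad_norm.

(** * The energy *)

Definition edens u x := (N u x `^ p + h x * `|u x| `^ p) * m x.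

(** The density of [1 / p] times the derivative of the energy at [u] in the direction
    [v]. *)
Definition dedens u v x :=
  (N u x `^ (p - 2) * Gm u v x + h x * `|u x| `^ (p - 2) * u x * v x) * m x.

Lemma edens_ge0 u x : 0 <= edens u x.
Proof.
by rewrite mulr_ge0 ?(ltW (mu_gt0 G x))// addr_ge0 ?powR_ge0// mulr_ge0 ?powR_ge0// ltW.
Qed.

Lemma edensZ c u x : fbounded u -> edens (fun y => c * u y) x = `|c| `^ p * edens u x.
Proof.
move=> bu; rewrite /edens grad_norm_Z// normrM !powRM ?grad_norm_ge0 ?normr_ge0//; ring.
Qed.

Lemma clarkson_aux (k a b c d a' b' c' d' : R) : 0 <= k ->
  a + b <= (c + d) / 2 -> a' + b' <= (c' + d') / 2 ->
  a + k * a' + (b + k * b') <= (c + k * c' + (d + k * d')) / 2.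
Proof. by move=> k0 h1 /(ler_wpM2l k0); lra. Qed.

Lemma tangent_aux (k q a b n g c a' b' x y c' : R) : 0 <= k ->
  a + q * (b * (n + g - n)) <= c -> a' + q * (b' * (x * (x + y) - x ^+ 2)) <= c' ->
  a + k * a' + q * (b * g + k * b' * x * y) <= c + k * c'.
Proof.
move=> k0 h1 /(ler_wpM2l k0) h2; apply: le_trans (lerD h1 h2).
by rewrite le_eqVlt; apply/orP; left; apply/eqP; ring.
Qed.

Lemma dedens_aux (k L M a b g c a' b' x y c' : R) : 0 <= k ->
  g <= b -> b <= L * a + M * c -> b' * x * y <= L * a' + M * c' ->
  g + k * b' * x * y <= L * (a + k * a') + M * (c + k * c').
Proof.
move=> k0 h0' h1 /(ler_wpM2l k0) h2; have := lerD (le_trans h0' h1) h2;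
  rewrite (_ : L * a + _ + _ = L * (a + k * a') + M * (c + k * c')); last by ring.
by apply: le_trans; rewrite le_eqVlt; apply/orP; left; apply/eqP; ring.
Qed.

(** The gradient product is a positive semidefinite form, so the parallelogram identity
    holds for [|grad u|] and [clarkson_powR] applies to it as it does to [|u|]. *)
Lemma edens_clarkson u v x : fbounded u -> fbounded v ->
  edens (fun y => (u y + v y) / 2) x + edens (fun y => (u y - v y) / 2) x
  <= (edens u x + edens v x) / 2.
Proof.
move=> bu bv; rewrite /edens -!mulrDl -[leRHS]mulrAC ler_wpM2r//; first by rewrite ltW// mu_gt0.
have mx := mu_gt0 G x.
have E1 : N (fun y => (u y + v y) / 2) x `^ p + N (fun y => (u y - v y) / 2) x `^ p <=
   (N u x `^ p + N v x `^ p) / 2.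
  apply: clarkson_powR; rewrite ?grad_norm_ge0//.
  rewrite !grad_norm_sqr.
  have -> : (fun y => (u y + v y) / 2) = (fun y => 2^-1 * (u y + v y)).
    by apply/funext => y; rewrite mulrC.
  have -> : (fun y => (u y - v y) / 2) = (fun y => 2^-1 * (u y + (-1) * v y)).
    by apply/funext => y; rewrite mulrC mulN1r.
  have bv' := fboundedZ (-1) bv.
  have b1 := fboundedD bu bv.
  have b2 := fboundedD bu bv'.
  have b1' := fboundedZ 2^-1 b1.
  have b2' := fboundedZ 2^-1 b2.
  rewrite !gradZl// !gradZr// !gradDl// !gradDr// !gradZl// !gradZr// (gradC v u).
  by field.
have E2 : `|(u x + v x) / 2| `^ p + `|(u x - v x) / 2| `^ p <= (`|u x| `^ p + `|v x| `^ p) / 2.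
  apply: clarkson_powR; rewrite ?normr_ge0//.
  by rewrite !real_normK ?num_real//; field.
exact: clarkson_aux (ltW (h0 x)) E1 E2.
Qed.

Lemma edensD u v x : fbounded u -> fbounded v ->
  edens (fun y => u y + v y) x <= 2 `^ p * (edens u x + edens v x).
Proof.
move=> bu bv.
have := edens_clarkson x bu bv.
have := edens_ge0 (fun y => (u y - v y) / 2) x.
have := edens_ge0 u x; have := edens_ge0 v x.
have -> : (fun y => u y + v y) = (fun y => 2 * ((u y + v y) / 2)).
  by apply/funext => y; field.
rewrite edensZ; last first.
  have -> : (fun y => (u y + v y) / 2) = (fun y => 2^-1 * (u y + v y)).
    by apply/funext => y; rewrite mulrC.
  exact/fboundedZ/fboundedD.
rewrite ger0_norm// => a b c d.
rewrite ler_wpM2l ?powR_ge0//; move: a b c d.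
do 4!move: (edens _ _) => ?; lra.
Qed.

(** Both summands of the energy density are convex in [u], by [powR_tangent]. *)
Lemma edens_tangent u w x : fbounded u -> fbounded w ->
  edens u x + p * dedens u w x <= edens (fun y => u y + w y) x.
Proof.
move=> bu bw; rewrite /edens /dedens.
have buw := fboundedD bu bw.
have mx := mu_gt0 G x.
have E1 : N u x `^ p + p * (N u x `^ (p - 2) * (Gm u (fun y => u y + w y) x - N u x ^+ 2))
    <= N (fun y => u y + w y) x `^ p.
  by apply: powR_tangent; rewrite ?grad_norm_ge0//; apply: le_trans (grad_CS x bu buw);
    exact: ler_norm.
have E2 : `|u x| `^ p + p * (`|u x| `^ (p - 2) * (u x * (u x + w x) - `|u x| ^+ 2))
    <= `|u x + w x| `^ p.
  by apply: powR_tangent; rewrite ?normr_ge0// -normrM ler_norm.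
rewrite gradDr// grad_norm_sqr in E1.
rewrite real_normK ?num_real// in E2.
rewrite mulrA -mulrDl ler_wpM2r ?(ltW mx)//.
exact: tangent_aux (ltW (h0 x)) E1 E2.
Qed.

(** With [L = 1] this gives summability; with small [L] it makes the derivative small in
    directions of small energy. *)
Lemma dedens_le u w x (L : R) : fbounded u -> fbounded w -> 0 < L ->
  `|dedens u w x| <= L * edens u x + L `^ (1 - p) * edens w x.
Proof.
move=> bu bw L0; rewrite /edens /dedens (normrM (_ + _)) (gtr0_norm (mu_gt0 G x)) (mulrA L)
  (mulrA (L `^ _)) -mulrDl.
have mx := mu_gt0 G x.
rewrite ler_wpM2r ?(ltW mx)//.
have p1 : 1 < p by apply: lt_le_trans p2; rewrite ltr1n.
apply: le_trans (ler_normD _ _) _.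
rewrite (normrM (N u x `^ _)) (normrM (h x * _ * _)) (normrM (h x * _)) (normrM (h x)).
rewrite !(ger0_norm (powR_ge0 _ _)) (gtr0_norm (h0 x)).
have E1 := powR_split_young p1 L0 (grad_norm_ge0 u x) (grad_norm_ge0 w x).
have E2 := powR_split_young p1 L0 (normr_ge0 (u x)) (normr_ge0 (w x)).
have E3 : N u x `^ (p - 2) * `|Gm u w x| <= N u x `^ (p - 1) * N w x.
  by rewrite -powR_m2 ?grad_norm_ge0// -mulrA ler_wpM2l ?powR_ge0//; exact: grad_CS.
rewrite -(powR_m2 (normr_ge0 (u x)) p2) in E2.
exact: dedens_aux (ltW (h0 x)) E3 E1 E2.
Qed.

Lemma edens_cvg {T : Type} (F : set_system T) {FF : ProperFilter F}
    (u_ : T -> V -> R) u (K : R) x :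
  (\forall i \near F, forall x, `|u_ i x| <= K) ->
  (forall x, (fun i => u_ i x) @ F --> u x) ->
  (fun i => edens (u_ i) x) @ F --> edens u x.
Proof.
move=> uK uF; have p0 : 0 <= p by apply: le_trans p2.
apply: cvgMl; apply: cvgD.
  apply: cvg_powR => //;
    [exact: nearW (fun i =>
    grad_norm_ge0 _ _)|exact: grad_norm_ge0|exact: (@grad_norm_cvg _ F _ _ _ K)].
apply: cvgMr; apply: cvg_powR => //; first exact: nearW (fun i => normr_ge0 _).
exact: cvg_norm.
Qed.

Lemma dedens_cvg {T : Type} (F : set_system T) {FF : ProperFilter F}
    (u_ : T -> V -> R) u w (K : R) x : fbounded w ->
  (\forall i \near F, forall x, `|u_ i x| <= K) ->
  (forall x, (fun i => u_ i x) @ F --> u x) ->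
  (fun i => dedens (u_ i) w x) @ F --> dedens u w x.
Proof.
move=> [L wL] uK uF; have p0 : 0 <= p - 2 by rewrite subr_ge0.
apply: cvgMl; apply: cvgD.
  apply: cvgM.
    by apply: cvg_powR => //;
      [exact: nearW (fun i =>
      grad_norm_ge0 _ _)|exact: grad_norm_ge0|exact: (@grad_norm_cvg _ F _ _ _ K)].
  by apply: (@grad_cvg _ F _ _ _ _ _ K L) => //; [exact: nearW|move=> y; exact: cvg_cst].
apply: cvgMl; apply: cvgM => //; apply: cvgMr.
apply: cvg_powR => //; first exact: nearW (fun i => normr_ge0 _).
exact: cvg_norm.
Qed.

Definition fin_energy u := summ (edens u).
Definition energy u := tsum (edens u).

Lemma p_gt0 : 0 < p.
Proof. by apply: lt_le_trans p2. Qed.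

Lemma energy_ge0 u : 0 <= energy u.
Proof. by apply: tsum_ge0 => x; exact: edens_ge0. Qed.

(** [h] and [mu] are bounded below by [hm] and [m0], so that the energy controls the sup
    norm. Elements of finite energy are therefore bounded and the bilinear calculus
    applies to them. *)
Lemma powR_le_energy u x : fin_energy u -> `|u x| `^ p <= (hm * m0)^-1 * energy u.
Proof.
move=> fu; rewrite ler_pdivlMl ?mulr_gt0//.
apply: le_trans (le_tsum1 x (edens_ge0 u) fu).
rewrite /edens mulrAC ler_pM ?mulr_ge0 ?powR_ge0 ?(ltW hm_gt0) ?(ltW m0_gt0)//.
apply: (@le_trans _ _ (h x * `|u x| `^ p)); last by rewrite lerDr powR_ge0.
by rewrite ler_wpM2r ?powR_ge0.
Qed.

Definition supb (e : R) : R := ((hm * m0)^-1 * e) `^ p^-1.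

Lemma norm_le_energy u x e : fin_energy u -> energy u <= e -> `|u x| <= supb e.
Proof.
move=> fu ue.
have -> : `|u x| = (`|u x| `^ p) `^ p^-1.
  by rewrite -powRrM mulfV ?(gt_eqF p_gt0)// powRr1.
apply: le_powR; [by rewrite invr_ge0 (ltW p_gt0)|exact: powR_ge0|].
apply: le_trans (powR_le_energy x fu) _.
by rewrite ler_wpM2l// invr_ge0 mulr_ge0 ?ltW.
Qed.

Lemma fin_bounded u : fin_energy u -> fbounded u.
Proof. by move=> fu; exists (supb (energy u)) => x; exact: norm_le_energy. Qed.

Lemma p_energyE u : fin_energy u -> p_energy G s p h u = (energy u)%:E.
Proof.
move=> fu; rewrite /p_energy /vint_ge0; have [M uM] := fu.
apply: (esum_fin (edens_ge0 u) (M := M)) => A.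
by apply: le_trans (uM A); apply: le_psum => x; exact: ler_norm.
Qed.

Lemma fin_energyZ c u : fin_energy u -> fin_energy (fun x => c * u x) /\ energy (fun x =>
  c * u x) = `|c| `^ p * energy u.
Proof.
move=> fu; have bu := fin_bounded fu.
rewrite /fin_energy /energy (_ : edens _ = fun x => `|c| `^ p * edens u x).
  by rewrite tsumZ//; split => //; exact: summZ.
by apply/funext => x; exact: edensZ.
Qed.

Lemma fin_energyD u v : fin_energy u -> fin_energy v ->
  fin_energy (fun x => u x + v x) /\ energy (fun x => u x + v x) <= 2 `^ p * (energy u + energy v).
Proof.
move=> fu fv; have bu := fin_bounded fu; have bv := fin_bounded fv.
have fs : summ (fun x => 2 `^ p * (edens u x + edens v x)) by apply/summZ/summD.
have fw : fin_energy (fun x => u x + v x).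
  apply: (summ_le fs) => x; rewrite ger0_norm ?edens_ge0//; exact: edensD.
split => //; rewrite /energy -tsumD// -tsumZ; last exact: summD.
by apply: le_tsum => // x; exact: edensD.
Qed.

Lemma fin_energyB u v : fin_energy u -> fin_energy v ->
  fin_energy (fun x => u x - v x) /\ energy (fun x => u x - v x) <= 2 `^ p * (energy u + energy v).
Proof.
move=> fu fv; have [fv' Ev'] := fin_energyZ (-1) fv.
have := fin_energyD fu fv'; rewrite Ev' normrN normr1 powR1 mul1r.
by under eq_fun do rewrite mulN1r.
Qed.

Lemma energyC u v : fin_energy u -> fin_energy v -> energy (fun x =>
  u x - v x) = energy (fun x => v x - u x).
Proof.
move=> fu fv; have [_] := fin_energyZ (-1) (fin_energyB fv fu).1.
rewrite normrN normr1 powR1 mul1r => <-.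
by congr energy; apply/funext => x; rewrite mulN1r opprB.
Qed.

Lemma energy_half u : fin_energy u -> fin_energy (fun x => u x / 2) /\ energy (fun x =>
  u x / 2) = (2 `^ p)^-1 * energy u.
Proof.
move=> fu; have := fin_energyZ 2^-1 fu; rewrite ger0_norm ?invr_ge0//.
rewrite (_ : 2^-1 `^ p = (2 `^ p)^-1).
  by under eq_fun do rewrite mulrC.
by rewrite -powR_inv1// powRAC powR_inv1// powR_ge0.
Qed.

Lemma energy_clarkson u v : fin_energy u -> fin_energy v ->
  energy (fun x => (u x + v x) / 2) + energy (fun x =>
    (u x - v x) / 2) <= (energy u + energy v) / 2.
Proof.
move=> fu fv.
have [f1 _] := energy_half (fin_energyD fu fv).1.
have [f2 _] := energy_half (fin_energyB fu fv).1.
have bu := fin_bounded fu; have bv := fin_bounded fv.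
rewrite /energy -(tsumD f1 f2) -(tsumD fu fv) mulrC -(tsumZ _ (summD fu fv)).
apply: le_tsum; [exact: summD|by apply/summZ/summD|move=> x].
by rewrite mulrC; exact: edens_clarkson.
Qed.

(** The energy bound gives a uniform sup bound, under which the densities converge
    pointwise. *)
Lemma energy_fatou {T : Type} (F : set_system T) {FF : ProperFilter F}
    (u_ : T -> V -> R) u (C : R) :
  (\forall i \near F, fin_energy (u_ i) /\ energy (u_ i) <= C) ->
  (forall x, (fun i => u_ i x) @ F --> u x) -> fin_energy u /\ energy u <= C.
Proof.
move=> uC uF.
have uK : \forall i \near F, forall x, `|u_ i x| <= supb C.
  by apply: filterS uC => i [fi Ei] x; exact: norm_le_energy.
have [|x|_ fu Eu] := @fatou_tsum _ _ _ F _ (fun i => edens (u_ i)) (edens u) C; last by split.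
  by apply: filterS uC => i [fi Ei]; split => // x; exact: edens_ge0.
exact: (@edens_cvg _ F _ _ _ (supb C)).
Qed.

(** * Finitely supported functions and their completion *)

Definition delta z : V -> R := fun x => (x == z)%:R.

Lemma delta_bounded z : fbounded (delta z).
Proof. by exists 1 => x; rewrite /delta; case: (x == z); rewrite ?normr1 ?normr0. Qed.

Lemma grad_delta_off z x : x != z -> Gm (delta z) (delta z) x = (2 * m x)^-1 * W x z.
Proof.
move=> xz; rewrite frac_grad_prodE; congr (_ * _).
have [|_ ->] := @tsum1 _ _ (gterm (delta z) (delta z) x) z.
  by move=> y yz; rewrite /gterm /delta (negbTE xz) (negbTE yz) subrr !mulr0.
by rewrite /gterm /delta (negbTE xz) eqxx sub0r -mulrA mulrNN !mulr1.
Qed.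

(** Away from [z], [|grad delta_z|^2] at [x] is [W x z / (2 mu x)]. It is bounded by a
    constant [K], and [p / 2 >= 1], so its power [p / 2] is at most a constant times [W
    x z / mu x], which is summable against [mu]. *)
Lemma delta_fin z : fin_energy (delta z).
Proof.
pose D := tsum (W z).
have WD x : W x z <= D by rewrite Wsym; exact: le_tsum1 (Wge0 z) (Wsumm z).
have D0 : 0 <= D by apply: tsum_ge0.
pose K := (2 * m0)^-1 * D.
have K0 : 0 <= K by rewrite mulr_ge0// invr_ge0 mulr_ge0// ltW.
have off x : x != z -> edens (delta z) x <= K `^ (p / 2 - 1) * (2^-1 * W z x).
  move=> xz; rewrite /edens /delta (negbTE xz) normr0 powR0 ?(gt_eqF p_gt0)// mulr0 addr0.
  have mx := mu_gt0 G x.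
  rewrite (powR_sqr _ (grad_norm_ge0 _ _)) grad_norm_sqr// grad_delta_off//.
  set g := _^-1 * _.
  have g0 : 0 <= g by rewrite mulr_ge0// invr_ge0 mulr_ge0// ltW.
  have gK : g <= K.
    have i0 : 0 <= (2 * m x)^-1 by rewrite invr_ge0 mulr_ge0// ltW.
    apply: (ler_pM i0 (Wge0 x z) _ (WD x)).
    by rewrite lef_pV2 ?posrE ?mulr_gt0// ler_pM2l.
  have -> : g `^ (p / 2) = g `^ (p / 2 - 1) * g.
    have [->|p2'] := eqVneq p 2; last first.
      rewrite powRS1//; rewrite ltr_pdivlMr// mul1r lt_neqAle eq_sym p2'.
      exact: p2.
    by rewrite divff// subrr powRr0 mul1r powRr1.
  have -> : g `^ (p / 2 - 1) * g * m x = g `^ (p / 2 - 1) * (2^-1 * W z x).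
    by rewrite -mulrA /g Wsym; congr (_ * _); move: (W z x) (mx) => w /lt0r_neq0 mx0; field.
  apply: ler_wpM2r; first exact: mulr_ge0.
  by apply: le_powR => //; rewrite subr_ge0 ler_pdivlMr// mul1r.
have [s1 _] := @tsum1 _ _ (fun x => if x == z then edens (delta z) z else 0) z (fun x =>
  @ifN_eq _ _ _ _ _ _).
have s2 : summ (fun x => K `^ (p / 2 - 1) * (2^-1 * W z x)) by do 2!apply: summZ.
apply: (summ_le (summD s1 s2)) => x; rewrite ger0_norm ?edens_ge0//.
have [->|xz] := eqVneq x z; first by rewrite lerDl mulr_ge0 ?powR_ge0// mulr_ge0.
by rewrite add0r off.
Qed.

Lemma edens0 x : edens (fun=> 0) x = 0.
Proof.
have b0 : fbounded (fun _ : V => 0 : R) by exists 0 => y; rewrite normr0.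
have := edensZ 0 x b0; rewrite normr0 powR0 ?(gt_eqF p_gt0)// mul0r.
by rewrite mul0r.
Qed.

Lemma fin0 : fin_energy (fun=> 0) /\ energy (fun=> 0) = 0.
Proof.
have := @summ_finsupp _ _ (edens (fun=> 0)) fset0 (fun x _ => edens0 x).
by rewrite /psum big_seq_fset0.
Qed.

Lemma finsum_fin (c : V -> R) (r : seq V) : fin_energy (fun x => \sum_(z <- r) c z * delta z x).
Proof.
elim: r => [|z r IH].
  under eq_fun do rewrite big_nil.
  exact: fin0.1.
under eq_fun do rewrite big_cons.
by apply: (fin_energyD _ IH).1; apply: (fin_energyZ _ _).1; exact: delta_fin.
Qed.

Lemma Cc_sum v : Cc v -> v = fun x => \sum_(z <- fset_set [set x | v x != 0]) v z * delta z x.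
Proof.
move=> cv; apply/funext => x.
have [vx|vx] := eqVneq (v x) 0.
  rewrite vx big1// => z _; rewrite /delta; case: eqP => [<-|]; rewrite ?vx ?mul0r ?mulr0//.
rewrite (big_fsetD1 x) /=; last by rewrite in_fset_set// inE.
rewrite /delta eqxx mulr1 big_seq big1 ?addr0// => z.
by rewrite !inE => /andP[zx _]; rewrite eq_sym (negbTE zx) mulr0.
Qed.

Lemma Cc_fin v : Cc v -> fin_energy v.
Proof. by move=> /Cc_sum ->; exact: finsum_fin. Qed.

Lemma Hsp_norm_lt u e : fin_energy u -> 0 < e ->
  (Hsp_norm G s p h u < e%:E)%E <-> energy u < e `^ p.
Proof.
move=> fu e0; rewrite /Hsp_norm p_energyE// poweR_EFin lte_fin.
have E0 := energy_ge0 u.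
have eE : (e `^ p) `^ p^-1 = e by rewrite -powRrM mulfV ?(gt_eqF p_gt0)// powRr1// ltW.
have EE : (energy u `^ p^-1) `^ p = energy u by rewrite -powRrM mulVf ?(gt_eqF p_gt0)// powRr1.
split => [ue|ue].
  by rewrite -EE gt0_ltr_powR ?p_gt0 ?nnegrE ?powR_ge0// ltW.
by rewrite -eE gt0_ltr_powR ?nnegrE ?powR_ge0// invr_gt0 p_gt0.
Qed.

(** By Fatou's lemma the uniform limit [u] of a Cauchy sequence of finitely supported
    functions is also its limit in energy, and conversely the energy controls the sup
    norm. *)
Lemma HspP u : Hsp G s p h u <->
  fin_energy u /\ forall e, 0 < e -> exists2 v, Cc v & energy (fun x => u x - v x) < e.
Proof.
split => [[u_ [Cu cu uu]]|[fu ue]].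
  have key e : 0 < e -> exists2 v, Cc v &
      fin_energy (fun x => u x - v x) /\ energy (fun x => u x - v x) <= e.
    move=> e0; have e1 : 0 < e `^ p^-1 by rewrite powR_gt0.
    have [n0 hn0] := cu _ e1.
    exists (u_ n0) => //.
    apply: (@energy_fatou _ \oo _ (fun n x => u_ n x - u_ n0 x)).
      exists n0 => // n /= n0n.
      have [f1 _] := fin_energyB (Cc_fin (Cu n)) (Cc_fin (Cu n0)).
      split => //; have := hn0 _ _ n0n (leqnn _).
      rewrite Hsp_norm_lt// -powRrM mulVf ?(gt_eqF p_gt0)// powRr1 ?(ltW e0)//.
      exact: ltW.
    move=> x; apply: cvgB; last exact: cvg_cst.
    apply/cvgrPdist_lt => d d0; have := uu _ d0.
    by apply: filterS => n; rewrite distrC.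
  split.
    have [v Cv [fuv _]] := key 1 ltr01.
    have := (fin_energyD fuv (Cc_fin Cv)).1.
    by under eq_fun do rewrite subrK.
  move=> e e0; have e2 : 0 < e / 2 by rewrite divr_gt0.
  have [v Cv [_ uv]] := key _ e2; exists v => //.
  by apply: (le_lt_trans uv); rewrite ltr_pdivrMr// ltr_pMr// ltr1n.
have /choice[v_ hv] : forall n : nat, exists v, Cc v /\ energy (fun x => u x - v x) < n.+1%:R^-1.
  by move=> n; have [|v Cv hv] := ue n.+1%:R^-1; [rewrite invr_gt0|exists v].
have fv n : fin_energy (v_ n) by apply: Cc_fin; exact: (hv n).1.
have small e : 0 < e -> exists n0 : nat, forall n, (n0 <= n)%N -> energy (fun x =>
  u x - v_ n x) < e.
  move=> e0; have [n0 hn0] : exists n0 : nat, n0.+1%:R^-1 < e.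
    exists (Num.trunc (e^-1)); rewrite -[ltRHS]invrK ltf_pV2 ?posrE ?invr_gt0//.
    by have := truncnS_gt e^-1.
  exists n0 => n n0n; apply: lt_trans (hv n).2 _; apply: le_lt_trans hn0.
  by rewrite lef_pV2 ?posrE// ler_nat.
exists v_; split.
- by move=> n; exact: (hv n).1.
- move=> e e0; have c0 : 0 < e `^ p / (2 `^ p * 2) by rewrite divr_gt0 ?powR_gt0// mulr_gt0
  ?powR_gt0.
  have [n0 hn0] := small _ c0; exists n0 => a b n0a n0b.
  have [f1 _] := fin_energyB (fv a) (fv b).
  apply/Hsp_norm_lt => //.
  have [fa _] := fin_energyB fu (fv a); have [fb _] := fin_energyB fu (fv b).
  have := (fin_energyB fb fa).2.
  have -> : (fun x => u x - v_ b x - (u x - v_ a x)) = (fun x => v_ a x - v_ b x).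
    by apply/funext => x; ring.
  move=> /le_lt_trans; apply.
  have := hn0 _ n0a; have := hn0 _ n0b.
  move: (energy _) (energy _) => A B Ac Bc.
  rewrite -ltr_pdivlMl ?powR_gt0//.
  rewrite (_ : _^-1 * _ = e `^ p / (2 `^ p * 2) + e `^ p / (2 `^ p * 2)); last first.
    have : 2 `^ p != 0 :> R by rewrite gt_eqF// powR_gt0.
    by move: (2 `^ p) (e `^ p) => P Q P0; field.
  exact: ltrD.
- move=> e e0.
  have c0 : 0 < (hm * m0) * e `^ p by rewrite mulr_gt0 ?powR_gt0// mulr_gt0.
  have [n0 hn0] := small _ c0; exists n0 => // n /= n0n x.
  have [fb _] := fin_energyB fu (fv n).
  rewrite distrC -(@ltr_pXn2r _ 1)// ?nnegrE ?normr_ge0 ?(ltW e0)// !expr1.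
  have h1 := powR_le_energy x fb.
  have h2 : `|u x - v_ n x| `^ p < e `^ p.
    by apply: (le_lt_trans h1); rewrite ltr_pdivrMl ?mulr_gt0//; exact: hn0.
  rewrite ltNge; apply/negP => /(le_powR (ltW p_gt0) (ltW e0)).
  by rewrite leNgt h2.
Qed.

Lemma Hsp_fin u : Hsp G s p h u -> fin_energy u.
Proof. by move=> /HspP[]. Qed.

Lemma Cc_Hsp v : Cc v -> Hsp G s p h v.
Proof.
move=> Cv; apply/HspP; split => [|e e0]; first exact: Cc_fin.
by exists v => //; under eq_fun do rewrite subrr; rewrite fin0.2.
Qed.

Lemma CcD u v : Cc u -> Cc v -> Cc (fun x => u x + v x).
Proof.
move=> Cu Cv; apply: (@sub_finite_set _ _ ([set x | u x != 0] `|` [set x | v x != 0])).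
  move=> x /=; have [->|] := eqVneq (u x) 0; last by left.
  by rewrite add0r; right.
by rewrite finite_setU.
Qed.

Lemma CcZ c u : Cc u -> Cc (fun x => c * u x).
Proof.
by apply: sub_finite_set => x /=; apply: contra => /eqP ->; rewrite mulr0.
Qed.

Lemma delta_Cc z : Cc (delta z).
Proof.
apply: (@sub_finite_set _ _ [set z]); last exact: finite_set1.
by move=> x /=; rewrite /delta; case: (x =P z) => // _; rewrite eqxx.
Qed.

Lemma HspZ c u : Hsp G s p h u -> Hsp G s p h (fun x => c * u x).
Proof.
move=> /HspP[fu ue]; apply/HspP; split => [|e e0]; first exact: (fin_energyZ c fu).1.
have c0 : 0 < (`|c| `^ p + 1) by rewrite ltr_wpDl ?powR_ge0.
have [|v Cv uv] := ue (e / (`|c| `^ p + 1)); first by rewrite divr_gt0.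
exists (fun x => c * v x); first exact: CcZ.
under eq_fun do rewrite -mulrBr.
rewrite (fin_energyZ c (fin_energyB fu (Cc_fin Cv)).1).2.
move: uv; rewrite ltr_pdivlMr// mulrDr mulr1 mulrC => /le_lt_trans; apply.
by rewrite lerDl energy_ge0.
Qed.

Lemma HspD u v : Hsp G s p h u -> Hsp G s p h v -> Hsp G s p h (fun x => u x + v x).
Proof.
move=> /HspP[fu ue] /HspP[fv ve]; apply/HspP; split => [|e e0]; first exact: (fin_energyD fu fv).1.
have c0 : 0 < e / (2 `^ p * 2) by rewrite divr_gt0// mulr_gt0 ?powR_gt0.
have [u1 Cu1 h1] := ue _ c0; have [v1 Cv1 h2] := ve _ c0.
exists (fun x => u1 x + v1 x); first exact: CcD.
have := (fin_energyD (fin_energyB fu (Cc_fin Cu1)).1 (fin_energyB fv (Cc_fin Cv1)).1).2.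
have -> : (fun x => u x - u1 x + (v x - v1 x)) = (fun x => u x + v x - (u1 x + v1 x)).
  by apply/funext => x; ring.
move=> /le_lt_trans; apply.
rewrite -ltr_pdivlMl ?powR_gt0//; move: h1 h2.
move: (energy _) (energy _) => A B Ac Bc.
rewrite (_ : _^-1 * _ = e / (2 `^ p * 2) + e / (2 `^ p * 2)); last first.
  have : 2 `^ p != 0 :> R by rewrite gt_eqF// powR_gt0.
  by move: (2 `^ p) => P P0; field.
exact: ltrD.
Qed.

Lemma Hsp_approx u : fin_energy u ->
  (forall e, 0 < e -> exists2 v, Hsp G s p h v & energy (fun x => u x - v x) <= e) ->
  Hsp G s p h u.
Proof.
move=> fu ue; apply/HspP; split => // e e0.
have c0 : 0 < e / (2 `^ p * 3) by rewrite divr_gt0// mulr_gt0 ?powR_gt0.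
have [v Hv h1] := ue _ c0; have /HspP[fv /(_ _ c0)[w Cw h2]] := Hv.
exists w => //.
have := (fin_energyD (fin_energyB fu fv).1 (fin_energyB fv (Cc_fin Cw)).1).2.
have -> : (fun x => u x - v x + (v x - w x)) = (fun x => u x - w x).
  by apply/funext => x; ring.
move=> /le_lt_trans; apply.
rewrite -ltr_pdivlMl ?powR_gt0//; move: h1 h2.
move: (energy _) (energy _) => A B Ac Bc.
rewrite (_ : _^-1 * _ = e / (2 `^ p * 3) * 3); last first.
  have : 2 `^ p != 0 :> R by rewrite gt_eqF// powR_gt0.
  by move: (2 `^ p) => P P0; field.
move: c0 Ac Bc; move: (e / _) => d; lra.
Qed.

(** * Closedness of the space under pointwise limits *)

(** A filter is closed under finite intersections only, so the vertices are taken in the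
    order of their codes, finitely many at a time. *)
Lemma near_initial {T : Type} (F : set_system T) {FF : Filter F} (P : T -> V -> Prop) n :
  (forall x, \forall i \near F, P i x) ->
  \forall i \near F, forall x, (choice.pickle x < n)%N -> P i x.
Proof.
move=> FP; elim: n => [|n IH]; first exact: nearW.
have [[x0 x0n]|nx] := pselect (exists x0 : V, choice.pickle x0 = n); last first.
  apply: filterS IH => i Pi x; rewrite ltnS leq_eqVlt => /orP[/eqP xn|]; last exact: Pi.
  by exfalso; apply: nx; exists x.
apply: filterS2 IH (FP x0) => i Pi Px0 x; rewrite ltnS leq_eqVlt => /orP[/eqP xn|]; last exact: Pi.
by have -> : x = x0 by apply: (pcan_inj (@choice.pickleK V)); rewrite xn.
Qed.

Lemma midpoint_dist (a b c d : R) :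
  `|a - b| <= d -> `|a - c| <= d -> `|a - (b + c) / 2| <= d.
Proof. by rewrite !ler_norml => /andP[a1 a2] /andP[a3 a4]; apply/andP; split; lra. Qed.

(** Mazur's lemma by uniform convexity. Let [K n] be the convex set of the elements of
    the space of energy at most [C] that are close to [u] on the first [n] vertices, and
    [d n] the infimum of the energy on [K n]. These infima increase to a finite limit,
    so by Clarkson's inequality almost minimisers [v_n] of [K n] form a Cauchy sequence
    in energy. They converge pointwise to [u], hence in energy by Fatou's lemma. *)
Lemma Hsp_closed {T : Type} (F : set_system T) {FF : ProperFilter F}
    (u_ : T -> V -> R) u (C : R) :
  (\forall i \near F, Hsp G s p h (u_ i) /\ energy (u_ i) <= C) ->
  (forall x, (fun i => u_ i x) @ F --> u x) -> Hsp G s p h u /\ energy u <= C.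
Proof.
move=> uC uF.
have [fu Eu] : fin_energy u /\ energy u <= C.
  by apply: (@energy_fatou _ F _ u_) => //; apply: filterS uC => i [/Hsp_fin].
split => //.
pose K (n : nat) : set (V -> R) := [set v | [/\ Hsp G s p h v, energy v <= C &
  forall x, (choice.pickle x < n)%N -> `|u x - v x| <= n.+1%:R^-1]].
have Kne n : K n !=set0.
  have : \forall i \near F, K n (u_ i).
    have near_n : \forall i \near F, forall x,
      (choice.pickle x < n)%N -> `|u x - u_ i x| <= n.+1%:R^-1.
      by apply: near_initial => x; have /cvgrPdist_le := uF x; apply; rewrite invr_gt0.
    by apply: filterS2 uC near_n => i [Hi Ei] hi; split.
  by move=> /filter_ex[i Ki]; exists (u_ i).
have Kdec n k : (n <= k)%N -> K k `<=` K n.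
  move=> nk v [Hv Ev vk]; split => // x xn; apply: le_trans (vk x (leq_trans xn nk)) _.
  by rewrite lef_pV2 ?posrE// ler_nat ltnS.
have Kmid n v w : K n v -> K n w -> K n (fun x => (v x + w x) / 2).
  move=> [Hv Ev vn] [Hw Ew wn]; split.
  - by under eq_fun do rewrite mulrC; exact/HspZ/HspD.
  - have := energy_clarkson (Hsp_fin Hv) (Hsp_fin Hw).
    have := energy_ge0 (fun x => (v x - w x) / 2); move: Ev Ew.
    by move: (energy _) (energy _) (energy _) (energy _) => a b c d; lra.
  - move=> x xn; have := vn x xn; have := wn x xn.
    by move=> wx vx; exact: midpoint_dist.
pose d n := inf (energy @` K n).
have lb n : has_inf (energy @` K n).
  split; first by have [v Kv] := Kne n; exists (energy v); exists v.
  by exists 0 => _ [v _ <-]; exact: energy_ge0.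
have dE n v : K n v -> d n <= energy v.
  by move=> Kv; apply: ge_inf; [exact: (lb n).2|exists v].
have dC n : d n <= C by have [v Kv] := Kne n; apply: le_trans (dE _ _ Kv) _; case: Kv.
have hsd : has_sup (range d).
  by split; [exists (d 0%N); exists 0%N|exists C => _ [n _ <-]; exact: dC].
pose D := sup (range d).
have dD n : d n <= D by apply: ub_le_sup; [exact: hsd.2|exists n].
have /choice[v_ hv] n : exists v, K n v /\ energy v < d n + n.+1%:R^-1.
  have [|_ [v Kv <-] vd] := @inf_adherent _ (energy @` K n) n.+1%:R^-1 _ (lb n).
    by rewrite invr_gt0.
  by exists v.
have vHsp n : Hsp G s p h (v_ n) by have [[]] := hv n.
have vu x : v_ n x @[n --> \oo] --> u x.
  apply/cvgrPdist_lt => e e0; have [n0 hn0] : exists n0 : nat, n0.+1%:R^-1 < e.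
    exists (Num.trunc (e^-1)); rewrite -[ltRHS]invrK ltf_pV2 ?posrE ?invr_gt0//.
    by have := truncnS_gt e^-1.
  exists (maxn n0 (choice.pickle x).+1) => // n /=; rewrite geq_max => /andP[n0n xn].
  have [[_ _ /(_ _ xn) h1] _] := hv n; apply: le_lt_trans h1 _; apply: le_lt_trans hn0.
  by rewrite lef_pV2 ?posrE// ler_nat ltnS.
(* The midpoint of v_n and v_k is in K n, so its energy is at least d n. *)
have half n k : (n <= k)%N ->
    energy (fun x => (v_ n x - v_ k x) / 2) <= (D - d n) / 2 + n.+1%:R^-1.
  move=> nk; have [Kn En_] := hv n; have [Kk Ek] := hv k.
  have := dE _ _ (Kmid _ _ _ Kn (Kdec _ _ nk _ Kk)).
  have := energy_clarkson (Hsp_fin (vHsp n)) (Hsp_fin (vHsp k)).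
  have := dD k; have : k.+1%:R^-1 <= n.+1%:R^-1 :> R by rewrite lef_pV2 ?posrE// ler_nat ltnS.
  move: En_ Ek; move: (d n) (d k) (k.+1%:R^-1) (n.+1%:R^-1) => a b c e.
  by move: (energy _) (energy _) (energy _) (energy _) => a1 b1 c1 d1; lra.
apply: Hsp_approx => // e e0.
pose e' := (2 `^ p)^-1 * e / 2.
have e'0 : 0 < e' by rewrite divr_gt0// mulr_gt0// invr_gt0 powR_gt0.
have [_ [n1 _ <-] hn1] := sup_adherent e'0 hsd.
have [n2 hn2] : exists n0 : nat, n0.+1%:R^-1 < e'.
  exists (Num.trunc (e'^-1)); rewrite -[ltRHS]invrK ltf_pV2 ?posrE ?invr_gt0//.
  by have := truncnS_gt e'^-1.
pose n := maxn n1 n2.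
have dn : d n1 <= d n.
  apply: lb_le_inf; first exact: (lb n).1.
  by move=> _ [v Kv <-]; apply: dE; apply: Kdec Kv; exact: leq_maxl.
have nn : n.+1%:R^-1 <= n2.+1%:R^-1 :> R by rewrite lef_pV2 ?posrE// ler_nat ltnS leq_maxr.
exists (v_ n) => //.
(* Fatou in k turns the Cauchy estimate into a bound on the distance to u. *)
have [_ h1] : fin_energy (fun x => (v_ n x - u x) / 2) /\ energy (fun x =>
  (v_ n x - u x) / 2) <= e' * 2.
  apply: (@energy_fatou _ \oo _ (fun k x => (v_ n x - v_ k x) / 2)).
    exists n => // k /= nk; split;
      first exact: (energy_half (fin_energyB (Hsp_fin (vHsp n)) (Hsp_fin (vHsp k))).1).1.
    apply: le_trans (half _ _ nk) _.
    by move: hn1 hn2 dn nn e'0; rewrite -/D -/n;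
      move: (d n) (d n1) (n.+1%:R^-1) (n2.+1%:R^-1) (D) (e') => *; lra.
  by move=> x; apply: cvgMl; apply: cvgB => //; exact: cvg_cst.
have fvu := (fin_energyB (Hsp_fin (vHsp n)) fu).1.
rewrite (energyC fu (Hsp_fin (vHsp n))).
rewrite (energy_half fvu).2 in h1.
by move: h1; rewrite /e' divfK// ler_pM2l// invr_gt0 powR_gt0.
Qed.

Variables (f : V -> R -> R) (alpha : R).
Hypothesis A1 : forall x : V, {within `[0, +oo[, continuous (f x)} /\ f x 0 = 0.
Hypothesis A2 : forall M : R, 0 < M -> exists C : R, forall (x : V) (y : R),
        0 <= y <= M -> f x y <= C.
Hypothesis alpha_gt : p < alpha.
Hypothesis A3 : forall (x : V) (y : R), 0 < y ->
        0 < alpha * primitive f x y /\ alpha * primitive f x y <= y * f x y.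
Hypothesis A5 : forall (x : V) (y z : R), 0 < y -> y < z ->
        f x y / y `^ (p - 1) < f x z / z `^ (p - 1).
Hypothesis hfin : forall M : R, exists A : {fset V}, forall x, x \notin A -> M <= h x.

(** * The nonlinear terms *)

(** [Bn], [Cn] and [Jn] are the integrals of [f(x,u+) u+], of [F(x,u+)] and of their
    combination [Hpos], with densities [Bt], [Ct] and [Jt] with respect to the counting
    measure. *)
Definition Bt u x := fpos f x (u x) * Num.max (u x) 0 * m x.
Definition Ct u x := Fpos f x (u x) * m x.
Definition Jt u x := Hpos p f x (u x) * m x.
Definition Bn u := tsum (Bt u).
Definition Cn u := tsum (Ct u).
Definition Jn u := tsum (Jt u).

Lemma pmass_term_le u x : `|u x| `^ p * m x <= hm^-1 * edens u x.
Proof.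
rewrite ler_pdivlMl// /edens mulrA ler_wpM2r ?(ltW (mu_gt0 G x))//.
apply: (@le_trans _ _ (h x * `|u x| `^ p)); last by rewrite lerDr powR_ge0.
by rewrite ler_wpM2r ?powR_ge0.
Qed.

Lemma max0_le (a : R) : Num.max a 0 <= `|a|.
Proof. by rewrite ge_max ler_norm normr_ge0. Qed.

Lemma max0_continuous : continuous (fun a : R => Num.max a 0).
Proof. by move=> a; apply: continuous_max; [exact: cvg_id|exact: cvg_cst]. Qed.

Lemma max0_ge0 (a : R) : 0 <= Num.max a 0.
Proof. by rewrite le_max lexx orbT. Qed.

Lemma Bt_ge0 u x : 0 <= Bt u x.
Proof.
by rewrite /Bt !mulr_ge0 ?max0_ge0 ?(ltW (mu_gt0 G x))//; exact: (fpos_ge0 p2 A1 alpha_gt A3).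
Qed.

Lemma Ct_ge0 u x : 0 <= Ct u x.
Proof.
by rewrite /Ct mulr_ge0 ?(ltW (mu_gt0 G x))//; exact: (Fpos_ge0 p2 alpha_gt A3).
Qed.

Lemma Ct_le u x : Ct u x <= Bt u x.
Proof. by rewrite /Ct /Bt ler_wpM2r ?(ltW (mu_gt0 G x))//; exact: (Fpos_le p2 A1 alpha_gt A3). Qed.

Lemma Bt_le (M : R) : 0 < M -> exists2 C : R, 0 <= C & forall u x, `|u x| <= M ->
  Bt u x <= C * (`|u x| `^ p * m x).
Proof.
move=> M0; have [C C0 hC] := fpos_growth A1 A2 A5 M0.
exists C => // u x ux; rewrite /Bt mulrA ler_wpM2r ?(ltW (mu_gt0 G x))//.
apply: (@le_trans _ _ (C * `|u x| `^ (p - 1) * `|u x|)); last first.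
  by rewrite -mulrA (mulrC (`|u x| `^ _)) mulr_powRB1 ?p_gt0.
apply: ler_pM => //; [exact: (fpos_ge0 p2 A1 alpha_gt A3)|exact: max0_ge0|exact: hC|exact: max0_le].
Qed.

Lemma JtE u x : Jt u x = p^-1 * Bt u x - Ct u x.
Proof. by rewrite /Jt /Bt /Ct /Hpos mulrBl; congr (_ - _); ring. Qed.

Lemma Bt_Ct_summ u : fin_energy u -> summ (Bt u) /\ summ (Ct u).
Proof.
move=> fu; have [M uM] := fin_bounded fu.
have M0 : 0 < `|M| + 1 by rewrite ltr_wpDl.
have [C C0 hC] := Bt_le M0.
have uM' x : `|u x| <= `|M| + 1.
  by apply: le_trans (uM x) _; rewrite (le_trans (ler_norm M))// lerDl.
have ks : summ (fun x => C * (hm^-1 * edens u x)) by do 2!apply: summZ.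
have BK x : Bt u x <= C * (hm^-1 * edens u x).
  by apply: le_trans (hC u x (uM' x)) _; rewrite ler_wpM2l// pmass_term_le.
split; apply: (summ_le ks) => x; rewrite ger0_norm ?Bt_ge0 ?Ct_ge0//.
exact: le_trans (Ct_le u x) _.
Qed.

Lemma Jn_E u : fin_energy u -> summ (Jt u) /\ Jn u = p^-1 * Bn u - Cn u.
Proof.
move=> fu; have [bs cs] := Bt_Ct_summ fu.
have bs' := summZ p^-1 bs.
rewrite /Jn (_ : Jt u = fun x => p^-1 * Bt u x - Ct u x); last by apply/funext => x; exact: JtE.
by split; [exact: summB|rewrite tsumB// tsumZ].
Qed.

(** Where [h >= M], the mass of [|u|^p] is at most [1 / M] times the energy; and [h] is
    at least [M] outside of a finite set. *)
Lemma edens_tail (C e : R) : 0 < e -> exists A : {fset V}, forall u B,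
  fin_energy u -> energy u <= C ->
  [disjoint A & B]%fset -> psum (fun x => `|u x| `^ p * m x) B <= e.
Proof.
move=> e0; pose M := (`|C| + 1) / e.
have C1 : 0 < `|C| + 1 by rewrite ltr_wpDl.
have M0 : 0 < M by rewrite divr_gt0.
have [A hA] := hfin M; exists A => u B fu uC AB.
apply: (@le_trans _ _ (psum (fun x => M^-1 * edens u x) B)).
  rewrite /psum big_seq [leRHS]big_seq; apply: ler_sum => x xB.
  have Mh : M <= h x by apply: hA; rewrite fdisjoint_sym in AB; exact: (fdisjointP AB).
  rewrite ler_pdivlMl// /edens mulrA ler_wpM2r ?(ltW (mu_gt0 G x))//.
  apply: (@le_trans _ _ (h x * `|u x| `^ p)); last by rewrite lerDr powR_ge0.
  by rewrite ler_wpM2r ?powR_ge0.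
rewrite psumZ ler_pdivrMl//; apply: le_trans (psum_le_tsum B (edens_ge0 u) fu) _.
by apply: (le_trans uC); rewrite /M divfK ?gt_eqF// (le_trans (ler_norm C))// lerDl.
Qed.

(** Both densities are bounded by a multiple of [|u|^p], whose tails are uniformly small
    by [edens_tail]. *)
Lemma Bn_Cn_cvg {T : Type} (F : set_system T) {FF : ProperFilter F}
    (u_ : T -> V -> R) u (C : R) :
  (\forall i \near F, fin_energy (u_ i) /\ energy (u_ i) <= C) ->
  (forall x, (fun i => u_ i x) @ F --> u x) ->
  (fun i => Bn (u_ i)) @ F --> Bn u /\ (fun i => Cn (u_ i)) @ F --> Cn u.
Proof.
move=> uC uF.
have M0 : 0 < `|supb C| + 1 by rewrite ltr_wpDl.
have [K K0 hK] := Bt_le M0.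
have hK' v x : fin_energy v -> energy v <= C -> Bt v x <= K * (`|v x| `^ p * m x).
  move=> fv Ev; apply: hK; apply: le_trans (norm_le_energy x fv Ev) _.
  by rewrite (le_trans (ler_norm _))// lerDl.
have K1 : 0 < K + 1 by rewrite ltr_wpDl.
have tl (e : R) : 0 < e -> exists A : {fset V}, \forall i \near F, forall B,
    [disjoint A & B]%fset -> psum (Bt (u_ i)) B <= e.
  move=> e0; have [A hA] := @edens_tail C _ (divr_gt0 e0 K1).
  exists A; apply: filterS uC => i [fi Ei] B AB.
  apply: (@le_trans _ _ (psum (fun x => K * (`|u_ i x| `^ p * m x)) B)).
    by apply: le_psum => x; exact: hK'.
  rewrite psumZ; apply: (@le_trans _ _ ((K + 1) * (e / (K + 1)))); last first.
    by rewrite mulrC divfK// gt_eqF.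
  apply: ler_pM => //; [|by rewrite lerDl|exact: hA].
  by apply: psum_ge0 => x; rewrite mulr_ge0 ?powR_ge0 ?(ltW (mu_gt0 G x)).
have cf x := @fpos_continuous R V f A1 x.
have cF x := @Fpos_continuous R V f A1 x.
have gc x : (fun i => fpos f x (u_ i x)) @ F --> fpos f x (u x).
  by apply: (continuous_cvg _ (f := fun i => u_ i x) (a := u x)); [exact: cf|exact: uF].
have Fc x : (fun i => Fpos f x (u_ i x)) @ F --> Fpos f x (u x).
  by apply: (continuous_cvg _ (f := fun i => u_ i x) (a := u x)); [exact: cF|exact: uF].
split.
  apply: (@tight_tsum _ _ _ F _ (fun i => Bt (u_ i)) (Bt u) _ _ _).2.
  - by apply: filterS uC => i [fi _]; exact: (Bt_Ct_summ fi).1.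
  - move=> e /tl[A hA]; exists A; apply: filterS hA => i hi B /hi; apply: le_trans.
    by apply: le_psum => x; rewrite ger0_norm ?Bt_ge0.
  - move=> x; apply: cvgMl; apply: cvgM => //.
    apply: (continuous_cvg _ (h := fun a : R => Num.max a 0) (f := fun i => u_ i x) (a := u x));
      [exact: max0_continuous|exact: uF].
apply: (@tight_tsum _ _ _ F _ (fun i => Ct (u_ i)) (Ct u) _ _ _).2.
- by apply: filterS uC => i [fi _]; exact: (Bt_Ct_summ fi).2.
- move=> e /tl[A hA]; exists A; apply: filterS hA => i hi B /hi; apply: le_trans.
  by apply: le_psum => x; rewrite ger0_norm ?Ct_ge0// Ct_le.
- by move=> x; apply: cvgMl.
Qed.

(** * Minimisation on the relaxed Nehari set *)

(** The Nehari set with an inequality in place of the identity: the energy is only lower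
    semicontinuous under pointwise limits, so that the inequality persists where the
    identity may be lost. *)
Definition relaxed u := [/\ Hsp G s p h u, u <> (fun=> 0) & energy u <= Bn u].

Variables (l delta0 : R).
Hypothesis delta0_gt0 : 0 < delta0.
Hypothesis l_lt : (l%:E < lambda_p G s p h)%E.
Hypothesis l_ge : forall x (y : R), 0 < y -> y < delta0 -> f x y <= l * y `^ (p - 1).

Definition pmass u := tsum (fun x => `|u x| `^ p * m x).

Lemma pmass_summ u : fin_energy u -> summ (fun x => `|u x| `^ p * m x).
Proof.
move=> fu; apply: (summ_le (summZ hm^-1 fu)) => x.
rewrite ger0_norm ?pmass_term_le// mulr_ge0 ?powR_ge0//; exact/ltW/mu_gt0.
Qed.

Lemma pmass_term_ge0 u x : 0 <= `|u x| `^ p * m x.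
Proof. by rewrite mulr_ge0 ?powR_ge0//; exact/ltW/mu_gt0. Qed.

Lemma pmass_gt0 u : fin_energy u -> u <> (fun=> 0) -> 0 < pmass u.
Proof.
move=> fu u0; have [x ux] : exists x, u x != 0.
  apply: contrapT => nx; apply: u0; apply/funext => x.
  by apply/eqP; apply: contrapT => ux; apply: nx; exists x; apply/negP.
apply: (@lt_le_trans _ _ (`|u x| `^ p * m x)).
  by rewrite mulr_gt0 ?mu_gt0// powR_gt0// normr_gt0.
by apply: le_tsum1 (pmass_summ fu) => y; exact: pmass_term_ge0.
Qed.

Lemma lambda_le u : Hsp G s p h u -> u <> (fun=> 0) -> l * pmass u < energy u.
Proof.
move=> Hu u0; have fu := Hsp_fin Hu; have S0 := pmass_gt0 fu u0.
have [M hM] := pmass_summ fu.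
have : (l%:E < p_energy G s p h u / vint_ge0 G (fun x => `|u x| `^ p)%R)%E.
  by apply: (lt_le_trans l_lt); apply: ereal_inf_lbound; exists u.
rewrite p_energyE// /vint_ge0 (esum_fin (pmass_term_ge0 u) (M := M)); last first.
  by move=> A; apply: le_trans (hM A); apply: le_psum => x; exact: ler_norm.
rewrite -/(pmass u) inver gt_eqF// -EFinM lte_fin => h1.
by rewrite -ltr_pdivlMr.
Qed.

(** If [u < delta0] everywhere, then [B(u) <= l |u|_p^p], and this is below the energy
    of [u]. *)
Lemma relaxed_large u : relaxed u -> exists x, delta0 <= u x.
Proof.
move=> [Hu u0 EB]; apply: contrapT => nx.
have small x : u x < delta0 by rewrite ltNge; apply/negP => ux; apply: nx; exists x.
have fu := Hsp_fin Hu.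
have [x0 _] : exists x, u x != 0.
  apply: contrapT => nx0; apply: u0; apply/funext => x.
  by apply/eqP; apply: contrapT => ux; apply: nx0; exists x; apply/negP.
have l0 : 0 <= l.
  have d2 : 0 < delta0 / 2 by rewrite divr_gt0.
  have := l_ge x0 d2 _; rewrite ltr_pdivrMr// ltr_pMr// ltr1n => /(_ isT) h1.
  have h2 := fpos_gt0 p2 alpha_gt A3 x0 d2; rewrite fpos_pos ?(ltW d2)// in h2.
  by have := lt_le_trans h2 h1; rewrite pmulr_lgt0 ?powR_gt0// => /ltW.
have := lambda_le Hu u0; rewrite ltNge => /negP; apply; apply: (le_trans EB).
rewrite /pmass -(tsumZ l (pmass_summ fu)); apply: le_tsum; first exact: (Bt_Ct_summ fu).1.
  by apply/summZ/pmass_summ.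
move=> x; rewrite /Bt mulrA ler_wpM2r ?(ltW (mu_gt0 G x))//.
have [ux|ux] := leP (u x) 0; first by rewrite mulr0 mulr_ge0 ?powR_ge0.
rewrite (fpos_pos _ _ (ltW ux)) (gtr0_norm ux) mulrC.
have := l_ge x ux (small x); rewrite -(ler_pM2l ux) => /le_trans; apply.
by rewrite mulrCA mulr_powRB1 ?p_gt0// ltW.
Qed.

(** By [A3], [C(u) <= B(u) / alpha], so [J(u) >= (1 / p - 1 / alpha) B(u)], and [B(u)]
    is at least the energy. *)
Lemma relaxed_coercive u : relaxed u -> energy u <= (p^-1 - alpha^-1)^-1 * Jn u.
Proof.
move=> [Hu u0 EB]; have fu := Hsp_fin Hu; have [bs cs] := Bt_Ct_summ fu.
have a0 := alpha_gt0 p2 alpha_gt.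
have k0 : 0 < p^-1 - alpha^-1 by rewrite subr_gt0 ltf_pV2 ?posrE ?p_gt0.
rewrite ler_pdivlMl//; apply: (@le_trans _ _ ((p^-1 - alpha^-1) * Bn u)).
  by rewrite ler_pM2l.
rewrite (Jn_E fu).2 mulrBl lerD2l lerN2 /Cn /Bn -tsumZ//.
apply: le_tsum => //; first exact: summZ.
move=> x; rewrite /Ct /Bt mulrA ler_wpM2r ?(ltW (mu_gt0 G x))// ler_pdivlMl//.
have [ux|ux] := leP (u x) 0; first by rewrite mulr0 (Fpos_neg _ _ ux) mulr0.
by rewrite (mulrC (fpos f x (u x))); exact: (ambrosetti_rabinowitz p2 alpha_gt A3 x ux).2.
Qed.

(** For a point mass at [z], the energy of [t delta_z] is a multiple of [t^p] and [B(t
    delta_z)] is [t^p mu(z)] times the slope at [t], which is unbounded. *)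
Lemma relaxed_neq0 (z : V) : relaxed !=set0.
Proof.
have fz := delta_fin z; have mz := mu_gt0 G z.
have [t t0 ht] := slope_unbounded p2 A1 alpha_gt A3 A5 z (energy (delta z) / m z).
exists (fun x => t * delta z x); split.
- by apply/HspZ/Cc_Hsp/delta_Cc.
- move=> /(congr1 (fun k => k z)); rewrite /delta eqxx mulr1 => t00.
  by rewrite t00 ltxx in t0.
rewrite (fin_energyZ t fz).2 gtr0_norm//.
have [|_ bz] := @tsum1 _ _ (Bt (fun x => t * delta z x)) z.
  by move=> x xz; rewrite /Bt /delta (negbTE xz) mulr0 maxxx mulr0 mul0r.
rewrite /Bn bz /Bt /delta eqxx mulr1 (max_l (ltW t0)) (mulrC (fpos f z t)).
rewrite (slope_mul f p2 z t0) -/(delta z) mulrAC mulrC ler_wpM2r ?powR_ge0// mulrC -ler_pdivrMl//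
  mulrC.
by move: ht; rewrite /slope.
Qed.

Lemma Jn_ge0 u : 0 <= Jn u.
Proof.
apply: tsum_ge0 => x; rewrite /Jt mulr_ge0 ?(ltW (mu_gt0 G x))//.
exact: (Hpos_ge0 p2 A1 alpha_gt A3).
Qed.

(** A cluster point of an ultrafilter is a limit. Ultrafilters serve in place of a
    diagonal extraction of subsequences, as one limit is needed at each vertex. *)
Lemma ultra_bounded_cvg (U : set_system nat) (a_ : nat -> R) (K : R) :
  UltraFilter U -> (forall n, `|a_ n| <= K) -> exists a : R, a_ @ U --> a.
Proof.
move=> UU aK.
have UK : (a_ @ U) `[- K, K]%classic.
  by rewrite /fmap /=; apply: filterS (@filterT _ U _) => n _ /=; rewrite in_itv /= -ler_norml.
have [a [_ aU]] := segment_compact (fmap_proper_filter a_ _) UK.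
exists a => B Ba; have [//|UB] := in_ultra_setVsetC (a_ @^-1` B) UU.
by have [x [/= xB /xB]] := aU (~` B) B UB Ba.
Qed.

(** The direct method: along an ultrafilter a minimising sequence of [J] converges at
    every vertex, [Hsp_closed] keeps the limit in the space, and [J] passes to the
    limit. *)
Lemma relaxed_minimizer (z0 : V) : exists2 u, relaxed u & forall v, relaxed v -> Jn u <= Jn v.
Proof.
pose S := Jn @` relaxed.
have hS : has_inf S.
  split; first by have [v Nv] := relaxed_neq0 z0; exists (Jn v); exists v.
  by exists 0 => _ [v _ <-]; exact: Jn_ge0.
pose mm := inf S.
have mJ v : relaxed v -> mm <= Jn v by move=> Nv; apply: ge_inf; [exact: hS.2|exists v].
have /choice[u_ hu] n : exists v, relaxed v /\ Jn v < mm + n.+1%:R^-1.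
  have n0 : 0 < n.+1%:R^-1 :> R by rewrite invr_gt0.
  by have [_ [v Nv <-] vm] := inf_adherent n0 hS; exists v.
have k0 : 0 < p^-1 - alpha^-1 by rewrite subr_gt0 ltf_pV2 ?posrE ?p_gt0// (alpha_gt0 p2 alpha_gt).
pose C := (p^-1 - alpha^-1)^-1 * (mm + 1).
have uHsp n : Hsp G s p h (u_ n) by have [[]] := hu n.
have ufin n : fin_energy (u_ n) by exact: Hsp_fin.
have uC n : energy (u_ n) <= C.
  have [Nu Ju] := hu n; apply: le_trans (relaxed_coercive Nu) _.
  rewrite ler_wpM2l ?invr_ge0 ?(ltW k0)//; apply: (le_trans (ltW Ju)).
  by rewrite lerD2l invf_le1 ?ler1n.
have [U [UU oU]] := @ultraFilterLemma nat \oo _.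
have UP : ProperFilter U by exact: ultra_proper.
have /choice[u uU] x : exists a : R, (fun n => u_ n x) @ U --> a.
  by apply: (@ultra_bounded_cvg U _ (supb C)) => n; exact: norm_le_energy.
have nearC : \forall n \near U, fin_energy (u_ n) /\ energy (u_ n) <= C by exact: nearW.
have [cB cC] := Bn_Cn_cvg nearC uU.
have [Hu _] : Hsp G s p h u /\ energy u <= C.
  by apply: (@Hsp_closed _ U _ u_) => //; exact: nearW.
have fu := Hsp_fin Hu.
exists u; last first.
  move=> v Nv; apply: le_trans (mJ v Nv).
  have cJ : (fun n => Jn (u_ n)) @ U --> Jn u.
    rewrite (Jn_E fu).2 (_ : (fun n => Jn (u_ n)) = fun n => p^-1 * Bn (u_ n) - Cn (u_ n)).
      by apply: cvgB => //; exact: cvgMr.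
    by apply/funext => n; exact: (Jn_E (ufin n)).2.
  apply/ler_addgt0Pr => e e0; apply: (cvgr_to_le cJ); apply: oU.
  exists (Num.trunc e^-1) => // n /= en; apply: ltW; apply: lt_le_trans (hu n).2 _.
  rewrite lerD2l -[leRHS]invrK lef_pV2 ?posrE ?invr_gt0//.
  by apply: le_trans (ltW (truncnS_gt _)) _; rewrite ler_nat ltnS.
split => //.
(* Each u_n has a value of at least delta0, and by the energy bound it is attained in
   one finite set A outside of which h is large: pointwise convergence to 0 is excluded. *)
- move=> u0; have dp : 0 < delta0 `^ p * m0 by rewrite mulr_gt0// powR_gt0.
  have [A hA] := hfin (C / (delta0 `^ p * m0) + 1).
  have large n : exists2 x, x \in A & delta0 <= u_ n x.
    have [x ux] := relaxed_large (hu n).1; exists x => //; apply: contrapT => /negP xA.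
    have := hA x xA; apply/negP; rewrite -ltNge.
    suff : h x <= C / (delta0 `^ p * m0) by move/le_lt_trans; apply; rewrite ltrDl.
    rewrite ler_pdivlMr//; apply: le_trans (uC n).
    apply: le_trans (le_tsum1 x (edens_ge0 _) (ufin n)).
    rewrite /edens mulrA; apply: ler_pM => //.
    + by rewrite mulr_ge0 ?powR_ge0// ltW.
    + exact: ltW.
    apply: (@le_trans _ _ (h x * `|u_ n x| `^ p)); last by rewrite lerDr powR_ge0.
    rewrite ler_pM2l//; apply: le_powR; [exact/ltW/p_gt0|exact/ltW|].
    exact: le_trans ux (ler_norm _).
  have : \forall n \near U, forall x, x \in A -> u_ n x < delta0.
    suff H (r : seq V) : \forall n \near U, forall x, x \in r -> u_ n x < delta0 by exact: H.
    elim: r => [|x r IH]; first by apply: nearW => n x; rewrite in_nil.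
    have hx : \forall n \near U, u_ n x < delta0.
      by have := uU x; rewrite u0 => /cvgr_lt; apply.
    apply: filterS2 hx IH => n h1 h2 y; rewrite inE => /orP[/eqP -> //|]; exact: h2.
  by move=> /filter_ex[n hn]; have [x xA] := large n; rewrite leNgt hn.
- apply/ler_addgt0Pr => e e0.
  have nB : \forall n \near U, Bn (u_ n) < Bn u + e by apply: (cvgr_lt _ cB); rewrite ltrDl.
  (* Near the ultrafilter the energy of u_n is at most B(u_n) < B(u) + e, a bound which
     closedness passes on to u. *)
  have [_] : Hsp G s p h u /\ energy u <= Bn u + e; last by [].
  apply: (@Hsp_closed _ U _ u_) => //; apply: filterS nB => n Bu; split => //.
  by have [[_ _ EB] _] := hu n; apply: (le_trans EB); exact: ltW.
Qed.

(** * Two-parameter perturbations *)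

(** The parameter [t] brings the perturbation [u + e w] back to the Nehari set. *)
Definition pencil u w (t e : R) : V -> R := fun x => t * u x + e * w x.

Section Pencil.
Variables (u w : V -> R).
Hypotheses (fu : fin_energy u) (fw : fin_energy w).

Definition pencil_dom x := 2 `^ p * (2 `^ p * edens u x + 2 `^ p * edens w x).

Lemma pencil_dom_summ : summ pencil_dom.
Proof. by apply/summZ/summD; exact: summZ. Qed.

Lemma pencil_fin t e : fin_energy (pencil u w t e).
Proof. by apply: (fin_energyD _ _).1; apply: (fin_energyZ _ _).1. Qed.

Lemma edens_pencil t e x : `|t| <= 2 -> `|e| <= 2 -> edens (pencil u w t e) x <= pencil_dom x.
Proof.
move=> t2 e2; have bu := fin_bounded fu; have bw := fin_bounded fw.
apply: le_trans (edensD x (fboundedZ t bu) (fboundedZ e bw)) _.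
rewrite !edensZ// /pencil_dom ler_wpM2l ?powR_ge0// lerD// ler_wpM2r ?edens_ge0// le_powR//;
  exact/ltW/p_gt0.
Qed.

(** For [t] and [e] in a bounded set the densities have the common summable majorant
    [pencil_dom]. *)
Lemma pencil_cvg {T : Type} (F : set_system T) {FF : ProperFilter F} (t_ e_ : T -> R) (t e : R) :
  t_ @ F --> t -> e_ @ F --> e -> `|t| < 2 -> `|e| < 2 ->
  [/\ (fun i => energy (pencil u w (t_ i) (e_ i))) @ F --> energy (pencil u w t e),
      (fun i => tsum (dedens (pencil u w (t_ i) (e_ i)) w)) @ F --> tsum (dedens (pencil u w t e) w)
    & (fun i => Bn (pencil u w (t_ i) (e_ i))) @ F --> Bn (pencil u w t e)].
Proof.
move=> ct ce t2 e2; have bu := fin_bounded fu; have bw := fin_bounded fw.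
have nt : \forall i \near F, `|t_ i| <= 2 by apply: (cvgr_le _ (cvg_norm ct)).
have ne : \forall i \near F, `|e_ i| <= 2 by apply: (cvgr_le _ (cvg_norm ce)).
have nd : \forall i \near F, forall x, edens (pencil u w (t_ i) (e_ i)) x <= pencil_dom x.
  by apply: filterS2 nt ne => i hi hi' x; exact: edens_pencil.
have nE : \forall i \near F,
  fin_energy (pencil u w (t_ i) (e_ i)) /\ energy (pencil u w (t_ i) (e_ i)) <= tsum pencil_dom.
  apply: filterS nd => i hi; split; first exact: pencil_fin.
  by apply: le_tsum => //; [exact: pencil_fin|exact: pencil_dom_summ].
have nK : \forall i \near F, forall x, `|pencil u w (t_ i) (e_ i) x| <= supb (tsum pencil_dom).
  by apply: filterS nE => i [fi Ei] x; exact: norm_le_energy.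
have cp x : (fun i => pencil u w (t_ i) (e_ i) x) @ F --> pencil u w t e x.
  by apply: cvgD; exact: cvgMl.
split; last by have [] := Bn_Cn_cvg nE cp.
- apply: (@dominated_tsum _ _ _ F _ (fun i =>
  edens (pencil u w (t_ i) (e_ i))) _ pencil_dom pencil_dom_summ _ _).2.
    by apply: filterS nd => i hi x; rewrite ger0_norm ?edens_ge0.
  by move=> x; exact: (@edens_cvg _ F _ _ _ _ _ nK).
- apply: (@dominated_tsum _ _ _ F _ (fun i => dedens (pencil u w (t_ i) (e_ i)) w) _
    (fun x => pencil_dom x + edens w x) (summD pencil_dom_summ fw) _ _).2.
    apply: filterS nd => i hi x.
    apply: le_trans (dedens_le x (fin_bounded (pencil_fin _ _)) bw ltr01) _.
    by rewrite mul1r powR1 mul1r lerD2r.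
  by move=> x; exact: (@dedens_cvg _ F _ _ _ _ _ _ bw nK).
Qed.
End Pencil.

Lemma scale_pencil u t : (fun x => t * u x) = pencil u u t 0.
Proof. by apply/funext => x; rewrite /pencil mul0r addr0. Qed.

Lemma Bt_slope u x : 0 < u x -> Bt u x = slope p f x (u x) * `|u x| `^ p * m x.
Proof.
by move=> ux; rewrite /Bt (max_l (ltW ux)) (gtr0_norm ux) (mulrC (fpos _ _ _)) (slope_mul f p2 x
  ux).
Qed.

Lemma Bt_neg u x : u x <= 0 -> Bt u x = 0.
Proof. by move=> ux; rewrite /Bt (fpos_neg A1 x ux) !mul0r. Qed.

Lemma relaxed_pos u : relaxed u -> exists x, 0 < u x.
Proof. by move=> /relaxed_large[x ux]; exists x; exact: lt_le_trans ux. Qed.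

Lemma near_lt {T : Type} {F : set_system T} {FF : Filter F} (a b : T -> R) (A B : R) :
  a @ F --> A -> b @ F --> B -> A < B -> \forall i \near F, a i < b i.
Proof.
move=> ca cb AB; have c : (fun i => b i - a i) @ F --> B - A by exact: cvgB.
have : \forall i \near F, 0 < b i - a i by apply: (cvgr_gt _ c); rewrite subr_gt0.
by apply: filterS => i; rewrite subr_gt0.
Qed.

Lemma cvg_sub {T : Type} {F : set_system T} {FF : Filter F} (a b : T -> R) (A B : R) :
  a @ F --> A -> b @ F --> B -> (fun i => a i - b i) @ F --> A - B.
Proof. by move=> ca cb; exact: cvgB. Qed.

Lemma step_bounds (r : R) : 0 < r -> r <= 1 / 2 -> [/\ 0 < 1 - r, 1 - r < 1, 0 < 1 + r & 1 < 1 + r].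
Proof. by move=> *; split; lra. Qed.

Lemma step_mem (r t : R) : 0 < r -> r <= 1 / 2 -> 1 - r <= t -> t <= 1 + r -> [/\ `|t - 1| <= r,
  0 < t & `|t| < 2].
Proof. by move=> *; split; [rewrite ler_norml; apply/andP; split| |rewrite ger0_norm]; lra. Qed.

(** The convex energy lies above its tangent, which bounds its increase from one point
    to another in terms of the derivative at the second one. *)
Lemma descent_aux (q e A B C D X Y : R) : 0 < q -> 0 < e -> A - q * (e * X) <= B -> C - D = e * Y
  -> X < Y ->
  q^-1 * A - C < q^-1 * B - D.
Proof.
move=> q0 e0 h1 h2 h3; have h4 : q^-1 * A - q^-1 * B <= e * X.
  by rewrite -mulrBr ler_pdivrMl//; lra.
have h5 : e * X < e * Y by rewrite ltr_pM2l.
move: (q^-1 * A) (q^-1 * B) (e * X) (e * Y) h2 h4 h5 => {h1}a b c d *; lra.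
Qed.

Lemma between_dist (a b y : R) : Num.min b a <= y <= Num.max b a -> `|y - b| <= `|a - b|.
Proof.
have [ba|/ltW ab] := leP b a.
  by rewrite ?minElt; case/andP => h1 h2; rewrite !ger0_norm ?subr_ge0 ?lerD2r.
by case/andP => h1 h2; rewrite !ler0_norm ?subr_le0// lerN2 lerD2r.
Qed.

(** * The minimiser is on the Nehari set *)

(** If [energy u < B(u)] then [t u] satisfies the same inequality for [t < 1] close to
    1, by continuity, and [J(t u) < J(u)] because [Hpos x] is strictly increasing on
    positive arguments and [u] has a positive value. *)
Lemma minimizer_nehari u : relaxed u -> (forall v, relaxed v -> Jn u <= Jn v) -> energy u = Bn u.
Proof.
move=> Nu minu; have [Hu u0 EB] := Nu; have fu := Hsp_fin Hu.
apply/eqP; rewrite eq_le EB /= leNgt; apply/negP => ltEB.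
have [x ux] := relaxed_pos Nu.
have p1 : pencil u u 1 0 = u by apply/funext => y; rewrite /pencil mul0r addr0 mul1r.
have lt12 : `|1 : R| < 2 by rewrite normr1 ltr1n.
have lt02 : `|0 : R| < 2 by rewrite normr0.
have cid : (fun t : R => t) @ (1 : R)^'- --> (1 : R) by apply: cvg_at_left_filter; exact: cvg_id.
have [cE _ cB] := @pencil_cvg u u fu fu R (1 : R)^'- _ _ _ _ _ cid (cvg_cst (0 : R)) lt12 lt02.
rewrite p1 in cE cB.
have near_gap : \forall t \near (1 : R)^'-, energy (pencil u u t 0) < Bn (pencil u u t 0).
  exact: (near_lt cE cB ltEB).
have near0 : \forall t \near (1 : R)^'-, 0 < t by apply: nbhs_left_gt.
have near1 : \forall t \near (1 : R)^'-, t < 1 by apply: nbhs_left_lt.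
have near3 : \forall t \near (1 : R)^'-, [/\ energy (pencil u u t 0) < Bn (pencil u u t 0),
  0 < t & t < 1].
  by apply: filterS3 near_gap near0 near1.
have [t [tgap t0 t1]] := @filter_ex _ _ (at_left_proper_filter (1 : R)) _ near3.
rewrite -scale_pencil in tgap.
have Hv : Hsp G s p h (fun x => t * u x) by exact: HspZ.
have Nv : relaxed (fun x => t * u x).
  split => //; last exact: ltW.
  move=> /(congr1 (fun k => k x)) /eqP; rewrite mulf_eq0.
  by rewrite (gt_eqF t0) (gt_eqF ux).
have := minu _ Nv; apply/negP; rewrite -ltNge.
have Hm y : Hpos p f y (t * u y) <= Hpos p f y (u y) /\ (0 < u y -> Hpos p f y (t * u y) < Hpos p
  f y (u y)).
  have [uy|uy] := leP (u y) 0.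
    by split => //; rewrite !(Hpos_neg _ A1)// mulr_ge0_le0// ltW.
  have H1 : Hpos p f y (t * u y) < Hpos p f y (u y).
    apply: (Hpos_lt p2 A1 A5 y); first exact: mulr_gt0.
    by rewrite gtr_pMl.
  by split => //; exact: ltW.
apply: (@lt_tsum _ _ _ _ x); [exact: (Jn_E (Hsp_fin Hv)).1|exact: (Jn_E fu).1| |].
  by move=> y; rewrite /Jt ler_wpM2r ?(ltW (mu_gt0 G y))//; exact: (Hm y).1.
by rewrite /Jt ltr_pM2r ?mu_gt0//; exact: (Hm x).2.
Qed.

(** * The Euler-Lagrange equation *)

Definition functional_real u := p^-1 * energy u - Cn u.

Lemma functional_real_nehari u : fin_energy u -> energy u = Bn u -> functional_real u = Jn u.
Proof. by move=> fu EB; rewrite /functional_real EB (Jn_E fu).2. Qed.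

(** On the ray through a point of the Nehari set the functional is largest at [t = 1]:
    its energy part is linear in [t^p] and [F] is convex as a function of [t^p], so the
    functional lies below its tangent at [t = 1], which is horizontal. *)
Lemma functional_real_ray u t : fin_energy u -> energy u = Bn u -> 0 < t ->
  functional_real (fun x => t * u x) <= functional_real u.
Proof.
move=> fu EB t0; have [ft Et] := fin_energyZ t fu.
have [bs cs] := Bt_Ct_summ fu; have [_ cts] := Bt_Ct_summ ft.
rewrite /functional_real Et (gtr0_norm t0) EB.
have bs' := summZ ((t `^ p - 1) / p) bs.
have : Cn u + (t `^ p - 1) / p * Bn u <= Cn (fun x => t * u x).
  rewrite /Cn /Bn -(tsumZ _ bs) -(tsumD cs bs'); apply: le_tsum => //; first exact: summD.
  move=> x; have [ux|ux] := leP (u x) 0.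
    rewrite Bt_neg// /Ct !Fpos_neg//; last by rewrite mulr_ge0_le0// ltW.
    by rewrite mulr0 !mul0r addr0.
  rewrite Bt_slope// (gtr0_norm ux) /Ct.
  have := Fpos_pconvex p2 A1 A5 x (mulr_gt0 t0 ux) ux.
  rewrite powRM ?(ltW t0) ?(ltW ux)// => /(ler_wpM2r (ltW (mu_gt0 G x))); apply: le_trans.
  by rewrite le_eqVlt; apply/orP; left; apply/eqP; ring.
move: (Cn _) (Bn u) (Cn u) (t `^ p) => a b d e hab;
  apply: (@le_trans _ _ (p^-1 * (e * b) - (d + (e - 1) / p * b))).
  by rewrite lerD2l lerN2.
by rewrite le_eqVlt; apply/orP; left; apply/eqP; ring.
Qed.

(** [B(t u) / t^p] is strictly increasing in [t], since the slope is. So [energy - B]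
    changes sign from positive to negative at a point of the Nehari set. *)
Lemma Bn_scale u a b x0 : fin_energy u -> 0 < u x0 -> 0 < a -> a < b ->
  b `^ p * Bn (fun x => a * u x) < a `^ p * Bn (fun x => b * u x).
Proof.
move=> fu ux0 a0 ab; have b0 := lt_trans a0 ab.
have [ba _] := Bt_Ct_summ (fin_energyZ a fu).1; have [bb _] := Bt_Ct_summ (fin_energyZ b fu).1.
rewrite /Bn -(tsumZ _ ba) -(tsumZ _ bb).
have key x : 0 < u x -> b `^ p * Bt (fun x => a * u x) x < a `^ p * Bt (fun x => b * u x) x.
  move=> ux; have aux := mulr_gt0 a0 ux; have bux := mulr_gt0 b0 ux.
  rewrite !Bt_slope// !gtr0_norm// !powRM ?(ltW a0) ?(ltW b0) ?(ltW ux)//.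
  have sl := slope_lt A5 x aux (_ : a * u x < b * u x); rewrite ltr_pM2r// in sl.
  have P : 0 < a `^ p * b `^ p * u x `^ p * m x by rewrite !mulr_gt0 ?powR_gt0 ?mu_gt0.
  have := sl ab; rewrite -(ltr_pM2r P); move: (slope _ _ _ _) (slope _ _ _ _) => A B.
  by congr (_ < _); ring.
apply: (@lt_tsum _ _ _ _ x0); [exact: summZ|exact: summZ| |exact: key].
move=> x; have [ux|/key/ltW//] := leP (u x) 0.
by rewrite !Bt_neg ?mulr0// mulr_ge0_le0// ltW.
Qed.

Lemma dedensZ u w c x : fbounded u -> fbounded w ->
  dedens u (fun y => c * w y) x = c * dedens u w x.
Proof. by move=> bu bw; rewrite /dedens gradZr//; ring. Qed.

Lemma dedens_summ u w : fin_energy u -> fin_energy w -> summ (dedens u w).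
Proof.
move=> fu fw; apply: (summ_le (summD fu fw)) => x.
have := dedens_le x (fin_bounded fu) (fin_bounded fw) ltr01.
by rewrite mul1r powR1 mul1r.
Qed.

(** Otherwise the derivative is negative in the direction [w] of plus or minus the point
    mass at [z], and remains so at all [t u + e w] with [t] close to 1 and [e] close to
    0. The functional at [t u + e w] is then less than at [t u], hence less than at [u].
    For a fixed small [e] the difference [energy - B] at [t u + e w] changes sign as [t]
    goes from [1 - r] to [1 + r], so that some [t u + e w] is on the Nehari set, with a
    value of [J] below the minimum. *)
Lemma euler_lagrange u z : relaxed u -> (forall v, relaxed v -> Jn u <= Jn v) ->
  tsum (dedens u (delta z)) = fpos f z (u z) * m z.
Proof.
move=> Nu minu; have EB := minimizer_nehari Nu minu.
have [Hu u0 _] := Nu; have fu := Hsp_fin Hu.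
set D := tsum _; set c := _ * _; apply: contrapT => Dc.
(* sg is the sign for which sg * delta z is a direction of descent. *)
pose sg : R := if c < D then -1 else 1.
have sg1 : `|sg| = 1 by rewrite /sg; case: ifP; rewrite ?normrN normr1.
have sDc : sg * (D - c) < 0.
  rewrite /sg; have [cD|Dc'] := ltP c D; first by rewrite mulN1r oppr_lt0 subr_gt0.
  by rewrite mul1r subr_lt0 lt_neqAle Dc' andbT; apply/eqP.
pose w x := sg * delta z x.
have fw : fin_energy w by exact: (fin_energyZ sg (delta_fin z)).1.
have Hw : Hsp G s p h w by apply/HspZ/Cc_Hsp/delta_Cc.
have Dw : tsum (dedens u w) = sg * D.
  rewrite /D -(tsumZ _ (dedens_summ fu (delta_fin z))); congr tsum; apply/funext => x.
  by rewrite dedensZ//; [exact: fin_bounded|exact: delta_bounded].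
(* eta is half of the gap between the two sides: each may move by eta. *)
pose eta := - (sg * (D - c)) / 2.
have eta0 : 0 < eta by rewrite divr_gt0// oppr_gt0.
have eta2 : sg * D + eta = sg * c - eta by rewrite /eta; field.
have p1 : pencil u w 1 0 = u by apply/funext => y; rewrite /pencil mul0r addr0 mul1r.
have lt12 : `|1 : R| < 2 by rewrite normr1 ltr1n.
have lt02 : `|0 : R| < 2 by rewrite normr0.
pose F := nbhs ((1 : R), (0 : R)).
have c1 : (fun q : R * R => q.1) @ F --> (1 : R) by exact: cvg_fst.
have c2 : (fun q : R * R => q.2) @ F --> (0 : R) by exact: cvg_snd.
have [_ cD _] := @pencil_cvg u w fu fw _ F _ _ _ _ _ c1 c2 lt12 lt02.
rewrite p1 Dw in cD.
have nD : \forall q \near F, tsum (dedens (pencil u w q.1 q.2) w) < sg * D + eta.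
  by apply: (cvgr_lt _ cD); rewrite ltrDl.
have [rho rho0 hrho] : exists2 rho : R, 0 < rho &
    forall y : R, `|y - u z| < rho -> sg * c - eta < sg * (fpos f z y * m z).
  have cfz : (fun y : R => sg * (fpos f z y * m z)) @ u z --> sg * c.
    by apply: cvgMr; apply: cvgMl; exact: fpos_continuous.
  have : \forall y \near u z, sg * c - eta < sg * (fpos f z y * m z).
    by apply: (cvgr_gt _ cfz); rewrite gtrBl.
  by move=> [rho /= rho0 hrho]; exists rho => // y; rewrite distrC; exact: hrho.
have nR : \forall q \near F, `|q.1 * u z - u z| + `|q.2| < rho.
  have cR : (fun q : R * R => `|q.1 * u z - u z| + `|q.2|) @ F --> `|1 * u z - u z| + `|0 : R|.
    apply: cvgD; last exact: cvg_norm.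
    by apply: cvg_norm; apply: cvgB; [exact: cvgMl|exact: cvg_cst].
  by apply: (cvgr_lt _ cR); rewrite mul1r subrr normr0 addr0.
have nDR : \forall q \near F,
  tsum (dedens (pencil u w q.1 q.2) w) < sg * D + eta /\ `|q.1 * u z - u z| + `|q.2| < rho.
  by apply: filterS2 nD nR.
move: nDR => /nbhs_ballP[r0 /= r00 hr].
pose r := Num.min (r0 / 2) (1 / 2).
have rp : 0 < r by rewrite lt_min !divr_gt0.
have rr0 : r < r0 by rewrite gt_min; apply/orP; left; lra.
have r12 : r <= 1 / 2 by rewrite ge_min lexx orbT.
(* Moving by e w lowers the functional: the energy by its tangent inequality at the new
   point, F by the mean value theorem at the only vertex z that moves. *)
have descent (t e : R) : `|t - 1| <= r -> 0 < e -> e <= r ->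
    functional_real (pencil u w t e) < functional_real (fun x => t * u x).
  move=> tr e0 er.
  have [] := hr (t, e).
    split => /=; first by rewrite /ball /= distrC; exact: le_lt_trans tr rr0.
    by rewrite /ball /= sub0r normrN gtr0_norm//; exact: le_lt_trans er rr0.
  move=> /= hD hR.
  have fv := pencil_fin fu fw t e; have ft := (fin_energyZ t fu).1.
  have ds := dedens_summ fv fw.
  have E1 : energy (pencil u w t e) - p * (e * tsum (dedens (pencil u w t e) w)) <= energy (fun x
    => t * u x).
    have ds' := summZ (p * e) ds.
    rewrite mulrA /energy -(tsumZ _ ds) -(tsumB fv ds'); apply: le_tsum => //; first exact: summB.
    move=> x; have bw := fin_bounded fw.
    have := edens_tangent x (fin_bounded fv) (fboundedZ (- e) bw).
    rewrite (dedensZ _ _ (fin_bounded fv) bw).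
    have -> : (fun y => pencil u w t e y + - e * w y) = (fun y => t * u y).
      by apply/funext => y; rewrite /pencil mulNr addrK.
    by rewrite mulNr mulrN mulrA.
  have [y hy E2] := Fpos_MVT A1 z (t * u z) (pencil u w t e z).
  have wz : w z = sg by rewrite /w /delta eqxx mulr1.
  have E3 : Cn (pencil u w t e) - Cn (fun x => t * u x) = e * (sg * (fpos f z y * m z)).
    have [_ cv] := Bt_Ct_summ fv; have [_ ct] := Bt_Ct_summ ft.
    rewrite /Cn -tsumB//.
    have [x xz|_ ->] := @tsum1 _ _ (fun x => Ct (pencil u w t e) x - Ct (fun x => t * u x) x) z.
      by rewrite /Ct /pencil /w /delta (negbTE xz) !mulr0 addr0 subrr.
    rewrite /Ct -mulrBl E2 /pencil wz; ring.
  have yz : `|y - u z| < rho.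
    apply: le_lt_trans hR; apply: (le_trans _ (_ : `|y - t * u z| + `|t * u z - u z| <= _)).
      by rewrite (le_trans _ (ler_normD _ _))// addrA subrK.
    rewrite addrC lerD2l.
    have <- : `|pencil u w t e z - t * u z| = `|e|.
      by rewrite /pencil addrAC subrr add0r wz normrM sg1 mulr1.
    exact: between_dist hy.
  have h3 := hrho y yz.
  have h4 : tsum (dedens (pencil u w t e) w) < sg * (fpos f z y * m z).
    apply: (lt_trans hD); apply: le_lt_trans h3.
    by rewrite eta2.
  exact: (descent_aux p_gt0 e0 E1 E3 h4).
have [x0 ux0] := relaxed_pos Nu.
have [r1 r1' r2 r2'] := step_bounds rp r12.
have idp : (fun e : R => e) @ (0 : R)^'+ --> (0 : R) by apply: cvg_at_right_filter; exact: cvg_id.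
have pen0 t : pencil u w t 0 = (fun x => t * u x).
  by apply/funext => y; rewrite /pencil mul0r addr0.
have lt_m : `|1 - r| < 2 by rewrite gtr0_norm// (lt_trans r1') ?ltr1n.
have lt_p : `|1 + r| < 2 by rewrite gtr0_norm// (natrD _ 1 1) ltrD2l (le_lt_trans r12)//
  ltr_pdivrMr// mul1r ltr1n.
have [cE1 _ cB1] := @pencil_cvg u w fu fw R (0 : R)^'+ _ _ _ _ _ (cvg_cst (1 - r)) idp lt_m lt02.
have [cE2 _ cB2] := @pencil_cvg u w fu fw R (0 : R)^'+ _ _ _ _ _ (cvg_cst (1 + r)) idp lt_p lt02.
rewrite pen0 in cE1 cB1; rewrite pen0 in cE2 cB2.
have u1 : (fun x => 1 * u x) = u by apply/funext => x; rewrite mul1r.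
have g1 : Bn (fun x => (1 - r) * u x) < energy (fun x => (1 - r) * u x).
  rewrite (fin_energyZ _ fu).2 EB (gtr0_norm r1).
  by have := Bn_scale fu ux0 r1 r1'; rewrite powR1 mul1r u1.
have g2 : energy (fun x => (1 + r) * u x) < Bn (fun x => (1 + r) * u x).
  rewrite (fin_energyZ _ fu).2 EB (gtr0_norm r2).
  by have := Bn_scale fu ux0 ltr01 r2'; rewrite powR1 mul1r u1.
have n1 : \forall e \near (0 : R)^'+, Bn (pencil u w (1 - r) e) < energy (pencil u w (1 - r) e).
  exact: (near_lt cB1 cE1 g1).
have n2 : \forall e \near (0 : R)^'+, energy (pencil u w (1 + r) e) < Bn (pencil u w (1 + r) e).
  exact: (near_lt cE2 cB2 g2).
have n3 : \forall e \near (0 : R)^'+, 0 < e by exact: nbhs_right_gt.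
have n4 : \forall e \near (0 : R)^'+, e <= r by exact: nbhs_right_le.
(* This condition keeps t u + e w positive at x0, hence different from 0. *)
have n5 : \forall e \near (0 : R)^'+, e < (1 - r) * u x0 by apply: nbhs_right_lt; exact: mulr_gt0.
have n6 : \forall e \near (0 : R)^'+, [/\ Bn (pencil u w (1 - r) e) < energy (pencil u w (1 - r) e),
    energy (pencil u w (1 + r) e) < Bn (pencil u w (1 + r) e), 0 < e, e <= r & e < (1 - r) * u x0].
  have n34 : \forall e \near (0 : R)^'+, [/\ 0 < e, e <= r & e < (1 - r) * u x0].
    by apply: filterS3 n3 n4 n5.
  by apply: filterS3 n1 n2 n34 => e q1 q2 [].
have [e [ge1 ge2 e0 er ex0]] := @filter_ex _ _ (at_right_proper_filter (0 : R)) _ n6.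
pose phi t := energy (pencil u w t e) - Bn (pencil u w t e).
have cphi : {within `[1 - r, 1 + r], continuous phi}.
  apply: continuous_in_subspaceT => t; rewrite inE /= in_itv /= => /andP[t1 t2].
  have [_ _ lt_t] := step_mem rp r12 t1 t2.
  have lt_e : `|e| < 2 by rewrite gtr0_norm// (le_lt_trans er)// (le_lt_trans r12)//
    ltr_pdivrMr// -natrM ltr1n.
  have [cE _ cB] := @pencil_cvg u w fu fw R (nbhs t) _ _ _ _ _ (@cvg_id _ _) (cvg_cst e) lt_t lt_e.
  exact: cvg_sub cE cB.
have r1r : 1 - r <= 1 + r := ltW (lt_trans r1' r2').
have [|t] := @IVT _ phi (1 - r) (1 + r) 0 r1r cphi.
  have phi1 : 0 <= phi (1 - r) by rewrite subr_ge0 ltW.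
  have phi2 : phi (1 + r) <= 0 by rewrite subr_le0 ltW.
  by rewrite ge_min le_max phi1 phi2 orbT.
rewrite in_itv /= => /andP[t1 t2] /eqP; rewrite subr_eq0 => /eqP EBv.
have [tr t0 _] := step_mem rp r12 t1 t2.
have fv := pencil_fin fu fw t e.
have Nv : relaxed (pencil u w t e).
  split; last by rewrite EBv.
    by apply: HspD; exact: HspZ.
  move=> /(congr1 (fun k => k x0)); apply/eqP; rewrite gt_eqF//.
  have h1 : (1 - r) * u x0 <= t * u x0 by rewrite ler_wpM2r ?(ltW ux0).
  have h2 : - e <= e * w x0.
    rewrite lerNl -mulrN (le_trans (ler_norm _))// normrM (gtr0_norm e0) normrN.
    by rewrite ler_piMr ?(ltW e0)// /w normrM sg1 mul1r /delta normr_nat lern1 leq_b1.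
  apply: lt_le_trans (lerD h1 h2); by rewrite subr_gt0.
have := minu _ Nv; apply/negP;
  rewrite -ltNge -(functional_real_nehari fv EBv) -(functional_real_nehari fu EB).
exact: lt_le_trans (descent t e tr e0 er) (functional_real_ray fu EB t0).
Qed.

(** * The pointwise equation and positivity *)

Definition plap_term u x y := W x y * (N u x `^ (p - 2) + N u y `^ (p - 2)) * (u x - u y).

Lemma frac_p_laplacianE u x : frac_p_laplacian G s p u x = (2 * m x)^-1 * tsum (plap_term u x).
Proof. by rewrite /frac_p_laplacian vsum_setC1// subrr mulr0. Qed.

(** At [x <> z] only the term [y = z] of the gradient product survives and gives, by
    symmetry of the weights, the half of the operator with the factor [|grad
    u|^(p-2)(x)]; at [x = z] all terms survive and give the half with the factor at [z]. *)
Lemma first_variation_delta u z : fin_energy u -> summ (plap_term u z) /\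
  tsum (dedens u (delta z)) = m z * (frac_p_laplacian G s p u z + h z * `|u z| `^ (p - 2) * u z).
Proof.
move=> fu; have bu := fin_bounded fu; have mz := mu_gt0 G z.
pose A x := N u x `^ (p - 2) * (W z x * (u z - u x)).
pose C x := W z x * (u z - u x).
pose B x := if x == z then dedens u (delta z) z else 0.
have dE x : dedens u (delta z) x = 2^-1 * A x + B x.
  rewrite /B; have [->|xz] := eqVneq x z; first by rewrite /A subrr !mulr0 add0r.
  have mx := mu_gt0 G x.
  rewrite /dedens /A addr0 frac_grad_prodE.
  have [|_ ->] := @tsum1 _ _ (gterm u (delta z) x) z.
    by move=> y yz; rewrite /gterm /delta (negbTE xz) (negbTE yz) subrr mulr0.
  rewrite /gterm /delta (negbTE xz) eqxx (Wsym x z) mulr0n mulr1n.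
  move: (W z x) (N u x `^ _) mx => w n /lt0r_neq0 mx; by field.
have [Bs tB] := @tsum1 _ _ B z (fun x => @ifN_eq _ _ _ _ _ _).
have ds := dedens_summ fu (delta_fin z).
have As' : summ (fun x => 2^-1 * A x).
  have -> : (fun x => 2^-1 * A x) = (fun x => dedens u (delta z) x - B x).
    by apply/funext => x; rewrite dE addrK.
  exact: summB.
have As : summ A.
  have -> : A = (fun x => 2 * (2^-1 * A x)) by apply/funext => x; rewrite mulVKf.
  exact: summZ.
have Cs : summ C.
  have [K uK] := bu; apply: (summ_le (summZ (2 * K) (Wsumm z))) => x.
  rewrite /C normrM (ger0_norm (Wge0 _ _)) mulrC ler_wpM2r//.
  by apply: le_trans (ler_normB _ _) _; rewrite mulr_natl mulr2n lerD.
have pE : plap_term u z = (fun x => N u z `^ (p - 2) * C x + A x).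
  apply/funext => x; rewrite /plap_term /A /C.
  by move: (W z x) (N u z `^ _) (N u x `^ _) => a b c; ring.
have Cs' := summZ (N u z `^ (p - 2)) Cs.
split; first by rewrite pE; exact: summD.
have -> : tsum (dedens u (delta z)) = 2^-1 * tsum A + B z.
  rewrite -tB -(tsumZ 2^-1 As) -(tsumD As' Bs); congr tsum; exact/funext.
have pT : tsum (plap_term u z) = N u z `^ (p - 2) * tsum C + tsum A.
  by rewrite pE -(tsumZ (N u z `^ (p - 2)) Cs); exact: tsumD.
rewrite frac_p_laplacianE pT.
rewrite /B eqxx /dedens frac_grad_prodE.
have -> : gterm u (delta z) z = C.
  apply/funext => y; rewrite /gterm /C /delta eqxx.
  by have [->|yz] := eqVneq y z; rewrite ?subrr ?mulr0 ?mul0r// subr0 mulr1.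
rewrite /delta eqxx mulr1.
move: (tsum A) (tsum C) (N u z `^ _) (`|_| `^ _) mz => a c n k /lt0r_neq0 mz; by field.
Qed.

(** The energy is summable, so only finitely many values of [|u|] are at least [|u x|]. *)
Lemma min_attained u x : fin_energy u -> u x < 0 -> exists z, u z < 0 /\ forall y, u z <= u y.
Proof.
move=> fu ux; pose c := `|u x|.
have c0 : 0 < c by rewrite normr_gt0 lt_eqF.
pose e := hm * (c `^ p * m0) / 2.
have e0 : 0 < e by rewrite divr_gt0// !mulr_gt0// powR_gt0.
have [A hA] := summ_tail fu e0.
have out y : y \notin A -> u x < u y.
  move=> yA; have dis : [disjoint A & [fset y]]%fset by rewrite fdisjointX1.
  have := hA _ dis; rewrite /psum big_seq_fset1 ger0_norm ?edens_ge0// => hy.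
  rewrite ltNge; apply/negP => uyx.
  have cy : c <= `|u y| by rewrite /c !ltr0_norm ?lerN2// (le_lt_trans uyx).
  have h1 : c `^ p * m0 <= `|u y| `^ p * m y.
    by rewrite ler_pM ?powR_ge0 ?(ltW m0_gt0)// le_powR// ?(ltW p_gt0) ?(ltW c0).
  have := le_trans h1 (pmass_term_le u y); rewrite ler_pdivlMl// => /le_trans /(_ hy).
  by rewrite /e; apply/negP; rewrite -ltNge ltr_pdivrMr// ltr_pMr ?ltr1n// !mulr_gt0// powR_gt0.
have xA : x \in A by apply/negPn/negP => /out; rewrite ltxx.
pose z := [arg min_(i < [` xA]%fset) u (val i)]%O.
have hz (i : A) : u (val z) <= u (val i) by rewrite /z; case: arg_minP => // k _; exact.
have zx := hz [` xA]%fset; rewrite /= in zx.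
exists (val z); split; first exact: le_lt_trans zx ux.
move=> y; have [yA|/out/ltW] := boolP (y \in A); first exact: (hz [` yA]%fset).
exact: le_trans.
Qed.

Lemma powR_gt0N (a q : R) : a < 0 -> 0 < `|a| `^ q.
Proof. by move=> a0; rewrite powR_gt0// normr_gt0 lt_eqF. Qed.

(** Minimum principle: at a negative minimum the operator and the term with [h] are
    nonpositive, the latter strictly, while the right-hand side vanishes. *)
Lemma solution_ge0 u : fin_energy u ->
  (forall z, frac_p_laplacian G s p u z + h z * `|u z| `^ (p - 2) * u z = fpos f z (u z)) ->
  forall x, 0 <= u x.
Proof.
move=> fu eqn x; rewrite leNgt; apply/negP => /(min_attained fu)[z [uz minz]].
have := eqn z; rewrite (fpos_neg A1 z (ltW uz)) => /eqP; apply/negP; rewrite lt_eqF//.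
rewrite -(addr0 0) ler_ltD//; last by rewrite nmulr_llt0// mulr_gt0// powR_gt0N.
rewrite frac_p_laplacianE mulr_ge0_le0//; first by rewrite invr_ge0 mulr_ge0// ltW ?mu_gt0.
have : 0 <= tsum (fun y => - plap_term u z y).
  apply: tsum_ge0 => y; rewrite oppr_ge0 /plap_term mulr_ge0_le0 ?subr_le0//.
  by apply: (mulr_ge0 (Wge0 z y)); rewrite addr_ge0 ?powR_ge0.
by rewrite tsumN ?oppr_ge0//; exact: (first_variation_delta z fu).1.
Qed.

Hypothesis Wpos : forall x y, x != y -> edge G x y -> 0 < W x y.

(** At a zero of a nonnegative solution the operator is a sum of nonpositive terms equal
    to 0, so every term vanishes. For a neighbour [y] with [u y > 0] this forces [|grad
    u|^(p-2) = 0] at [x], although the term [y] makes the gradient positive there. *)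
Lemma zero_spreads u x y : fin_energy u -> (forall z, 0 <= u z) ->
  (forall z, frac_p_laplacian G s p u z + h z * `|u z| `^ (p - 2) * u z = fpos f z (u z)) ->
  u x = 0 -> edge G x y -> u y = 0.
Proof.
move=> fu u0 eqn ux xy; have [<-//|xney] := eqVneq x y.
have Wxy := Wpos xney xy; have mx := mu_gt0 G x; have bu := fin_bounded fu.
have [ps _] := first_variation_delta x fu.
have := eqn x; rewrite ux mulr0 addr0 (fpos_neg A1 x (lexx 0)) frac_p_laplacianE => /eqP.
rewrite mulf_eq0 invr_eq0 mulf_eq0 pnatr_eq0 (gt_eqF mx) /= => /eqP T0.
have t0 : forall z, - plap_term u x z = 0.
  apply: tsum_eq0; [|exact: summN|by rewrite tsumN// T0 oppr0].
  move=> z; rewrite oppr_ge0 /plap_term ux sub0r mulr_ge0_le0 ?oppr_le0//.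
  by apply: (mulr_ge0 (Wge0 x z)); rewrite addr_ge0 ?powR_ge0.
have := t0 y; rewrite /plap_term ux sub0r => /eqP; rewrite oppr_eq0 mulf_eq0 oppr_eq0.
case/orP => [|/eqP//]; rewrite mulf_eq0 (gt_eqF Wxy) /= => P0.
apply/eqP/negP => /negP uy.
have Nx : 0 < N u x.
  rewrite lt_neqAle grad_norm_ge0 andbT eq_sym -sqrf_eq0 grad_norm_sqr frac_grad_prodE.
  rewrite mulf_neq0 ?invr_eq0 ?mulf_neq0 ?pnatr_eq0 ?(gt_eqF mx)//.
  have gy : 0 < gterm u u x y.
    by rewrite /gterm ux sub0r -mulrA mulrNN (mulr_gt0 Wxy)// -expr2 exprn_even_gt0.
  rewrite gt_eqF//; apply: (lt_le_trans gy); apply: le_tsum1; last exact: gterm_summ.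
  by move=> z; exact: gterm_ge0.
move: P0; apply/negP; rewrite gt_eqF// ltr_wpDr ?powR_ge0//.
exact: powR_gt0.
Qed.

Lemma zero_everywhere u x : connected_graph G -> fin_energy u -> (forall z, 0 <= u z) ->
  (forall z, frac_p_laplacian G s p u z + h z * `|u z| `^ (p - 2) * u z = fpos f z (u z)) ->
  u x = 0 -> u = (fun=> 0).
Proof.
move=> [_ conn] fu u0 eqn ux; apply/funext => y; have [n [q [pq <- _]]] := conn x y.
elim: q x ux pq => [|a q IH] x ux //= /andP[xa pq]; apply: IH pq.
exact: (zero_spreads fu u0 eqn ux xa).
Qed.

(** * The weak form *)

Definition rterm u w x := fpos f x (u x) * w x * m x.

(** The density of the difference of the two sides of the weak equation. *)
Definition wresidual u w x := dedens u w x - rterm u w x.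

Lemma wresidualZD u c v w x : fbounded u -> fbounded v -> fbounded w ->
  wresidual u (fun y => c * v y + w y) x = c * wresidual u v x + wresidual u w x.
Proof.
move=> bu bv bw; have bc := fboundedZ c bv.
by rewrite /wresidual /dedens /rterm gradDr// gradZr//; ring.
Qed.

Lemma rterm_le u : fin_energy u -> exists2 C : R, 0 <= C & forall w L x, 0 < L ->
  `|rterm u w x| <= C * (L * edens u x + L `^ (1 - p) * edens w x).
Proof.
move=> fu; have [M uM] := fin_bounded fu.
have M1 : 0 < `|M| + 1 by rewrite ltr_wpDl.
have [C C0 hC] := fpos_growth A1 A2 A5 M1.
exists (C * hm^-1); first by rewrite mulr_ge0// invr_ge0 ltW.
move=> w L x L0; rewrite /rterm normrM (gtr0_norm (mu_gt0 G x)).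
have hf : `|fpos f x (u x)| <= C * `|u x| `^ (p - 1).
  rewrite ger0_norm ?(fpos_ge0 p2 A1 alpha_gt A3)//; apply: hC.
  by rewrite (le_trans (uM x))// (le_trans (ler_norm M))// lerDl.
have p1 : 1 < p by apply: lt_le_trans p2; rewrite ltr1n.
have E := powR_split_young p1 L0 (normr_ge0 (u x)) (normr_ge0 (w x)).
have h1 : `|fpos f x (u x) * w x| <= C * (L * `|u x| `^ p + L `^ (1 - p) * `|w x| `^ p).
  rewrite normrM; apply: (@le_trans _ _ (C * `|u x| `^ (p - 1) * `|w x|));
    first by rewrite ler_wpM2r.
  by rewrite -mulrA ler_wpM2l.
apply: (le_trans (ler_wpM2r (ltW (mu_gt0 G x)) h1)).
rewrite -!mulrA ler_wpM2l// mulrDl.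
have a1 := ler_wpM2l (ltW L0) (pmass_term_le u x).
have a2 := ler_wpM2l (powR_ge0 L (1 - p)) (pmass_term_le w x).
have -> : hm^-1 * (L * edens u x + L `^ (1 - p) * edens w x) =
   L * (hm^-1 * edens u x) + L `^ (1 - p) * (hm^-1 * edens w x) by ring.
by rewrite -!mulrA lerD.
Qed.

Lemma rterm_summ u w : fin_energy u -> fin_energy w -> summ (rterm u w).
Proof.
move=> fu fw; have [C C0 hC] := rterm_le fu.
apply: (summ_le (summZ C (summD fu fw))) => x.
by have := hC w 1 x ltr01; rewrite mul1r powR1 mul1r.
Qed.

Lemma wresidual_summ u w : fin_energy u -> fin_energy w -> summ (wresidual u w).
Proof. by move=> fu fw; apply: summB; [exact: dedens_summ|exact: rterm_summ]. Qed.

Lemma wresidual_Cc u : fin_energy u -> (forall z, tsum (wresidual u (delta z)) = 0) ->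
  forall v, Cc v -> tsum (wresidual u v) = 0.
Proof.
move=> fu ud v /Cc_sum ->; have bu := fin_bounded fu.
elim: (enum_fset _) => [|z r IH].
  under eq_fun do rewrite big_nil.
  have w0 x : wresidual u (fun=> 0) x = 0.
    have b0 := fin_bounded fin0.1; have := wresidualZD (-1) x bu b0 b0.
    have -> : (fun _ : V => -1 * 0 + 0 : R) = (fun=> 0) by apply/funext => y; rewrite mulr0 addr0.
    by move->; rewrite mulN1r addNr.
  by have [_ ->] := summ_finsupp (A := fset0) (fun x _ => w0 x); rewrite /psum big_seq_fset0.
under eq_fun do rewrite big_cons.
have fr := finsum_fin v r.
have -> : wresidual u (fun x => v z * delta z x + \sum_(z <- r) v z * delta z x) =
   (fun x => v z * wresidual u (delta z) x + wresidual u (fun x =>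
     \sum_(z <- r) v z * delta z x) x).
  by apply/funext => x; apply: wresidualZD => //; [exact: delta_bounded|exact: fin_bounded].
have ws := wresidual_summ fu (delta_fin z).
by rewrite (tsumD (summZ (v z) ws) (wresidual_summ fu fr)) (tsumZ (v z) ws) ud mulr0 IH addr0.
Qed.

(** The residual is linear in the test function and vanishes on finitely supported ones,
    so it takes the same value on [w] and on [w - v] with [v] finitely supported and [w
    - v] of small energy. It is bounded there by [K (L energy(u) + L^(1-p) energy(w -
    v))], small for a small [L] chosen first. *)
Lemma wresidual_Hsp u : fin_energy u -> (forall z, tsum (wresidual u (delta z)) = 0) ->
  forall w, Hsp G s p h w -> tsum (wresidual u w) = 0.
Proof.
move=> fu ud w /HspP[fw ws]; have [C C0 hC] := rterm_le fu.
pose K := 1 + C; have K0 : 0 < K by rewrite ltr_wpDr.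
have bound v L : fin_energy v -> 0 < L -> `|tsum (wresidual u v)| <= K * (L * energy u + L `^ (1
  - p) * energy v).
  move=> fv L0; have wv := wresidual_summ fu fv.
  have s1 := summZ L fu; have s2 := summZ (L `^ (1 - p)) fv.
  apply: (le_trans (normr_tsum wv)); rewrite /energy -!tsumZ// -tsumD// -tsumZ; last exact: summD.
  apply: le_tsum; [exact/summ_norm|by apply: summZ; exact: summD|].
  move=> x; apply: (le_trans (ler_normB _ _)); rewrite mulrDl mul1r lerD//; last exact: hC.
  by apply: dedens_le => //; exact: fin_bounded.
apply: contrapT => /eqP; rewrite -normr_gt0 => D0; set D := `|_| in D0.
have E0 := energy_ge0 u; have E1 : 0 < energy u + 1 by rewrite ltr_wpDl.
(* L and then e make each of the two terms of the bound less than D / 2. *)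
pose L := D / (2 * K * (energy u + 1)).
have L0 : 0 < L by rewrite divr_gt0// !mulr_gt0.
have Lp : 0 < L `^ (1 - p) by rewrite powR_gt0.
pose e := D / (2 * K * L `^ (1 - p)).
have e0 : 0 < e by rewrite divr_gt0// !mulr_gt0.
have [v Cv ve] := ws e e0; have fv := Cc_fin Cv.
have [fwv _] := fin_energyB fw fv.
have Dv : tsum (wresidual u w) = tsum (wresidual u (fun x => w x - v x)).
  have -> : wresidual u w = (fun x => 1 * wresidual u v x + wresidual u (fun x => w x - v x) x).
    apply/funext => x; rewrite -wresidualZD; [|exact: fin_bounded..].
    by congr (wresidual u _ x); apply/funext => y; rewrite mul1r addrC subrK.
  rewrite tsumD; [|by apply: summZ; exact: wresidual_summ|exact: wresidual_summ].
  by rewrite tsumZ ?(wresidual_Cc fu ud Cv) ?mulr0 ?add0r//; exact: wresidual_summ.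
have := bound _ _ fwv L0; rewrite -Dv -/D; apply/negP; rewrite -ltNge.
have h1 : K * (L * energy u) < D / 2.
  have -> : D / 2 = K * (L * (energy u + 1)).
    by rewrite /L; move: (lt0r_neq0 K0) (lt0r_neq0 E1) => k1 k2; field; rewrite k1 k2.
  by rewrite ltr_pM2l// ltr_pM2l// ltrDl.
have h2 : K * (L `^ (1 - p) * energy (fun x => w x - v x)) < D / 2.
  have -> : D / 2 = K * (L `^ (1 - p) * e).
    by rewrite /e; move: (lt0r_neq0 K0) (lt0r_neq0 Lp) => k1 k2; field; rewrite k1 k2.
  by rewrite ltr_pM2l// ltr_pM2l.
by have := ltrD h1 h2; rewrite -splitr mulrDr.
Qed.

Lemma weak_form u : Hsp G s p h u -> (forall x, 0 <= u x) ->
  (forall z, tsum (dedens u (delta z)) = fpos f z (u z) * m z) -> weak_solution G s p h f u.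
Proof.
move=> Hu u0 ueq; split => // w Hw lhs rhs; have fu := Hsp_fin Hu; have fw := Hsp_fin Hw.
have ds := dedens_summ fu fw; have rs := rterm_summ fu fw.
have rE : rterm u w = (fun x => rhs x * m x).
  by apply/funext => x; rewrite /rterm /rhs (fpos_pos f x (u0 x)).
have dE : dedens u w = (fun x => lhs x * m x) by [].
split; [by apply/summable_summ; rewrite -dE|by apply/summable_summ; rewrite -rE|].
rewrite /vint -/(tsum _) -/(tsum _) -rE -dE; apply/eqP; rewrite -subr_eq0 -tsumB//; apply/eqP.
apply: (wresidual_Hsp fu _ Hw) => z; rewrite /wresidual.
have [rz1 rz2] := @tsum1 _ _ (rterm u (delta z)) z (fun x xz =>
  ltac:(by rewrite /rterm /delta (negbTE xz) mulr0 mul0r)).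
rewrite tsumB//; last exact: dedens_summ (delta_fin z).
by rewrite ueq rz2 /rterm /delta eqxx mulr1 subrr.
Qed.

(** * The ground state *)

Lemma vint_ge0_Bn u : fin_energy u -> vint_ge0 G (fun x =>
  f x (pos_part u x) * pos_part u x) = (Bn u)%:E.
Proof. by move=> /Bt_Ct_summ[bs _];
  exact: (esum_fin (Bt_ge0 u) (fun A => psum_le_tsum A (Bt_ge0 u) bs)). Qed.

Lemma vint_ge0_Cn u : fin_energy u -> vint_ge0 G (fun x =>
  primitive f x (pos_part u x)) = (Cn u)%:E.
Proof. by move=> /Bt_Ct_summ[_ cs];
  exact: (esum_fin (Ct_ge0 u) (fun A => psum_le_tsum A (Ct_ge0 u) cs)). Qed.

Lemma functionalE u : fin_energy u -> functional G s p h f u = (functional_real u)%:E.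
Proof. by move=> fu; rewrite /functional p_energyE// vint_ge0_Cn. Qed.

Lemma nehariP u : nehari G s p h f u <-> [/\ Hsp G s p h u, u <> (fun=> 0) & energy u = Bn u].
Proof.
split => -[Hu u0 EB]; split => //; have fu := Hsp_fin Hu.
  by move: EB; rewrite p_energyE// vint_ge0_Bn// => -[].
by rewrite p_energyE// vint_ge0_Bn// EB.
Qed.

Lemma nehari_relaxed u : nehari G s p h f u -> relaxed u.
Proof. by move=> /nehariP[Hu u0 EB]; split => //; rewrite EB. Qed.

(** On the Nehari set, which is part of the relaxed one, the functional coincides with
    [Jn]. *)
Lemma minimizer_ground_level u : relaxed u -> (forall v, relaxed v -> Jn u <= Jn v) ->
  nehari G s p h f u /\ functional G s p h f u = ground_level G s p h f.
Proof.
move=> Nu minu; have EB := minimizer_nehari Nu minu; have [Hu u0 _] := Nu.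
have Nh : nehari G s p h f u by apply/nehariP.
have fu := Hsp_fin Hu; split => //; apply/eqP; rewrite eq_le; apply/andP; split; last first.
  by apply: ereal_inf_lbound; exists u.
apply: le_ereal_inf_tmp => _ [v Nv <-].
have /nehariP[Hv _ EBv] := Nv; have fv := Hsp_fin Hv.
rewrite (functionalE fu) (functionalE fv) lee_fin (functional_real_nehari fu EB)
  (functional_real_nehari fv EBv).
exact/minu/nehari_relaxed.
Qed.

Lemma ground_state_exists : connected_graph G -> exists u : V -> R,
  [/\ ground_state_solution G s p h f u, pointwise_solution G s p h f u & forall x, 0 < u x].
Proof.
move=> Gconn; have [z0 _] := Gconn.1.
have [u Nu minu] := relaxed_minimizer z0; have [Hu u0 _] := Nu; have fu := Hsp_fin Hu.
have EL z := euler_lagrange z Nu minu.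
have eqn z : frac_p_laplacian G s p u z + h z * `|u z| `^ (p - 2) * u z = fpos f z (u z).
  apply: (mulfI (lt0r_neq0 (mu_gt0 G z))).
  by rewrite -(first_variation_delta z fu).2 EL mulrC.
have pos := solution_ge0 fu eqn.
have [Nh gl] := minimizer_ground_level Nu minu.
exists u; split.
- by split => //; exact: weak_form.
- by move=> z; rewrite eqn fpos_pos.
- move=> x; rewrite lt_neqAle pos andbT; apply/eqP => ux.
  exact/u0/(zero_everywhere Gconn fu pos eqn (esym ux)).
Qed.

End Energy.

(** * Finiteness of distance balls *)

Section Balls.
Context {R : realType} {V : countType} (G : weighted_graph R V).
Hypothesis Glf : locally_finite G.
Implicit Types x y z : V.

(** By induction on the length: the first step of a longer walk starts at a neighbour of
    one of finitely many vertices. *)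
Lemma walks_finite x n : finite_set [set y | walk G y x n].
Proof.
elim: n => [|n IH].
  apply: (@sub_finite_set _ _ [set x]); last exact: finite_set1.
  by move=> y [q [_ <- /size0nil ->]].
apply: (@sub_finite_set _ _ (\bigcup_(a in [set a | walk G a x n]) [set y | edge G a y])).
  move=> y [q]; case: q => [[_ _ //]|a q [/= /andP[ya pq] lq [sq]]].
  by exists a; [exists q|rewrite /= edge_sym].
by apply: bigcup_finite => // a _; exact: Glf.
Qed.

Lemma graph_dist_walk x y : (exists n, walk G x y n) -> walk G x y (graph_dist G x y).
Proof.
move=> ex; rewrite /graph_dist.
have [n [wn minn]] : exists n, [set n | walk G x y n /\ forall m, walk G x y m -> (n <= m)%N] n.
  have ex' : exists n, `[< walk G x y n >] by have [n wn] := ex; exists n; apply/asboolP.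
  have [n /asboolP wn minn] := ex_minnP ex'.
  by exists n; split => // k wk; apply: minn; apply/asboolP.
by case: xgetP => [k -> []//|/(_ n)] /(_ (conj wn minn)).
Qed.

Lemma ball_finite x N : connected_graph G -> finite_set [set y | (graph_dist G y x < N)%N].
Proof.
move=> [_ conn].
apply: (@sub_finite_set _ _ (\bigcup_(n in `I_N) [set y | walk G y x n])).
  by move=> y /= yN; exists (graph_dist G y x) => //; exact/graph_dist_walk/conn.
by apply: bigcup_finite => // n _; exact: walks_finite.
Qed.
End Balls.

(** * Existence of a strictly positive ground state *)

Lemma inf_range_le {R : realType} {T : Type} (g : T -> R) : 0 < inf (range g) ->
  forall x, inf (range g) <= g x.
Proof.
move=> g0 x; have [[_ lg]|ng] := pselect (has_inf (range g)); last by rewrite inf_out ?ltxx in g0.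
by apply: ge_inf => //; exists x.
Qed.

(** A bound of the upper limit from above holds on some interval [(0, d)], with a real
    number below [b]; the supremum over [x] inside makes it uniform. *)
Lemma limf_esup_bound {R : realType} {T : Type} (g : T -> R -> R) (b : \bar R) :
  (limf_esup (fun y : R => ereal_sup (range (fun x : T => (g x y)%:E))) (0 : R)^'+ < b)%E ->
  exists l d : R, [/\ 0 < d, (l%:E < b)%E & forall x y, 0 < y -> y < d -> g x y <= l].
Proof.
move=> /ereal_inf_lt[_ [B [d /= d0 Bd] <-]] sb.
have [l sl lb] : exists2 l : R, (ereal_sup [set ereal_sup (range (fun x : T =>
  (g x y)%:E)) | y in B] <= l%:E)%E & (l%:E < b)%E.
  move: (ereal_sup _) sb => [r||]; first by exists r.
    by case: b.
  case: b => [r _|_|//].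
  - by exists (r - 1); rewrite ?leNye// lte_fin gtrBl.
  - by exists 0; rewrite ?leNye// ltry.
exists l, d; split => // x y y0 yd; rewrite -lee_fin; apply: le_trans sl.
apply: (@le_trans _ _ (ereal_sup (range (fun x : T => (g x y)%:E)))).
  by apply: ereal_sup_ubound; exists x.
apply: ereal_sup_ubound; exists y => //; apply: Bd => //=.
by rewrite sub0r normrN gtr0_norm.
Qed.

Theorem theorem5 (R : realType) (V : countType) (G : weighted_graph R V)
    (s p : R) (h : V -> R) (f : V -> R -> R)
    (Gconn : connected_graph G)
    (Glf : locally_finite G)
    (Gsc : stochastically_complete G)
    (s_gt0 : 0 < s) (s_lt1 : s < 1) (p_ge2 : 2 <= p)
    (mu_inf : 0 < inf (range (mu G)))
    (h_inf : 0 < inf (range h))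
    (h_infty : forall x0 : V, forall M : R, exists N : nat, forall x : V,
        (N <= graph_dist G x x0)%N -> M <= h x)
    (A1 : forall x : V, {within `[0, +oo[, continuous (f x)} /\ f x 0 = 0)
    (A2 : forall M : R, 0 < M -> exists C : R, forall (x : V) (y : R),
        0 <= y <= M -> f x y <= C)
    (A3 : exists2 alpha : R, p < alpha & forall (x : V) (y : R), 0 < y ->
        0 < alpha * primitive f x y /\ alpha * primitive f x y <= y * f x y)
    (A4 : (limf_esup
             (fun y : R => ereal_sup (range (fun x : V =>
                (f x y / y `^ (p - 1))%:E))) 0^'+
           < lambda_p G s p h)%E)
    (A5 : forall (x : V) (y z : R), 0 < y -> y < z ->
        f x y / y `^ (p - 1) < f x z / z `^ (p - 1)) :
  exists u : V -> R,
    [/\ ground_state_solution G s p h f u,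
        pointwise_solution G s p h f u
      & forall x : V, 0 < u x].
Proof.
have [alpha alpha_gt A3'] := A3.
have [l [d [d0 ll hl]]] := limf_esup_bound A4.
have h_ge := inf_range_le h_inf.
apply: (ground_state_exists (Ws_ge0 Glf s_gt0 s_lt1) (Ws_summ Glf Gsc s_gt0 s_lt1) p_ge2 _
  mu_inf (inf_range_le mu_inf) h_inf h_ge (Ws_sym s Glf) A1 A2 alpha_gt A3' A5
  _ d0 ll _ (Ws_gt0 Glf Gsc s_gt0 s_lt1) Gconn).
- by move=> x; exact: lt_le_trans (h_ge x).
- move=> M; have [x0 _] := Gconn.1; have [N hN] := h_infty x0 M.
  exists (fset_set [set x | (graph_dist G x x0 < N)%N]) => x.
  rewrite in_fset_set; last exact: ball_finite.
  by rewrite notin_setE /= => /negP; rewrite -leqNgt; exact: hN.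
- by move=> x y y0 yd; rewrite -ler_pdivrMr ?powR_gt0//; exact: hl.
Qed.
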